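(* Let $\mathbf{k}$ be an algebraically closed field of characteristic $0$, let $n,d\ge 1$, let $\mathcal{H}=\mathrm{Hilb}^d_{\mathbb{A}^n/\mathbf{k}}$ and let $\mathcal{B}\subseteq\mathcal{H}$ be the barycenter scheme. If $[I]\in\mathcal{B}$ is a hedgehog point, then $[I]$ is a non-reduced point of $\mathcal{B}$ (i.e. the local ring $\mathcal{O}_{\mathcal{B},[I]}$ is not reduced). Hence $(0,[I])\in\mathbb{A}^n\times\mathcal{B}\simeq\mathcal{H}$ is a non-reduced point of $\mathcal{H}$ as well.
   Context: Let $S=\mathbf{k}[\alpha_1,\dots,\alpha_n]$ and, for a $\mathbf{k}$-algebra $A$, $S_A=A[\alpha_1,\dots,\alpha_n]$. $\mathcal{H}=\mathrm{Hilb}^d_{\mathbb{A}^n/\mathbf{k}}$ is the scheme whose $A$-points $[I]$ are ideals $I\subseteq S_A$ such that $S_A/I$ is a finite flat $A$-module of rank $d$. $\mathbb{G}_m$-action: $\mathbb{G}_m$ acts on $\mathcal{H}$ via scaling on $\mathbb{A}^n$: for $a\in A^*$, $a\cdot[I]$ is the ideal $\ker(S_A\to S_A\to S_A/I)$, where the first map is $\alpha_i\mapsto a\alpha_i$. If $\mathbb{G}_m$ acts on a vector space $W$, put $W_k=\{w: t\in\mathbb{G}_m \text{ acts on } w \text{ by multiplication by } t^{-k}\}$. (At a fixed point $[I]$, i.e. $I$ homogeneous, under $T_{[I]}\mathcal{H}=\mathrm{Hom}_S(I,S/I)$ the degree $k$ part consists of the $\delta$ with $\delta(I_m)\subseteq(S/I)_{m+k}$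 for all $m$.) Barycenter scheme: $Bar:\mathcal{H}\to\mathbb{A}^n$ is the Hilbert–Chow morphism $\mathcal{H}\to(\mathbb{A}^n)^d/\!\!/\mathbb{S}_d$ followed by the averaging map $(\mathbb{A}^n)^d/\!\!/\mathbb{S}_d\to\mathbb{A}^n$. Concretely, on an $A$-point given by a free $A$-algebra $R=S_A/I$, it corresponds to $\alpha_j\mapsto\frac1d \mathrm{Tr}_{R/A}(\alpha_j)$. The barycenter scheme is $\mathcal{B}=Bar^{-1}(0)$, a closed $\mathbb{G}_m$-stable subscheme. Translation gives an isomorphism $\mathbb{A}^n\times\mathcal{B}\simeq\mathcal{H}$, $(v,[Z])\mapsto[v+Z]$. Białynicki-Birula decomposition: $\mathcal{B}^+$ is the scheme representing the functor $T\mapsto\{\mathbb{G}_m\text{-equivariant } \mathbb{A}^1\times T\to\mathcal{B}\}$, where $\mathbb{G}_m$ acts by multiplication on $\mathbb{A}^1$ and trivially on $T$. $\pi:\mathcal{B}^+\to\mathcal{B}^{\mathbb{G}_m}$ is restriction to $0\times T$. Negative spike and hedgehog point: for a $\mathbb{G}_m$-fixed $\mathbf{k}$-point $[I]\in\mathcal{B}$ the negative spike at $[I]$ is the scheme-theoretic fiber $V=\pi^{-1}([I])\subseteq\mathcal{B}^+$. The point $[I]$ is a hedgehog point if: (1) $(T_{[I]}\mathcal{B})_{>0}=0$; (2) $T_{[I]}\mathcal{B}\ne(T_{[I]}\mathcal{B})_0$; (3) $V$ is $0$-dimensional (equivalently, there is no closed point $[I']\neq[I]$ of $\mathcal{B}$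 with $\lim_{t\to0}t\cdot[I']=[I]$). *)

(* Defs.v *)
From HB Require Import structures.
From mathcomp Require Import all_boot all_order all_algebra.
From mathcomp Require Export mpoly.

Set Implicit Arguments.
Unset Strict Implicit.
Unset Printing Implicit Defensive.

Import GRing.Theory.
Local Open Scope ring_scope.

(* Schemes over k are described by their functors of points.  Since the rings
   below are nontrivial, functors are only evaluated on nonzero k-algebras,
   which loses nothing: X(0) is a singleton for every scheme X. *)

Section Ideals.
Context (R : comNzRingType).
Implicit Types (I J P : R -> Prop).

Definition is_ideal I : Prop :=
  [/\ I 0, (forall x y, I x -> I y -> I (x + y)) & (forall a x, I x -> I (a * x))].

Definition ideal_eq I J : Prop := forall x, I x <-> J x.

Definition ideal_gen P (x : R) : Prop :=
  exists (m : nat) (a p : 'I_m -> R),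
    (forall i, P (p i)) /\ x = \sum_(i < m) a i * p i.

Definition is_prime_ideal P : Prop :=
  [/\ is_ideal P, ~ P 1 & (forall x y, P (x * y) -> P x \/ P y)].

Definition is_maximal_ideal P : Prop :=
  [/\ is_ideal P, ~ P 1 &
      (forall J, is_ideal J -> (forall x, P x -> J x) -> ~ J 1 -> ideal_eq J P)].

(* Krull dimension 0, for the nonzero ring R. *)
Definition krull_dim0 : Prop := forall P, is_prime_ideal P -> is_maximal_ideal P.

End Ideals.

(* k-algebras.  The structure map is kept separate from the ring so that
   A[t] can carry both its A-algebra and its k-algebra structure. *)

Record kalg (k : comNzRingType) := KAlg {
  kalg_ring :> comNzRingType;
  kalg_str : {rmorphism k -> kalg_ring} }.

Record khom (k : comNzRingType) (A B : kalg k) := KHom {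
  khom_fun :> {rmorphism A -> B};
  khom_str : forall c : k, khom_fun (kalg_str A c) = kalg_str B c }.

Definition base_kalg (k : comNzRingType) : kalg k := KAlg [the {rmorphism k -> k} of idfun].

Definition poly_kalg (k : comNzRingType) (A : kalg k) : kalg k :=
  KAlg [the {rmorphism k -> {poly A}} of @polyC A \o kalg_str A].

(* A[t] -> C extending phi : A -> C and sending t to c. *)
Definition poly_eval (A C : comNzRingType) (phi : {rmorphism A -> C}) (c : C)
  : {rmorphism {poly A} -> C} :=
  [the {rmorphism {poly A} -> C} of horner_eval c \o map_poly phi].

(* Dual numbers: (a, b) stands for a + b e with e ^ 2 = 0. *)

Definition dual (R : comNzRingType) : Type := (R * R)%type.

Section Dual.
Context (R : comNzRingType).
HB.instance Definition _ := GRing.Zmodule.copy (dual R) (R * R)%type.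

Definition dual_one : dual R := (1, 0).
Definition dual_mul (x y : dual R) : dual R := (x.1 * y.1, x.1 * y.2 + x.2 * y.1).

Fact dual_mulA : associative dual_mul.
Proof.
move=> [a a'] [b b'] [c c']; rewrite /dual_mul /= mulrA; congr pair.
by rewrite mulrDr mulrDl !mulrA addrA.
Qed.

Fact dual_mulC : commutative dual_mul.
Proof.
by move=> [a a'] [b b']; rewrite /dual_mul /= [a * b]mulrC [a * b']mulrC [a' * b]mulrC addrC.
Qed.

Fact dual_mul1 : left_id dual_one dual_mul.
Proof. by move=> [a a']; rewrite /dual_mul /= !mul1r mul0r addr0. Qed.

Fact dual_mulDl : left_distributive dual_mul +%R.
Proof.
move=> [a a'] [b b'] [c c']; rewrite /dual_mul /= !mulrDl; congr pair => /=.
by rewrite addrACA.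
Qed.

Fact dual_one_neq0 : dual_one != 0.
Proof. by apply/eqP => -[/eqP]; rewrite oner_eq0. Qed.

HB.instance Definition _ := GRing.Zmodule_isComNzRing.Build (dual R)
  dual_mulA dual_mulC dual_mul1 dual_mulDl dual_one_neq0.

Definition dualC (c : R) : dual R := (c, 0).

Fact dualC_zmod : zmod_morphism dualC.
Proof. by move=> a b; congr pair; rewrite /= subr0. Qed.

Fact dualC_monoid : monoid_morphism dualC.
Proof. by split=> // a b; congr pair; rewrite /= mulr0 mul0r addr0. Qed.

HB.instance Definition _ := GRing.isZmodMorphism.Build R (dual R) dualC dualC_zmod.
HB.instance Definition _ := GRing.isMonoidMorphism.Build R (dual R) dualC dualC_monoid.

Definition dual0 (x : dual R) : R := x.1.

Fact dual0_zmod : zmod_morphism dual0. Proof. by []. Qed.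
Fact dual0_monoid : monoid_morphism dual0. Proof. by []. Qed.

HB.instance Definition _ := GRing.isZmodMorphism.Build (dual R) R dual0 dual0_zmod.
HB.instance Definition _ := GRing.isMonoidMorphism.Build (dual R) R dual0 dual0_monoid.

(* e |-> c e; pulling back along it multiplies tangent vectors by c. *)
Definition dual_scale (c : R) (x : dual R) : dual R := (x.1, c * x.2).

Fact dual_scale_zmod c : zmod_morphism (dual_scale c).
Proof. by move=> x y; congr pair; rewrite /= mulrBr. Qed.

Fact dual_scale_monoid c : monoid_morphism (dual_scale c).
Proof.
split=> [|x y]; congr pair; rewrite /= ?mulr0 //.
by rewrite mulrDr !mulrA [c * x.1]mulrC.
Qed.

HB.instance Definition _ c :=
  GRing.isZmodMorphism.Build (dual R) (dual R) (dual_scale c) (dual_scale_zmod c).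
HB.instance Definition _ c :=
  GRing.isMonoidMorphism.Build (dual R) (dual R) (dual_scale c) (dual_scale_monoid c).

End Dual.

Definition dual_kalg (k : comNzRingType) : kalg k :=
  KAlg [the {rmorphism k -> dual k} of @dualC k].

(* A functor of points: X(A) is the set of x : fpt X A with fmem X x, up to
   feq; working with an ambient type avoids carrying membership proofs. *)

Record kfunctor (k : comNzRingType) := KFunctor {
  fpt : kalg k -> Type;
  fmem : forall A, fpt A -> Prop;
  feq : forall A, fpt A -> fpt A -> Prop;
  fmap : forall A B, khom A B -> fpt A -> fpt B }.

Arguments fmem {k} X {A} : rename.
Arguments feq {k} X {A} : rename.
Arguments fmap {k} X {A B} : rename.

Section Functors.
Context (k : comNzRingType) (X : kfunctor k).

(* X is isomorphic to Spec C, with universal point xi. *)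
Definition represents (C : kalg k) (xi : fpt X C) : Prop :=
  fmem X xi /\
  forall (A : kalg k) (x : fpt X A), fmem X x ->
    (exists phi : khom C A, feq X (fmap X phi xi) x) /\
    (forall phi psi : khom C A,
       feq X (fmap X phi xi) x -> feq X (fmap X psi xi) x -> phi =1 psi).

(* xi : Spec R -> X is an open immersion: it is a monomorphism, and for every
   x : Spec A -> X the preimage of its image is the complement of V(a) for
   some subset a of A, i.e. Spec A' -> Spec A factors through this preimage
   iff a generates the unit ideal of A'. *)
Definition affine_open (R : kalg k) (xi : fpt X R) : Prop :=
  [/\ fmem X xi,
      (forall (A : kalg k) (phi psi : khom R A),
         feq X (fmap X phi xi) (fmap X psi xi) -> phi =1 psi) &
      (forall (A : kalg k) (x : fpt X A), fmem X x ->
         exists a : A -> Prop, forall (A' : kalg k) (phi : khom A A'),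
           (exists psi : khom R A', feq X (fmap X psi xi) (fmap X phi x)) <->
           ideal_gen (fun b : A' => exists2 c, a c & b = phi c) 1)].

(* r / 1 = 0 in the localization of R at the prime ideal ker e. *)
Definition local_zero (R : kalg k) (e : khom R (base_kalg k)) (r : R) : Prop :=
  exists2 s : R, e s != 0 & s * r = 0.

(* The local ring of X at the k-point x, i.e. the localization at ker e of the
   coordinate ring R of an affine open neighbourhood, has a nonzero nilpotent.
   Elements of the form r / 1 suffice, as r / s is r / 1 times a unit. *)
Definition nonreduced_point (x : fpt X (base_kalg k)) : Prop :=
  exists (R : kalg k) (xi : fpt X R) (e : khom R (base_kalg k)),
    [/\ affine_open xi, feq X (fmap X e xi) x &
        exists (r : R) (N : nat), local_zero e (r ^+ N) /\ ~ local_zero e r].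

End Functors.

Section FamiliesOfIdeals.
Context (n : nat).

(* Below, J is an ideal of S_A = A[alpha_1, ..., alpha_n].
   This is the ideal J S_B, with S_B / J S_B = (S_A / J) (x)_A B. *)
Definition base_change (A B : comNzRingType) (phi : {rmorphism A -> B})
    (J : {mpoly A[n]} -> Prop) : {mpoly B[n]} -> Prop :=
  ideal_gen (fun g => exists2 f, J f & g = map_mpoly phi f).

Context (A : comNzRingType).
Implicit Types (J : {mpoly A[n]} -> Prop).

Definition quotient_finite J : Prop :=
  exists (m : nat) (e : 'I_m -> {mpoly A[n]}), forall f,
    exists a : 'I_m -> A, J (f - \sum_(i < m) a i *: e i).

(* Flatness of the A-module S_A / J, via the equational criterion: every
   linear relation in it follows from linear relations in A. *)
Definition quotient_flat J : Prop :=
  forall (m : nat) (a : 'I_m -> A) (x : 'I_m -> {mpoly A[n]}),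
    J (\sum_(i < m) a i *: x i) ->
    exists (r : nat) (b : 'I_m -> 'I_r -> A) (y : 'I_r -> {mpoly A[n]}),
      (forall i, J (x i - \sum_(j < r) b i j *: y j)) /\
      (forall j, \sum_(i < m) a i * b i j = 0).

Definition quotient_basis J (d : nat) (e : 'I_d -> {mpoly A[n]}) : Prop :=
  (forall f, exists a : 'I_d -> A, J (f - \sum_(i < d) a i *: e i)) /\
  (forall a : 'I_d -> A, J (\sum_(i < d) a i *: e i) -> forall i, a i = 0).

End FamiliesOfIdeals.

(* The fibres of S_A / J at the points of Spec A have dimension d. *)
Definition quotient_rank (n : nat) (A : comNzRingType) (J : {mpoly A[n]} -> Prop)
    (d : nat) : Prop :=
  forall (K : fieldType) (phi : {rmorphism A -> K}),
    exists e : 'I_d -> {mpoly K[n]}, quotient_basis (base_change phi J) e.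

Definition hilb_mem (n d : nat) (A : comNzRingType) (J : {mpoly A[n]} -> Prop) : Prop :=
  [/\ is_ideal J, quotient_finite J, quotient_flat J & quotient_rank J d].

(* u . [J] *)
Definition scale (n : nat) (A : comNzRingType) (u : A) (J : {mpoly A[n]} -> Prop)
    (f : {mpoly A[n]}) : Prop :=
  J (f \mPo [tuple u *: 'X_i | i < n]).

(* [v + Z], for Z the zero scheme of J. *)
Definition translate (n : nat) (A : comNzRingType) (v : 'I_n -> A)
    (J : {mpoly A[n]} -> Prop) (f : {mpoly A[n]}) : Prop :=
  J (f \mPo [tuple 'X_i + (v i)%:MP | i < n]).

Section HilbertScheme.
Context (k : fieldType) (n d : nat).

Definition Hilb : kfunctor k :=
  @KFunctor k (fun A => {mpoly A[n]} -> Prop)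
    (fun A J => hilb_mem d J)
    (fun A J J' => ideal_eq J J')
    (fun A B phi J => base_change phi J).

(* v is the barycenter of the A-point J.  The trace is computed after the base
   changes making S_A / J free; these include the localizations of A at the
   members of some generating family of the unit ideal, so v is unique. *)
Definition is_barycenter (A : kalg k) (J : {mpoly A[n]} -> Prop) (v : 'I_n -> A) : Prop :=
  forall (C : kalg k) (phi : khom A C) (e : 'I_d -> {mpoly C[n]}) (M : 'I_n -> 'M[C]_d),
    quotient_basis (base_change phi J) e ->
    (forall j i, base_change phi J ('X_j * e i - \sum_(l < d) M j i l *: e l)) ->
    forall j, phi (v j) = kalg_str C (d%:R^-1) * \tr (M j).

Definition bar_mem (A : kalg k) (J : {mpoly A[n]} -> Prop) : Prop :=
  hilb_mem d J /\ is_barycenter J (fun=> 0).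

Definition Bar : kfunctor k :=
  @KFunctor k (fun A => {mpoly A[n]} -> Prop)
    bar_mem
    (fun A J J' => ideal_eq J J')
    (fun A B phi J => base_change phi J).

(* Equivariance of the morphism A^1 x Spec A -> B given by an A[t]-point,
   tested on C-points of G_m x A^1 x Spec A. *)
Definition equivariant (A : comNzRingType) (J : {mpoly {poly A}[n]} -> Prop) : Prop :=
  forall (C : comNzRingType) (phi : {rmorphism A -> C}) (c u w : C), u * w = 1 ->
    ideal_eq (base_change (poly_eval phi (u * c)) J)
             (scale u (base_change (poly_eval phi c) J)).

Definition bar_plus_mem (A : kalg k) (J : {mpoly {poly A}[n]} -> Prop) : Prop :=
  bar_mem (A := poly_kalg A) J /\ equivariant J.

Definition Bar_plus : kfunctor k :=
  @KFunctor k (fun A => {mpoly {poly A}[n]} -> Prop)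
    bar_plus_mem
    (fun A J J' => ideal_eq J J')
    (fun A B phi J => base_change [the {rmorphism {poly A} -> {poly B}} of map_poly phi] J).

(* Restriction to 0 x Spec A. *)
Definition bar_pi (A : comNzRingType) (J : {mpoly {poly A}[n]} -> Prop)
  : {mpoly A[n]} -> Prop :=
  base_change (poly_eval [the {rmorphism A -> A} of idfun] 0) J.

Definition Spike (I : {mpoly k[n]} -> Prop) : kfunctor k :=
  @KFunctor k (fpt Bar_plus)
    (fun A J => fmem Bar_plus J /\ ideal_eq (bar_pi J) (base_change (kalg_str A) I))
    (@feq k Bar_plus)
    (@fmap k Bar_plus).

Definition Gm_fixed (I : {mpoly k[n]} -> Prop) : Prop :=
  forall (C : kalg k) (u w : C), u * w = 1 ->
    ideal_eq (scale u (base_change (kalg_str C) I)) (base_change (kalg_str C) I).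

(* Vectors of T_[I] B, as k[e]-points of B. *)
Definition tangent (I : {mpoly k[n]} -> Prop) (J : {mpoly (dual k)[n]} -> Prop) : Prop :=
  bar_mem (A := dual_kalg k) J /\
  ideal_eq (base_change [the {rmorphism dual k -> k} of @dual0 k] J) I.

Definition tangent_zero (I : {mpoly k[n]} -> Prop) : {mpoly (dual k)[n]} -> Prop :=
  base_change [the {rmorphism k -> dual k} of @dualC k] I.

(* The degree m part of T_[I] B: t acts as multiplication by t ^ (- m). *)
Definition tangent_deg (I : {mpoly k[n]} -> Prop) (m : int)
    (J : {mpoly (dual k)[n]} -> Prop) : Prop :=
  tangent I J /\
  forall t : k, t != 0 ->
    ideal_eq (scale (dualC t) J)
      (base_change [the {rmorphism dual k -> dual k} of dual_scale (t ^ (- m))] J).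

Record hedgehog (I : {mpoly k[n]} -> Prop) : Prop := Hedgehog {
  hedgehog_mem : fmem Bar (A := base_kalg k) I;
  hedgehog_fixed : Gm_fixed I;
  (* The positive part is the direct sum of its graded pieces. *)
  hedgehog_pos : forall (m : int) J, 0 < m -> tangent_deg I m J ->
    ideal_eq J (tangent_zero I);
  hedgehog_nontrivial : exists2 J, tangent I J & ~ tangent_deg I 0 J;
  (* A 0-dimensional scheme of finite type over k is affine. *)
  hedgehog_dim0 : exists (C : kalg k) (xi : fpt (Spike I) C),
    represents xi /\ krull_dim0 C }.

End HilbertScheme.

(* Main.v *)
Require Import Defs.
From HB Require Import structures.
From mathcomp Require Import all_boot all_order all_algebra.
From mathcomp Require Import ring zify ssrcomplements.
From mathcomp Require boolp classical_sets.

(** Fix monomials lam_1, ..., lam_d that form a basis of S/I.  The ideals J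
    for which they still form a basis of S/J are the points of an affine open
    chart: such a J is determined by the matrices of multiplication by the
    variables alpha_j on S/J, which commute and send 1 to lam_i under the
    monomial lam_i; conversely, matrices with these properties come from an
    ideal.  The barycenter is 0 when the matrices have trace 0.  So a
    neighbourhood of [I] in B is Spec R with R = P/K, for P the polynomial
    ring on the matrix entries x_a and K the ideal of these conditions.
    Scaling by t multiplies the entry x_a, a = (j, i, l), by t to the power
    w_a = deg lam_i + 1 - deg lam_l.  Hence K is homogeneous, and the point q
    of R given by I, being fixed, has q_a = 0 unless w_a = 0.  Let m be the
    maximal ideal of q.

    The chart is open because S_A/J is a finite module: lam spans it over A'
    exactly when the minors of a presentation of the cokernel generate the
    unit ideal of A' ([span_open]), and then flatness and the constancy of the
    rank force lam to be a basis ([span_basis]).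

    Variables of negative weight vanish near q ([neg_locally_zero]).  A tangent
    vector supported on negative w_a has positive degree, hence is 0; dually,
    x_a is modulo K an element of m^2 when w_a < 0.  That element can be taken
    homogeneous of negative weight, so each of its monomials contains another
    negative variable, and Nakayama's lemma kills all of them.

    Variables of positive weight are nilpotent near q.  First, they are
    nilpotent on the fibre of the limit map over q ([spike_pos_fib]):
    otherwise some x_a is nonzero on a prime of that fibre, with residue
    domain D, and the orbit of the resulting D-point extends over t = 0 to a
    D[t]-point of the negative spike.  The spike has dimension 0, so its
    coordinate ring maps to D[t] with image a field, that is, into D; the
    family is constant in t, which contradicts x_a being nonzero.  Second,
    a monomial of large weight in the positive variables is therefore, modulo
    K and the negative variables, a combination with coefficients in m of the
    finitely many monomials of that weight, and Nakayama's lemma applies again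
    ([pos_locally_zero]).

    Finally some tangent vector t does not have degree 0, so t_a != 0 for some
    a with w_a != 0.  Then x_a is not zero in the local ring, although a power
    of it is ([hedgehog_nilpotent]).

    For the Hilbert scheme the same chart is used without the trace condition,
    with coordinate ring H.  When lam is stable under divisors, the span of
    lam is stable under translations, so that moving the barycenter to 0 is a
    retraction of the chart of the Hilbert scheme to that of B, and the
    nilpotent of R pulls back to H ([hedgehog_hilb_nonreduced]). *)

Set Implicit Arguments.
Unset Strict Implicit.
Unset Printing Implicit Defensive.

Import Order.TTheory GRing.Theory Num.Theory.
Local Open Scope ring_scope.

(** * Ideals, quotients and primes *)

Section IdealBasics.
Context (R : comNzRingType) (I : R -> Prop) (hI : is_ideal I).

Lemma ideal0 : I 0. Proof. by case: hI. Qed.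
Lemma idealD x y : I x -> I y -> I (x + y). Proof. by case: hI => _ h _; apply: h. Qed.
Lemma ideal_mull a x : I x -> I (a * x). Proof. by case: hI => _ _; apply. Qed.
Lemma ideal_mulr a x : I x -> I (x * a). Proof. by rewrite mulrC; apply: ideal_mull. Qed.
Lemma idealN x : I x -> I (- x). Proof. by move=> hx; rewrite -mulN1r; apply: ideal_mull. Qed.
Lemma idealB x y : I x -> I y -> I (x - y).
Proof. by move=> hx hy; apply: idealD => //; apply: idealN. Qed.
Lemma ideal_sum (T : Type) (r : seq T) (P : pred T) (F : T -> R) :
  (forall i, P i -> I (F i)) -> I (\sum_(i <- r | P i) F i).
Proof. by move=> h; elim/big_ind: _ => //; [exact: ideal0 | exact: idealD]. Qed.
Lemma ideal_subE x y : I (x - y) -> (I x <-> I y).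
Proof.
move=> h; split=> h'; first by rewrite -(subKr x y); apply: idealB.
by rewrite -(subrK y x); apply: idealD.
Qed.

End IdealBasics.

Section IdealGen.
Context (R : comNzRingType).
Implicit Types (P I : R -> Prop).

Lemma ideal_gen_ideal P : is_ideal (ideal_gen P).
Proof.
split.
- by exists 0, (fun=> 0), (fun=> 0); split=> [[]|] //; rewrite big_ord0.
- move=> x y [m [a [p [hp ->]]]] [m' [a' [p' [hp' ->]]]].
  exists (m + m')%N.
  exists (fun i => match split i with inl j => a j | inr j => a' j end).
  exists (fun i => match split i with inl j => p j | inr j => p' j end).
  split; first by move=> i; case: (split i).
  rewrite big_split_ord /=; congr (_ + _); apply: eq_bigr => i _.
    by rewrite (unsplitK (inl i)).
  by rewrite (unsplitK (inr i)).
- move=> c x [m [a [p [hp ->]]]]; exists m, (fun i => c * a i), p; split=> //.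
  by rewrite mulr_sumr; apply: eq_bigr => i _; rewrite mulrA.
Qed.

Lemma mem_ideal_gen P x : P x -> ideal_gen P x.
Proof.
by move=> h; exists 1, (fun=> 1), (fun=> x); split=> //; rewrite big_ord1 mul1r.
Qed.

Lemma ideal_gen_min P I : is_ideal I -> (forall x, P x -> I x) ->
  forall x, ideal_gen P x -> I x.
Proof.
move=> hI hP x [m [a [p [hp ->]]]]; apply: ideal_sum => // i _.
by apply: ideal_mull => //; apply: hP.
Qed.

Lemma ideal_genS P Q : (forall x, P x -> Q x) ->
  forall x, ideal_gen P x -> ideal_gen Q x.
Proof.
move=> h; apply: ideal_gen_min; first exact: ideal_gen_ideal.
by move=> x /h; apply: mem_ideal_gen.
Qed.

End IdealGen.

Section MakeMorphism.
Context (R S : nzRingType) (f : R -> S) (fB : zmod_morphism f) (fM : monoid_morphism f).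
Definition morphism_fun of zmod_morphism f & monoid_morphism f := f.
HB.instance Definition _ := GRing.isZmodMorphism.Build R S (morphism_fun fB fM) fB.
HB.instance Definition _ := GRing.isMonoidMorphism.Build R S (morphism_fun fB fM) fM.
Definition make_rmorphism : {rmorphism R -> S} := morphism_fun fB fM.
End MakeMorphism.

Section Quotients.

Section QuotientBuild.
Context (R : comNzRingType) (I : R -> Prop) (hI : is_ideal I) (hI1 : ~ I 1).
Definition ideal_pred of is_ideal I & ~ I 1 : pred R := fun x => boolp.asbool (I x).
Local Notation IP := (ideal_pred hI hI1).
Fact ideal_pred_closed : idealr_closed IP.
Proof.
split; rewrite /in_mem /= /ideal_pred.
- by apply/boolp.asboolP; apply: ideal0.
- by apply/negP => /boolp.asboolP.
- move=> a x y /boolp.asboolP hx /boolp.asboolP hy.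
  by apply/boolp.asboolP; apply: (idealD hI) => //; apply: (ideal_mull hI).
Qed.
HB.instance Definition _ := isIdealr.Build R IP ideal_pred_closed.
Definition ideal_str : idealr R := Idealr.clone R IP _.
Definition ideal_quotient : comNzRingType := {ideal_quot ideal_str}.
Definition ideal_proj : {rmorphism R -> ideal_quotient} := \pi_({ideal_quot ideal_str})%qT.

Lemma ideal_proj_eq0 x : ideal_proj x = 0 <-> I x.
Proof.
have -> : I x <-> x - 0 \in ideal_str.
  by rewrite subr0; split=> [h|/boolp.asboolP//]; apply/boolp.asboolP.
rewrite Quotient.idealrBE -[0 in X in X <-> _](rmorph0 ideal_proj) /ideal_proj /=.
by split=> [->|/eqP].
Qed.
Lemma ideal_proj_surj y : exists x, ideal_proj x = y.
Proof. by exists (repr y); rewrite /ideal_proj /= reprK. Qed.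
End QuotientBuild.

Lemma quotient_exists (R : comNzRingType) (I : R -> Prop) :
  is_ideal I -> ~ I 1 ->
  exists (Q : comNzRingType) (pi : {rmorphism R -> Q}),
    (forall x, pi x = 0 <-> I x) /\ (forall y, exists x, pi x = y).
Proof.
move=> hI h1; exists (ideal_quotient hI h1), (ideal_proj hI h1).
by split; [exact: ideal_proj_eq0 | exact: ideal_proj_surj].
Qed.

Lemma quotient_lift (R Q A : comNzRingType) (pi : {rmorphism R -> Q})
    (g : {rmorphism R -> A}) :
  (forall y, exists x, pi x = y) -> (forall x, pi x = 0 -> g x = 0) ->
  exists h : {rmorphism Q -> A}, forall x, h (pi x) = g x.
Proof.
move=> /boolp.choice [s sK] h0.
have E x y : pi x = pi y -> g x = g y.
  by move=> e; apply/eqP; rewrite -subr_eq0 -rmorphB h0 // rmorphB e subrr.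
pose h y := g (s y).
have hpi x : h (pi x) = g x by apply: E; rewrite sK.
have hB : zmod_morphism h.
  by move=> x y; rewrite /h -rmorphB; apply: E; rewrite rmorphB !sK.
have hM : monoid_morphism h.
  split; first by rewrite /h -[RHS](rmorph1 g); apply: E; rewrite rmorph1 sK.
  by move=> x y; rewrite /h -rmorphM; apply: E; rewrite rmorphM !sK.
by exists (make_rmorphism hB hM) => x; apply: hpi.
Qed.

End Quotients.

(** A quotient by a prime ideal comes without inverses; those that the
    construction of its fraction field asks for are picked by choice. *)
Section Domain.
Context (D : comNzRingType) (hD : forall x y : D, x * y = 0 -> x = 0 \/ y = 0).
Definition dom_type of (forall x y : D, x * y = 0 -> x = 0 \/ y = 0) : Type := D.
Local Notation T := (dom_type hD).
HB.instance Definition _ := GRing.ComNzRing.on T.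
Definition dom_unit : {pred T} := fun x => boolp.asbool (exists y : T, y * x = 1).
Definition dom_inv (x : T) : T :=
  match boolp.pselect (exists y : T, y * x = 1) with
  | left h => proj1_sig (boolp.cid h)
  | right _ => x
  end.
Fact dom_mulVx : {in dom_unit, left_inverse 1 dom_inv *%R}.
Proof.
move=> x /boolp.asboolP hx; rewrite /dom_inv.
by case: boolp.pselect => // h; case: boolp.cid.
Qed.
Fact dom_unitP (x y : T) : y * x = 1 -> dom_unit x.
Proof. by move=> h; apply/boolp.asboolP; exists y. Qed.
Fact dom_inv_out : {in [predC dom_unit], dom_inv =1 id}.
Proof.
move=> x /boolp.asboolP hx; rewrite /dom_inv; case: boolp.pselect => // h.
Qed.
HB.instance Definition _ :=
  GRing.ComNzRing_hasMulInverse.Build T dom_mulVx dom_unitP dom_inv_out.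
Fact dom_integral (x y : T) : x * y = 0 -> (x == 0) || (y == 0).
Proof. by case/hD => ->; rewrite eqxx ?orbT. Qed.
HB.instance Definition _ := GRing.ComUnitRing_isIntegral.Build T dom_integral.
Definition dom_idomain : idomainType := T.
Definition dom_of : {rmorphism D -> dom_idomain} := @idfun D.
End Domain.

Lemma prime_quotient_exists (R : comNzRingType) (P : R -> Prop) :
  is_prime_ideal P ->
  exists (D : idomainType) (pi : {rmorphism R -> D}), forall x, pi x = 0 <-> P x.
Proof.
case=> hI h1 hp; have [Q [pi [pi0 pis]]] := quotient_exists hI h1.
have hD (x y : Q) : x * y = 0 -> x = 0 \/ y = 0.
  have [a <-] := pis x; have [b <-] := pis y.
  by rewrite -rmorphM => /pi0 /hp []/pi0; [left|right].
exists (dom_idomain hD), (dom_of hD \o pi) => x; exact: pi0.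
Qed.

Section Primes.
Context (R : comNzRingType).

(** An ideal that is maximal among those avoiding the powers of [x] is prime:
    if it contains neither [a] nor [b], then adding either of them brings in a
    power of [x], and the product of the two powers lies in the ideal as soon
    as [a * b] does. *)
Lemma prime_avoiding (I : R -> Prop) (x : R) :
  is_ideal I -> (forall N, ~ I (x ^+ N)) ->
  exists P, [/\ is_prime_ideal P, forall y, I y -> P y & forall N, ~ P (x ^+ N)].
Proof.
move=> hI hx.
pose good (A : R -> Prop) := [/\ is_ideal A, forall y, I y -> A y & forall N, ~ A (x ^+ N)].
have goodI : good I by split.
(* The empty predicate is admitted as the union of the empty chain. *)
have [|A [hA maxA]] := @classical_sets.Zorn_bigcup R (fun A => A = (fun=> False) \/ good A).
  move=> F hF tot.
  have [[A0 FA0 gA0]|no] := boolp.pselect (exists2 A, F A & good A); last first.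
    left; apply: boolp.funext => y; apply: boolp.propext; split=> // -[A FA Ay].
    case: (hF A FA) => [eA|gA]; first by rewrite eA in Ay.
    by case: no; exists A.
  right.
  have chain y z : classical_sets.bigcup F (fun X => X) y ->
      classical_sets.bigcup F (fun X => X) z -> exists A, [/\ F A, good A, A y & A z].
    move=> [A FA Ay] [B FB Bz].
    have gA : good A by case: (hF A FA) => // e; rewrite e in Ay.
    have gB : good B by case: (hF B FB) => // e; rewrite e in Bz.
    by case: (tot A B FA FB) => s; [exists B | exists A]; split=> //; apply: s.
  split.
  - split.
    + by exists A0 => //; case: gA0 => hi _ _; apply: ideal0.
    + move=> y z hy hz; have [A [FA [hi _ _] Ay Az]] := chain y z hy hz.
      by exists A => //; apply: idealD.
    + move=> a y hy; have [A [FA [hi _ _] Ay _]] := chain y y hy hy.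
      by exists A => //; apply: ideal_mull.
  - by move=> y Iy; exists A0 => //; case: gA0 => _ h _; apply: h.
  - move=> N hy; have [A [_ [_ _ h] Ay _]] := chain _ _ hy hy; exact: (h N).
have gA : good A.
  case: hA => // e; case: (maxA I _); last by right.
  rewrite e; split=> // h; exact: (h 0 (ideal0 hI)).
have [iA IA xA] := gA.
exists A; split=> //; split=> //; first by move: (xA 0%N); rewrite expr0.
move=> a b hab; have [Aa|nAa] := boolp.pselect (A a); first by left.
right; have [//|nAb] := boolp.pselect (A b); exfalso.
have ext c : ~ A c -> exists N r y, A y /\ x ^+ N = y + r * c.
  move=> nAc; pose B z := exists r y, A y /\ z = y + r * c.
  apply: boolp.contrapT => no; apply: (maxA B).
    split; last by move=> s; apply: nAc; apply: s; exists 1, 0; rewrite mul1r add0r;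
      split=> //; apply: ideal0.
    by move=> y Ay; exists 0, y; rewrite mul0r addr0.
  right; split.
  - split.
    + by exists 0, 0; rewrite mul0r addr0; split=> //; apply: ideal0.
    + move=> _ _ [r [y [Ay ->]]] [r' [y' [Ay' ->]]]; exists (r + r'), (y + y').
      by rewrite mulrDl addrACA; split=> //; apply: idealD.
    + move=> s _ [r [y [Ay ->]]]; exists (s * r), (s * y).
      by rewrite mulrDr mulrA; split=> //; apply: ideal_mull.
  - by move=> y Iy; exists 0, y; rewrite mul0r addr0; split=> //; apply: IA.
  - by move=> N [r [y [Ay e]]]; apply: no; exists N, r, y.
have [N [r [y [Ay e]]]] := ext a nAa; have [N' [r' [y' [Ay' e']]]] := ext b nAb.
apply: (xA (N + N')%N); rewrite exprD e e'.
have -> : (y + r * a) * (y' + r' * b) = (y' + r' * b) * y + (r * a) * y' + (r * r') * (a * b).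
  by ring.
by do 2?[apply: idealD => //]; apply: ideal_mull.
Qed.

(** A non-unit lies in a prime ideal, hence vanishes in its residue field. *)
Lemma unit_from_fields (x : R) :
  (forall (K : fieldType) (f : {rmorphism R -> K}), f x != 0) ->
  exists y, y * x = 1.
Proof.
move=> h; apply: boolp.contrapT => no.
pose I z := exists r, z = r * x.
have hI : is_ideal I.
  split; first by exists 0; rewrite mul0r.
    by move=> _ _ [r ->] [r' ->]; exists (r + r'); rewrite mulrDl.
  by move=> a _ [r ->]; exists (a * r); rewrite mulrA.
have [|P [hP IP _]] := @prime_avoiding I 1 hI.
  by move=> N [r]; rewrite expr1n => e; apply: no; exists r.
have [D [pi pi0]] := prime_quotient_exists hP.
pose f := [the {rmorphism R -> {fraction D}} of @FracField.tofrac D \o pi].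
have := h _ f; rewrite /= (proj2 (pi0 x)) ?rmorph0 ?eqxx //.
by apply: IP; exists 1; rewrite mul1r.
Qed.

End Primes.

(** Cramer's rule, the engine of Nakayama's lemma: if [A] is the identity at
    a point, then [\det A] does not vanish there and kills every [g i]
    modulo [I]. *)
Lemma det_trick (R : comNzRingType) (I : R -> Prop) (m : nat)
    (A : 'M[R]_m) (g : 'I_m -> R) :
  is_ideal I -> (forall i, I (\sum_j A i j * g j)) -> forall i, I (\det A * g i).
Proof.
move=> hI h i.
have -> : \det A * g i = \sum_l (\adj A) i l * \sum_j A l j * g j.
  under eq_bigr do rewrite mulr_sumr.
  rewrite exchange_big /=.
  under eq_bigr do under eq_bigr do rewrite mulrA.
  under eq_bigr do rewrite -mulr_suml.
  have E j : \sum_i0 \adj A i i0 * A i0 j = (\det A)%:M i j.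
    by rewrite -mul_adj_mx mxE.
  under eq_bigr do rewrite E mxE.
  rewrite (bigD1 i) //= eqxx mulr1n big1 ?addr0 // => j /negbTE ji.
  by rewrite eq_sym ji mulr0n mul0r.
by apply: ideal_sum => // l _; apply: ideal_mull.
Qed.

(** * Polynomials with weighted variables *)

Section LinearExtension.
Context (n : nat) (A : comNzRingType) (V : lmodType A) (g : 'X_{1..n} -> V).

Definition mlin (f : {mpoly A[n]}) : V := \sum_(m <- msupp f) f@_m *: g m.

Lemma mlinwE f b : (msize f <= b)%N -> mlin f = \sum_(m : 'X_{1..n < b}) f@_m *: g m.
Proof.
move=> le_fb; set I : subFinType _ := 'X_{1..n < b}.
rewrite /mlin (big_mksub I) ?msupp_uniq //=; first last.
  by move=> x /msize_mdeg_lt /leq_trans; apply.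
rewrite big_rmcond //= => j /memN_msupp_eq0 ->.
by rewrite scale0r.
Qed.

Fact mlin_linear : linear mlin.
Proof.
move=> a f h; pose b := maxn (msize (a *: f + h)) (maxn (msize f) (msize h)).
rewrite (@mlinwE _ b) ?(@mlinwE f b) ?(@mlinwE h b) ?leq_max ?leqnn ?orbT //.
rewrite scaler_sumr -big_split; apply: eq_bigr => m _ /=.
by rewrite mcoeffD mcoeffZ scalerDl scalerA.
Qed.
HB.instance Definition _ := GRing.isLinear.Build A {mpoly A[n]} V *:%R mlin mlin_linear.

Lemma mlinX m : mlin 'X_[m] = g m.
Proof. by rewrite /mlin msuppX big_seq1 mcoeffX eqxx scale1r. Qed.
End LinearExtension.

Lemma mpoly_linear_ext (n : nat) (A : comNzRingType) (V : lmodType A)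
    (f g : {linear {mpoly A[n]} -> V}) :
  (forall m, f 'X_[m] = g 'X_[m]) -> f =1 g.
Proof.
move=> h x; rewrite (mpolyE x) !linear_sum; apply: eq_bigr => m _.
by rewrite !linearZ /= h.
Qed.

Lemma mpoly_ring_ind (n : nat) (A : comNzRingType) (P : {mpoly A[n]} -> Prop) :
  (forall c, P c%:MP) -> (forall i, P 'X_i) ->
  (forall f g, P f -> P g -> P (f + g)) -> (forall f g, P f -> P g -> P (f * g)) ->
  forall f, P f.
Proof.
move=> hC hX hD hM f.
rewrite (mpolyE f); apply: (big_ind P) => //; first by rewrite -mpolyC0.
move=> m _; rewrite -mul_mpolyC; apply: (hM) => //; rewrite mpolyXE_id.
apply: (big_ind P) => [|f' g'|i _]; [by rewrite -[1]mpolyC1 | exact: hM |].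
move: (m i) => e.
by elim: e => [|e ih]; [rewrite expr0 -[1]mpolyC1 | rewrite exprS; apply: hM].
Qed.

Lemma mpoly_rmorph_ext (n : nat) (A B : comNzRingType) (f g : {rmorphism {mpoly A[n]} -> B}) :
  (forall c, f c%:MP = g c%:MP) -> (forall i, f 'X_i = g 'X_i) -> f =1 g.
Proof.
move=> hC hX; apply: mpoly_ring_ind => // x y hx hy.
  by rewrite !rmorphD hx hy.
by rewrite !rmorphM hx hy.
Qed.

(** Isolates finitely many generators, whose coefficients can then be replaced
    by homogeneous components or evaluated. *)
Lemma ideal_gen_split (R : comNzRingType) (P : R -> Prop) (m : nat) (g : 'I_m -> R) f :
  ideal_gen (fun x => P x \/ exists i, x = g i) f ->
  exists h, ideal_gen P (f - \sum_i h i * g i).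
Proof.
have gI := ideal_gen_ideal P.
move: f; apply: ideal_gen_min.
  split.
  - exists (fun=> 0); rewrite big1 ?subr0; first exact: ideal0.
    by move=> i _; rewrite mul0r.
  - move=> x y [h hh] [h' hh']; exists (fun i => h i + h' i).
    under eq_bigr do rewrite mulrDl.
    by rewrite big_split /= opprD addrACA; apply: idealD.
  - move=> a x [h hh]; exists (fun i => a * h i).
    under eq_bigr do rewrite -mulrA.
    by rewrite -mulr_sumr -mulrBr; apply: ideal_mull.
move=> x [Px|[i ->]].
  exists (fun=> 0); rewrite big1 ?subr0; first exact: mem_ideal_gen.
  by move=> i _; rewrite mul0r.
exists (fun j => (j == i)%:R); rewrite (bigD1 i) //= eqxx mul1r big1 ?addr0 ?subrr.
  exact: ideal0.
by move=> j /negbTE ->; rewrite mul0r.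
Qed.

(** A subspace killed by no nonzero functional is everything.  As [W] is only a
    predicate, a matrix with rows in [W] of maximal rank serves as a basis. *)
Section SubspaceFull.
Context (k : fieldType) (p : nat) (W : 'rV[k]_p -> Prop).
Hypothesis (W0 : W 0) (WP : forall a u v, W u -> W v -> W (a *: u + v)).

Let W_sub m (B : 'M_(m, p)) (v : 'rV_p) :
  (forall i, W (row i B)) -> (v <= B)%MS -> W v.
Proof.
move=> hB /submxP [c ->]; rewrite mulmx_sum_row.
elim/big_rec: _ => // i x _ hx; exact: WP.
Qed.

Lemma subspace_full :
  (forall t : 'cV[k]_p, (forall v, W v -> v *m t = 0) -> t = 0) -> forall v, W v.
Proof.
move=> h.
pose Q r := boolp.asbool (exists B : 'M[k]_p, (forall i, W (row i B)) /\ \rank B = r).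
have exQ : exists r, Q r.
  exists 0%N; apply/boolp.asboolP; exists 0; rewrite mxrank0; split=> // i.
  by rewrite row0.
have leQ r : Q r -> (r <= p)%N by move=> /boolp.asboolP [B [_ <-]]; exact: rank_leq_row.
case: (ex_maxnP exQ leQ) => r /boolp.asboolP [B [hB rB]] maxr.
have inB v : W v -> (v <= B)%MS.
  move=> hv; have hBv i : W (row i (B + v)%MS).
    apply: (@W_sub _ (col_mx B v)); last by rewrite -addsmxE row_sub.
    move=> j; case: (split_ordP j) => l ->; first by rewrite rowKu.
    by rewrite rowKd row_id.
  have le : (\rank (B + v)%MS <= \rank B)%N.
    by rewrite rB; apply: maxr; apply/boolp.asboolP; exists (B + v)%MS.
  have e : (B == B + v)%MS by rewrite -(mxrank_leqif_eq (addsmxSl B v)) eqn_leq le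
    mxrankS ?addsmxSl.
  by apply: submx_trans (addsmxSr B v) _; case/andP: e.
have full : cokermx B = 0.
  apply/matrixP => i j; rewrite [RHS]mxE.
  have : col j (cokermx B) = 0.
    apply: h => v /inB /submxP [c ->].
    by rewrite colE mulmxA -(mulmxA c) mulmx_coker mulmx0 mul0mx.
  by move/matrixP/(_ i 0); rewrite !mxE.
by move=> v; apply: (W_sub hB); rewrite submxE full mulmx0.
Qed.

End SubspaceFull.

Section Graded.
Context (k : fieldType) (p : nat) (w : 'I_p -> int) (q : 'I_p -> k).
Local Notation P := {mpoly k[p]}.
Implicit Types (f g : P) (e : int) (m : 'X_{1..p}).

Definition wt m : int := \sum_a w a *+ m a.
Definition wcomp e : P -> P := mlin (fun m => if wt m == e then 'X_[m] else 0).
HB.instance Definition _ e := GRing.Linear.on (wcomp e).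
Definition whomog e f : Prop := wcomp e f = f.

Lemma wcomp_sum e (T : Type) (r : seq T) (Q : pred T) (F : T -> P) :
  wcomp e (\sum_(i <- r | Q i) F i) = \sum_(i <- r | Q i) wcomp e (F i).
Proof. exact: linear_sum. Qed.

Lemma wt0 : wt 0%MM = 0.
Proof. by rewrite /wt big1 // => a _; rewrite mnm0E. Qed.
Lemma wtD m1 m2 : wt (m1 + m2)%MM = wt m1 + wt m2.
Proof. by rewrite -big_split; apply: eq_bigr => a _ /=; rewrite mnmDE mulrnDr. Qed.
Lemma wtU a : wt U_(a)%MM = w a.
Proof.
rewrite /wt (bigD1 a) //= mnm1E eqxx mulr1n big1 ?addr0 // => b /negbTE ba.
by rewrite mnm1E eq_sym ba.
Qed.

Lemma wcompX e m : wcomp e 'X_[m] = if wt m == e then 'X_[m] else 0.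
Proof. exact: mlinX. Qed.
Lemma whomogX m : whomog (wt m) 'X_[m].
Proof. by rewrite /whomog wcompX eqxx. Qed.
Lemma whomogU a : whomog (w a) 'X_a.
Proof. by rewrite -wtU; apply: whomogX. Qed.
Lemma whomog0 e : whomog e 0.
Proof. exact: linear0. Qed.
Lemma whomogC c : whomog 0 c%:MP.
Proof.
by rewrite -[c%:MP]mulr1 mul_mpolyC -[1]mpolyX0 /whomog linearZ /= wcompX wt0 eqxx.
Qed.
Lemma whomogD e f g : whomog e f -> whomog e g -> whomog e (f + g).
Proof. by rewrite /whomog => hf hg; rewrite linearD /= hf hg. Qed.
Lemma whomogN e f : whomog e f -> whomog e (- f).
Proof. by rewrite /whomog => hf; rewrite linearN /= hf. Qed.
Lemma whomogB e f g : whomog e f -> whomog e g -> whomog e (f - g).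
Proof. by move=> hf hg; apply: whomogD => //; apply: whomogN. Qed.
Lemma whomog_sum e (T : Type) (r : seq T) (Q : pred T) (F : T -> P) :
  (forall i, Q i -> whomog e (F i)) -> whomog e (\sum_(i <- r | Q i) F i).
Proof. by move=> h; elim/big_ind: _ => //; [exact: whomog0 | move=> *; exact: whomogD]. Qed.

Lemma wcomp_homog e f : whomog e (wcomp e f).
Proof.
apply: (@mpoly_linear_ext _ _ _ [the {linear P -> P} of wcomp e \o wcomp e]
  [the {linear P -> P} of wcomp e]) => m /=.
by rewrite wcompX; case: eqP => [h|]; rewrite ?linear0 // wcompX h eqxx.
Qed.

Lemma wcompM e a f g : whomog a g -> wcomp e (f * g) = wcomp (e - a) f * g.
Proof.
move=> <-; rewrite (mpolyE g) linear_sum !mulr_sumr linear_sum; apply: eq_bigr => m _ /=.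
rewrite !linearZ /= wcompX; case: eqP => [h|]; last by rewrite !scaler0 !mulr0 linear0.
rewrite -!scalerAr linearZ /=; congr (_ *: _).
rewrite (mpolyE f) !linear_sum !mulr_suml linear_sum; apply: eq_bigr => m' _ /=.
rewrite -scalerAl !linearZ /= -mpolyXD !wcompX wtD h -scalerAl.
congr (_ *: _); rewrite [in LHS]eq_sym -subr_eq [in LHS]eq_sym.
by case: eqP => _; rewrite ?mpolyXD ?mul0r.
Qed.

Lemma whomogM e a f g : whomog e f -> whomog a g -> whomog (e + a) (f * g).
Proof. by move=> hf hg; rewrite /whomog (wcompM _ _ hg) addrK hf. Qed.

Lemma whomog_gen (rel : P -> Prop) : (forall f, rel f -> exists e, whomog e f) ->
  forall e f, ideal_gen rel f -> ideal_gen rel (wcomp e f).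
Proof.
move=> hr e; have gI := ideal_gen_ideal rel.
move=> _ [m [a [r [hrel ->]]]]; rewrite linear_sum; apply: ideal_sum => // i _ /=.
have [e' he'] := hr _ (hrel i); rewrite (wcompM _ _ he').
by apply: ideal_mull => //; apply: mem_ideal_gen.
Qed.

Hypothesis q0 : forall a, w a != 0 -> q a = 0.

(** A tangent vector at [q] of the zero locus of an ideal is a family [t] such
    that [\sum_b t b * dq b f] is 0 for all [f] in the ideal. *)
Definition dq (b : 'I_p) (f : P) : k := (f^`M(b)).@[q].
Lemma dqD b f g : dq b (f + g) = dq b f + dq b g.
Proof. by rewrite /dq mderivD mevalD. Qed.
Lemma dqZ b c f : dq b (c *: f) = c * dq b f.
Proof. by rewrite /dq mderivZ mevalZ. Qed.
Lemma dq0 b : dq b 0 = 0. Proof. by rewrite /dq mderiv0 meval0. Qed.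
Lemma dqM b f g : dq b (f * g) = dq b f * g.@[q] + f.@[q] * dq b g.
Proof. by rewrite /dq mderivM mevalD !mevalM. Qed.
Lemma dqX b a : dq b 'X_a = (a == b)%:R.
Proof.
rewrite /dq mderivX mnm1E mevalZ; case: eqP => [->|_]; last by rewrite mul0r.
have -> : (U_(b) - U_(b))%MM = 0%MM by apply/mnmP => j; rewrite mnmBE subnn mnm0E.
by rewrite mpolyX0 meval1 mulr1.
Qed.
Lemma dqC b c : dq b c%:MP = 0. Proof. by rewrite /dq mderivC meval0. Qed.

Lemma meval_wt m : wt m != 0 -> ('X_[m]).@[q] = 0.
Proof.
move=> h; rewrite mevalX.
have [a /andP [wa ma]] : exists a, (w a != 0) && (m a != 0%N).
  apply/existsP; apply: contraNT h; rewrite negb_exists => /forallP h.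
  rewrite /wt big1 // => a _; have := h a; rewrite negb_and !negbK.
  by case/orP => /eqP ->; rewrite ?mul0rn.
by rewrite (bigD1 a) //= q0 // expr0n (negbTE ma) mul0r.
Qed.

(** If [w b] is not the weight of a monomial, then the derivative of the
    monomial along [b] still has nonzero weight, hence vanishes at [q]. *)
Lemma dq_wcomp b e f : dq b (wcomp e f) = if w b == e then dq b f else 0.
Proof.
rewrite (mpolyE f) linear_sum /=.
elim/big_rec2: _ => [|m x y _]; first by rewrite !dq0 if_same.
rewrite !dqD !linearZ /= !dqZ wcompX => ->.
case: (w b =P e) => [<-|hb]; last first.
  rewrite addr0; case: eqP => [hm|_]; last by rewrite dq0 mulr0.
  rewrite /dq mderivX mevalZ.
  have [->|mb] := eqVneq (m b) 0%N; first by rewrite mul0r mulr0.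
  rewrite meval_wt ?mulr0 //; apply/eqP => h0.
  have : wt (m - U_(b) + U_(b))%MM = wt m.
    by rewrite submK //; apply/mnm_lepP => j; rewrite mnm1E; case: eqP => // <-; lia.
  by rewrite wtD h0 wtU add0r hm.
congr (_ + _); case: eqP => // hm; congr (_ * _); apply: esym; rewrite dq0.
rewrite /dq mderivX mevalZ.
have [->|mb] := eqVneq (m b) 0%N; first by rewrite mul0r.
rewrite meval_wt ?mulr0 //; apply/eqP => h0; apply: hm.
have : wt (m - U_(b) + U_(b))%MM = wt m.
  by rewrite submK //; apply/mnm_lepP => j; rewrite mnm1E; case: eqP => // <-; lia.
by rewrite wtD h0 wtU add0r.
Qed.

End Graded.

(** * Nakayama arguments at a fixed point *)

Lemma sumPosz (T : finType) (F : T -> nat) : (\sum_b F b)%:Z = \sum_b (F b)%:Z.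
Proof. exact: (big_morph Posz PoszD). Qed.

Section Contracting.
Context (k : fieldType) (p : nat) (w : 'I_p -> int) (q : 'I_p -> k).
Local Notation P := {mpoly k[p]}.
Implicit Types (f g : P) (e : int).
Hypothesis q0 : forall a, w a != 0 -> q a = 0.
Context (rel : P -> Prop).
Hypothesis rel_homog : forall f, rel f -> exists e, whomog w e f.
Hypothesis rel_q : forall f, rel f -> f.@[q] = 0.

Local Notation K := (ideal_gen rel).
Let KI := ideal_gen_ideal rel.

Lemma K_q f : K f -> f.@[q] = 0.
Proof.
move: f; apply: ideal_gen_min => //; split; first exact: meval0.
  by move=> x y hx hy; rewrite mevalD hx hy addr0.
by move=> a x hx; rewrite mevalM hx mulr0.
Qed.

Lemma K_dq (t : 'I_p -> k) : (forall f, rel f -> \sum_b t b * dq q b f = 0) ->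
  forall f, K f -> \sum_b t b * dq q b f = 0.
Proof.
move=> h f [m [a [r [hr ->]]]].
under eq_bigr => b _.
  have -> : dq q b (\sum_(i < m) a i * r i) = \sum_(i < m) (a i).@[q] * dq q b (r i).
    elim/big_rec2: _ => [|i x y _ ih]; first exact: dq0.
    by rewrite dqD ih dqM rel_q // mulr0 add0r.
  rewrite mulr_sumr.
  under eq_bigr do rewrite mulrCA.
  over.
rewrite exchange_big big1 // => i _ /=.
by rewrite -mulr_sumr h // mulr0.
Qed.

(** The families below are 0 at the variables of other weights, so that
    combinations of them can be indexed by all variables. *)
Definition negvar (b : 'I_p) : P := if w b < 0 then 'X_b else 0.
Definition zerovar (b : 'I_p) : P := if w b == 0 then 'X_b - (q b)%:MP else 0.

(** The variables of negative weight have no limit under the action as the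
    parameter goes to 0; where they vanish, [fibrel] adds the equations saying
    that this limit is [q]. *)
Definition negrel f := rel f \/ exists b, f = negvar b.
Definition fibrel f := negrel f \/ exists b, f = zerovar b.

Lemma negrel_homog f : negrel f -> exists e, whomog w e f.
Proof.
case=> [/rel_homog //|[b ->]]; exists (w b); rewrite /negvar.
by case: ifP => _; [apply: whomogU | apply: whomog0].
Qed.

Lemma wt_neg m : wt w m < 0 -> exists2 b, w b < 0 & m b != 0%N.
Proof.
move=> h; apply/exists_inP; apply: contraTT h; rewrite negb_exists -leNgt => /forallP h.
rewrite /wt; apply: sumr_ge0 => b _; have := h b; rewrite negb_and negbK -leNgt.
by case/orP => [h'|/eqP ->]; rewrite ?mulr0n // mulrn_wge0.
Qed.

Lemma mpolyX_split (m : 'X_{1..p}) b : m b != 0%N -> 'X_[m] = 'X_[m - U_(b)] * 'X_b :> P.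
Proof.
move=> h; rewrite -mpolyXD submK //; apply/mnm_lepP => j; rewrite mnm1E.
by case: eqP => // <-; lia.
Qed.

Lemma negX_mem (m : 'X_{1..p}) b : w b < 0 -> m b != 0%N -> ideal_gen negrel 'X_[m].
Proof.
move=> wb mb; rewrite (mpolyX_split mb).
apply: (ideal_mull (ideal_gen_ideal _)); apply: mem_ideal_gen; right; exists b.
by rewrite /negvar wb.
Qed.

Hypothesis tangent_neg : forall (e : int) (t : 'I_p -> k), e < 0 ->
  (forall b, w b != e -> t b = 0) ->
  (forall f, rel f -> \sum_b t b * dq q b f = 0) -> forall b, t b = 0.

(** The differentials at [q] of the elements of [K] form a subspace.  A
    functional killing it is a tangent vector, and its component in each weight
    again is one since [K] is homogeneous.  If the functional lives on negative
    variables these components are all 0, so that the differentials take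
    arbitrary values on these variables. *)
Let negdual : forall a, w a < 0 -> exists f,
  [/\ K f, whomog w (w a) f & forall b, w b < 0 -> dq q b f = (a == b)%:R].
Proof.
pose W (v : 'rV[k]_p) := exists f, K f /\ forall b, w b < 0 -> v 0 b = dq q b f.
have full : forall v, W v.
  apply: subspace_full.
  - exists 0; split; first exact: ideal0.
    by move=> b _; rewrite dq0 mxE.
  - move=> c u v [f [Kf hf]] [g [Kg hg]]; exists (c *: f + g); split.
      by apply: idealD => //; rewrite -mul_mpolyC; apply: ideal_mull.
    by move=> b wb; rewrite !mxE dqD dqZ hf // hg.
  - move=> t ht; apply/matrixP => b j; rewrite [RHS]mxE (ord1 j) {j}.
    have kill (v : 'rV_p) : W v -> \sum_j v 0 j * t j 0 = 0.
      by move=> /ht /matrixP/(_ 0 0); rewrite !mxE.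
    have [wb|wb] := boolP (w b < 0); last first.
      have := kill (delta_mx 0 b); rewrite (bigD1 b) //= mxE !eqxx mul1r big1 ?addr0.
        apply; exists 0; split; first exact: ideal0.
        by move=> c wc; rewrite dq0 mxE eqxx /=; case: eqP => // e; rewrite -e wc in wb.
      by move=> j jb; rewrite mxE (negbTE jb) andbF mul0r.
    pose te j := if w j == w b then t j 0 else 0.
    have := @tangent_neg (w b) te wb; rewrite /te => H.
    suff: (if w b == w b then t b 0 else 0) = 0 by rewrite eqxx.
    apply: (H _ _ b) => [j /negbTE ->//|f rf].
    pose v := \row_j dq q j (wcomp w (w b) f).
    rewrite -[RHS](kill v).
      apply: eq_bigr => j _; rewrite mxE dq_wcomp //.
      by case: eqP => _; rewrite ?mul0r // mulrC.
    exists (wcomp w (w b) f); split; last by move=> j _; rewrite mxE.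
    by apply: whomog_gen => //; apply: mem_ideal_gen.
move=> a wa; have [f [Kf hf]] := full (delta_mx 0 a).
exists (wcomp w (w a) f); split; first exact: whomog_gen.
  exact: wcomp_homog.
move=> b wb; rewrite dq_wcomp // -hf // mxE /= eq_sym.
by case: (eqVneq a b) => [->|_]; rewrite ?eqxx ?if_same.
Qed.

(** A monomial of negative weight contains a variable of negative weight. *)
Let neg_decomp e f : e < 0 -> whomog w e f -> exists h : 'I_p -> P, f = \sum_b h b * negvar b.
Proof.
move=> e0 hf.
have : ideal_gen (fun x => x = 0 \/ exists b, x = negvar b) f.
  rewrite -hf /wcomp /mlin; apply: (ideal_sum (ideal_gen_ideal _)) => m _.
  case: eqP => [hm|_]; last by rewrite scaler0; apply: ideal0; apply: ideal_gen_ideal.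
  rewrite -hm in e0; have [b wb mb] := wt_neg e0.
  rewrite (mpolyX_split mb) -mul_mpolyC mulrA; apply: ideal_mull; first exact: ideal_gen_ideal.
  by apply: mem_ideal_gen; right; exists b; rewrite /negvar wb.
move=> /ideal_gen_split [h hh]; exists h; apply/eqP; rewrite -subr_eq0; apply/eqP.
have I0 : is_ideal (fun x : P => x = 0).
  by split=> // [x y -> ->|a x ->]; rewrite ?addr0 ?mulr0.
exact: (ideal_gen_min I0 _ hh).
Qed.

(** Decomposing the elements of [negdual] along the negative variables gives
    a square system of relations between these variables.  Taking derivatives
    at [q] shows that its matrix is the identity there. *)
Lemma neg_locally_zero : exists2 s, s.@[q] = 1 & forall b, K (s * negvar b).
Proof.
have /fin_all_exists [H hH] : forall a, exists H : 'I_p -> P,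
    K (\sum_b H b * negvar b) /\ forall b, (H b).@[q] = (a == b)%:R.
  move=> a; have [wa|wa] := boolP (w a < 0); last first.
    exists (fun b => (a == b)%:R); split; last first.
      by move=> b; case: eqP => _; rewrite ?meval1 ?meval0.
    rewrite (bigD1 a) //= {1}/negvar (negbTE wa) mulr0 add0r big1; first exact: ideal0.
    by move=> b; rewrite eq_sym => /negbTE ->; rewrite mul0r.
  have [f [Kf hf df]] := negdual wa; have [h fE] := neg_decomp wa hf.
  exists (fun b => if w b < 0 then h b else (a == b)%:R); split.
    rewrite (_ : \sum_b _ = f) // {1}fE; apply: eq_bigr => b _.
    by rewrite /negvar; case: ifP => // _; rewrite !mulr0.
  move=> b; case: ifP => [wb|_]; last by case: eqP => _; rewrite ?meval1 ?meval0.
  rewrite -df // {1}fE.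
  have -> : dq q b (\sum_c h c * negvar c) = \sum_c (h c).@[q] * (c == b)%:R.
    elim/big_rec2: _ => [|c x y _ ih]; first exact: dq0.
    rewrite dqD -ih dqM /negvar; case: ifP => wc.
      by rewrite mevalXU (q0 (a := c)) ?dqX ?mulr0 ?add0r // lt_eqF.
    rewrite meval0 dq0 !mulr0; case: eqP => [e|_]; last by rewrite mulr0 addr0.
    by rewrite e wb in wc.
  rewrite (bigD1 b) //= eqxx mulr1 big1 ?addr0 // => c /negbTE ->; by rewrite mulr0.
exists (\det (\matrix_(a, b) H a b)).
  rewrite -det_map_mx -[RHS](det1 k p); congr (\det _); apply/matrixP => a b.
  by rewrite !mxE; exact: (hH a).2.
move=> b; apply: (det_trick KI) => a.
by under eq_bigr do rewrite mxE; case: (hH a).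
Qed.

Hypothesis pos_fib : forall a, 0 < w a -> exists N, ideal_gen fibrel ('X_a ^+ N).

Let posmon (m : 'X_{1..p}) := [forall b, (m b != 0%N) ==> (0 < w b)].

(** Modulo the negative variables, a monomial is the product of one in the
    variables of weight 0 and one in the variables of positive weight, which
    carries the whole weight. *)
Let pos_decomp e f (B : nat) : whomog w e f -> (`|e| < B)%N ->
  exists c : 'X_{1..p < B} -> P,
    ideal_gen negrel (f - \sum_m c m * (if posmon m && (wt w m == e) then 'X_[m] else 0)).
Proof.
have NI := ideal_gen_ideal negrel.
move=> hf hB; rewrite -hf /wcomp /mlin.
elim/big_rec: _ => [|m x _ [c hc]].
  exists (fun=> 0); rewrite big1 ?subr0; first exact: ideal0.
  by move=> m _; rewrite mul0r.
suff [c' hc'] : exists c' : 'X_{1..p < B} -> P, ideal_gen negrel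
    (f@_m *: (if wt w m == e then 'X_[m] else 0) -
     \sum_m0 c' m0 * (if posmon m0 && (wt w m0 == e) then 'X_[m0] else 0)).
  exists (fun m => c' m + c m).
  under eq_bigr do rewrite mulrDl.
  by rewrite big_split /= opprD addrACA; apply: idealD.
case: eqP => [wm|_]; last first.
  exists (fun=> 0); rewrite scaler0 big1 ?subr0; first exact: ideal0.
  by move=> m' _; rewrite mul0r.
have [/existsP [b /andP [mb wb]]|/existsPn noneg] := boolP [exists b, (m b != 0%N) && (w b < 0)].
  exists (fun=> 0); rewrite big1 ?subr0; last by move=> m' _; rewrite mul0r.
  by rewrite -mul_mpolyC; apply: ideal_mull => //; apply: negX_mem wb mb.
pose mp : 'X_{1..p} := [multinom (if (0 < w b)%R then m b else 0%N) | b < p].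
pose mz : 'X_{1..p} := [multinom (if (0 < w b)%R then 0%N else m b) | b < p].
have mE : m = (mz + mp)%MM.
  by apply/mnmP => b; rewrite mnmDE !mnmE; case: ifP => _; rewrite ?addn0.
have wz : wt w mz = 0.
  rewrite /wt big1 // => b _; rewrite mnmE; case: ifPn => [_|wb]; first exact: mulr0n.
  have := noneg b; rewrite negb_and negbK; case/orP => [/eqP ->|]; first exact: mulr0n.
  by move=> wb'; have -> : w b = 0 by [lia]; rewrite mul0rn.
have wp : wt w mp = e by rewrite -wm mE wtD wz add0r.
have lp : (mdeg mp < B)%N.
  suff : (mdeg mp)%:Z <= e by lia.
  rewrite -wp mdegE /wt sumPosz; apply: ler_sum => b _.
  rewrite mnmE; case: ifPn => [wb|_]; last by rewrite mulr0n.
  by rewrite -mulr_natr natz; nia.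
have pp : posmon mp.
  by apply/forallP => b; rewrite mnmE; case: ifP => _; rewrite ?implybT.
pose bm := BMultinom lp.
exists (fun m' => if m' == bm then f@_m *: 'X_[mz] else 0).
rewrite (bigD1 bm) //= eqxx pp wp eqxx /= big1.
  by rewrite addr0 {2}mE mpolyXD scalerAl subrr; apply: ideal0.
by move=> m' /negbTE ->; rewrite mul0r.
Qed.

(** Consider all monomials of some fixed weight in the positive variables.  If
    the weight is large then each of them contains a high power of a variable,
    which is a combination of [fibrel].  Taking components of that weight, it
    becomes, modulo [negrel], a combination of the monomials of the same
    weight whose coefficients vanish at [q]. *)
Lemma pos_locally_zero a : 0 < w a ->
  exists s T, s.@[q] = 1 /\ ideal_gen negrel (s * 'X_a ^+ T).
Proof.
have NI := ideal_gen_ideal negrel; have FI := ideal_gen_ideal fibrel.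
have /fin_all_exists [N0 hN0] : forall a, exists N, 0 < w a -> ideal_gen fibrel ('X_a ^+ N).
  move=> b; have [wb|] := boolP (0 < w b); last by exists 0%N.
  by have [N hN] := pos_fib wb; exists N.
pose N := (\sum_b N0 b)%N.
have hN b : 0 < w b -> ideal_gen fibrel ('X_b ^+ N).
  move=> wb; rewrite /N (bigD1 b) //= exprD; apply: ideal_mulr => //; exact: hN0.
move=> wa.
(* A monomial with all exponents below [N] has weight below [w a *+ T]. *)
pose T := (N * (\sum_b `|w b|) + 1)%N.
pose e := w a *+ T.
pose B := (`|e|).+1.
pose g (m : 'X_{1..p < B}) : P := if posmon m && (wt w m == e) then 'X_[m] else 0.
have step m : exists h : 'X_{1..p < B} -> P,
    (forall m', (h m').@[q] = 0) /\ ideal_gen negrel (g m - \sum_m' h m' * g m').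
  rewrite /g; case: andP => [[pm /eqP wm]|_]; last first.
    exists (fun=> 0); split=> [m'|]; first exact: meval0.
    rewrite big1 ?subr0; first exact: ideal0.
    by move=> m' _; rewrite mul0r.
  have [b mb] : exists b, (N <= m b)%N && (0 < w b).
    apply/existsP; apply: contraT => /existsPn no.
    have : wt w m <= (N * \sum_b `|w b|)%:Z.
      rewrite big_distrr /= /wt sumPosz; apply: ler_sum => b _.
      have := no b; rewrite negb_and -ltnNge -leNgt -mulr_natr !natz.
      by case/orP=> h; nia.
    by rewrite wm /e /T -mulr_natr natz; nia.
  have fib : ideal_gen fibrel 'X_[m].
    case/andP: mb => mb wb; have -> : bmnm m = (m - U_(b) *+ N + U_(b) *+ N)%MM.
      rewrite submK //; apply/mnm_lepP => j; rewrite mulmnE mnm1E.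
      by case: eqP => [<-|_]; rewrite ?mul1n ?mul0n.
    by rewrite mpolyXD -mpolyXn; apply: ideal_mull => //; apply: hN.
  have [z hz] := ideal_gen_split fib.
  have hz' : ideal_gen negrel ('X_[m] - \sum_b wcomp w e (z b) * zerovar b).
    have := whomog_gen negrel_homog e hz.
    rewrite linearB /= wcomp_sum wcompX wm eqxx.
    congr (ideal_gen _ (_ - _)).
    apply: eq_bigr => c _; rewrite /= (@wcompM _ _ w e 0) ?subr0 // /zerovar.
    case: eqP => wc; last exact: whomog0.
    by apply: whomogB; [rewrite -wc; apply: whomogU | apply: whomogC].
  have /fin_all_exists [c hc] b' : exists c : 'X_{1..p < B} -> P, ideal_gen negrel
      (wcomp w e (z b') - \sum_m' c m' * g m').
    by apply: pos_decomp => //; apply: wcomp_homog.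
  exists (fun m' => \sum_b' c b' m' * zerovar b'); split.
    move=> m'; rewrite rmorph_sum big1 // => b' _; rewrite /= mevalM /zerovar.
    by case: eqP => _; rewrite ?mevalB ?mevalXU ?mevalC ?subrr ?meval0 mulr0.
  set s := \sum_m' _.
  have sE : s = \sum_b' (\sum_m' c b' m' * g m') * zerovar b'.
    rewrite /s; under eq_bigr do rewrite mulr_suml.
    rewrite exchange_big; apply: eq_bigr => b' _; rewrite mulr_suml.
    by apply: eq_bigr => m' _; rewrite mulrAC.
  rewrite -(subrKA (\sum_b' wcomp w e (z b') * zerovar b')); apply: idealD => //.
  rewrite sE -sumrB; apply: ideal_sum => // b' _.
  by rewrite -mulrBl; apply: ideal_mulr.
have /fin_all_exists [h hh] := step.
pose A := \matrix_(i < #|{: 'X_{1..p < B}}|, j < #|{: 'X_{1..p < B}}|)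
   ((i == j)%:R - h (enum_val i) (enum_val j)).
have hA (i : 'I_#|{: 'X_{1..p < B}}|) : ideal_gen negrel (\det A * g (enum_val i)).
  apply: (@det_trick _ _ _ A (fun i => g (enum_val i)) NI) => {}i.
  have := (hh (enum_val i)).2; congr ideal_gen.
  under [in RHS]eq_bigr do rewrite mxE mulrBl.
  rewrite sumrB; congr (_ - _).
    by rewrite (bigD1 i) //= eqxx mul1r big1 ?addr0 // => j;
      rewrite eq_sym => /negbTE ->; rewrite mul0r.
  by rewrite (reindex (fun j : 'I_#|{: 'X_{1..p < B}}| => enum_val j)) //; apply: onW_bij; apply: enum_val_bij.
have la : (mdeg (U_(a) *+ T : 'X_{1..p})%MM < B)%N.
  by rewrite mdegMn mdeg1 mul1n /B /e -mulr_natr natz; nia.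
exists (\det A), T; split.
  rewrite -det_map_mx -[RHS](det1 k #|{: 'X_{1..p < B}}|); congr (\det _).
  apply/matrixP => i j; rewrite !mxE /= mevalB (hh (enum_val i)).1 subr0.
  by case: eqP => _; rewrite ?meval1 ?meval0.
have := hA (enum_rank (BMultinom la)); rewrite enum_rankK /g /= mpolyXn.
have -> : posmon (U_(a) *+ T)%MM.
  apply/forallP => b; rewrite mulmnE mnm1E; case: (eqVneq a b) => [<-|_]; first by rewrite wa implybT.
  by rewrite mul0n.
suff -> : wt w (U_(a) *+ T)%MM == e by [].
rewrite /wt (bigD1 a) //= big1 ?addr0; first by rewrite mulmnE mnm1E eqxx mul1n.
by move=> b; rewrite mulmnE mnm1E eq_sym => /negbTE ->; rewrite mul0n mulr0n.
Qed.

Lemma locally_nilpotent a : w a != 0 ->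
  exists s T, s.@[q] = 1 /\ K (s * 'X_a ^+ T).
Proof.
have [s1 hs1 neg0] := neg_locally_zero.
move=> wa; have [wa'|wa'] := boolP (w a < 0).
  by exists s1, 1%N; split=> //; have := neg0 a; rewrite /negvar wa' expr1.
have [|s [T [hs hT]]] := @pos_locally_zero a; first by lia.
exists (s1 * s), T; split; first by rewrite mevalM hs hs1 mulr1.
rewrite -mulrA; move: hT; move: (s * _); apply: ideal_gen_min.
  split; first by rewrite mulr0; apply: ideal0.
    by move=> x y hx hy; rewrite mulrDr; apply: idealD.
  by move=> c x hx; rewrite mulrCA; apply: ideal_mull.
by move=> x [rx|[b ->]] //; apply: ideal_mull => //; apply: mem_ideal_gen.
Qed.

End Contracting.

(** * Bases and base change *)

Lemma mnm_ind (n : nat) (Q : 'X_{1..n} -> Prop) :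
  Q 0%MM -> (forall m j, Q m -> Q (m + U_(j))%MM) -> forall m, Q m.
Proof.
move=> h0 hS m; move: {2}(mdeg m) (erefl (mdeg m)) => e.
elim: e m => [|e ih] m hm; first by move/eqP: hm; rewrite mdeg_eq0 => /eqP ->.
have [j mj] : exists j, m j != 0%N.
  apply/existsP; apply: contra_eqT hm => /existsPn no.
  suff -> : m = 0%MM by rewrite mdeg0.
  by apply/mnmP => j; rewrite mnm0E; apply/eqP; have := no j; rewrite negbK.
have E : (m - U_(j) + U_(j))%MM = m.
  by rewrite submK //; apply/mnm_lepP => l; rewrite mnm1E; case: eqP => // <-; lia.
rewrite -E; apply: hS; apply: ih.
by move: hm; rewrite -{1}E mdegD mdeg1; lia.
Qed.

Section MpolyIdeal.
Context (n : nat) (A : comNzRingType) (J : {mpoly A[n]} -> Prop) (hJ : is_ideal J).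

Lemma idealZ c f : J f -> J (c *: f).
Proof. by rewrite -mul_mpolyC; apply: ideal_mull. Qed.

Lemma lc_subst m r (a : 'I_m -> A) (x : 'I_m -> {mpoly A[n]}) (N : 'I_m -> 'I_r -> A)
    (y : 'I_r -> {mpoly A[n]}) :
  (forall l, J (x l - \sum_b N l b *: y b)) ->
  J (\sum_l a l *: x l - \sum_b (\sum_l a l * N l b) *: y b).
Proof.
move=> h.
have -> : \sum_b (\sum_l a l * N l b) *: y b = \sum_l a l *: \sum_b N l b *: y b.
  under eq_bigr do rewrite scaler_suml.
  rewrite exchange_big; apply: eq_bigr => l _ /=.
  by rewrite scaler_sumr; apply: eq_bigr => b _; rewrite scalerA.
rewrite -sumrB; apply: ideal_sum => // l _.
by rewrite -scalerBr; apply: idealZ.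
Qed.

Lemma basis_coef_uniq d (e : 'I_d -> {mpoly A[n]}) (a b : 'I_d -> A) f :
  quotient_basis J e -> J (f - \sum_i a i *: e i) -> J (f - \sum_i b i *: e i) ->
  forall i, a i = b i.
Proof.
move=> [_ hi] ha hb i; apply/eqP; rewrite -subr_eq0; apply/eqP.
apply: (hi (fun i => a i - b i)).
under eq_bigr do rewrite scalerBl.
rewrite sumrB; have := idealB hJ hb ha.
by rewrite opprB addrC subrKA.
Qed.

Lemma basis_mx_uniq d a (e : 'I_d -> {mpoly A[n]}) (x : 'I_a -> {mpoly A[n]}) (M N : 'M[A]_(a, d)) :
  quotient_basis J e -> (forall i, J (x i - \sum_l M i l *: e l)) ->
  (forall i, J (x i - \sum_l N i l *: e l)) -> M = N.
Proof.
move=> he hM hN; apply/matrixP => i l.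
exact: (basis_coef_uniq he (hM i) (hN i) l).
Qed.

Lemma lc_mx_subst a b c (e : 'I_c -> {mpoly A[n]}) (x : 'I_a -> {mpoly A[n]})
    (y : 'I_b -> {mpoly A[n]}) (M : 'M[A]_(a, b)) (N : 'M[A]_(b, c)) :
  (forall i, J (x i - \sum_l M i l *: y l)) ->
  (forall i, J (y i - \sum_l N i l *: e l)) ->
  (forall i, J (x i - \sum_l (M *m N) i l *: e l)).
Proof.
move=> hM hN i.
rewrite -(subrKA (\sum_l M i l *: y l)); apply: idealD => //.
have := lc_subst (M i) hN; congr (J (_ - _)).
by apply: eq_bigr => l _; rewrite mxE.
Qed.

Lemma lc_id d (e : 'I_d -> {mpoly A[n]}) i : J (e i - \sum_l (1%:M : 'M_d) i l *: e l).
Proof.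
rewrite (bigD1 i) //= mxE eqxx scale1r big1 ?addr0 ?subrr; first exact: ideal0.
by move=> l li; rewrite mxE eq_sym (negbTE li) scale0r.
Qed.

Lemma basis_mx d a (e : 'I_d -> {mpoly A[n]}) (x : 'I_a -> {mpoly A[n]}) : quotient_basis J e ->
  exists M : 'M[A]_(a, d), forall i, J (x i - \sum_l M i l *: e l).
Proof.
move=> [hs _].
have /fin_all_exists [M hM] := fun i => hs (x i).
by exists (\matrix_(i, l) M i l) => i; under eq_bigr do rewrite mxE.
Qed.

Lemma lc_mulX d (e x : 'I_d -> {mpoly A[n]}) (M : 'M[A]_d) g :
  (forall i, J (x i - \sum_l M i l *: e l)) ->
  (forall i, J (g * x i - \sum_l M i l *: (g * e l))).
Proof.
move=> h i; have := ideal_mull hJ g (h i); rewrite mulrBr mulr_sumr.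
by congr (J (_ - _)); apply: eq_bigr => l _; rewrite scalerAr.
Qed.

Lemma basis_card a b (e : 'I_a -> {mpoly A[n]}) (e' : 'I_b -> {mpoly A[n]}) :
  quotient_basis J e -> quotient_basis J e' -> a = b.
Proof.
move=> he he'; have [Q hQ] := basis_mx e' he; have [Q' hQ'] := basis_mx e he'.
apply/eqP; rewrite eqn_leq; apply/andP; split.
  by apply: (@mulmx1_min _ _ _ Q' Q); apply: (basis_mx_uniq he (lc_mx_subst hQ' hQ)); apply: lc_id.
by apply: (@mulmx1_min _ _ _ Q Q'); apply: (basis_mx_uniq he' (lc_mx_subst hQ hQ')); apply: lc_id.
Qed.

Lemma coordinates_exist m (x : 'I_m -> {mpoly A[n]}) :
  (forall f, exists a : 'I_m -> A, J (f - \sum_j a j *: x j)) ->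
  exists g : 'X_{1..n} -> 'rV[A]_m, forall f, J (f - \sum_j mlin g f 0 j *: x j).
Proof.
move=> hx; have [r hr] := boolp.choice (fun mu : 'X_{1..n} => hx 'X_[mu]).
exists (fun mu => \row_j r mu j) => f.
have -> : \sum_j mlin (fun mu => \row_j r mu j) f 0 j *: x j =
    \sum_(mu <- msupp f) f@_mu *: \sum_j r mu j *: x j.
  under eq_bigr => j _.
    have -> : mlin (fun mu => \row_j r mu j) f 0 j = \sum_(mu <- msupp f) f@_mu * r mu j.
      by rewrite summxE; apply: eq_bigr => mu _; rewrite !mxE.
    rewrite scaler_suml; over.
  rewrite exchange_big; apply: eq_bigr => mu _ /=.
  by rewrite scaler_sumr; apply: eq_bigr => j _; rewrite scalerA.
rewrite {1}(mpolyE f) -sumrB; apply: ideal_sum => // mu _.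
by rewrite -scalerBr; apply: idealZ.
Qed.

(** Matrices of the same multiplication in two bases are conjugate, so that
    barycenters can be computed in the monomial basis. *)
Lemma basis_trace_uniq d (e e' : 'I_d -> {mpoly A[n]}) (M M' : 'M[A]_d) g :
  quotient_basis J e -> quotient_basis J e' ->
  (forall i, J (g * e i - \sum_l M i l *: e l)) ->
  (forall i, J (g * e' i - \sum_l M' i l *: e' l)) -> \tr M = \tr M'.
Proof.
move=> he he' hM hM'.
have [Q hQ] := basis_mx e' he; have [Q' hQ'] := basis_mx e he'.
have E1 : Q' *m Q = 1%:M.
  by apply: (basis_mx_uniq he (lc_mx_subst hQ' hQ)); apply: lc_id.
have E2 : M' = Q *m M *m Q'.
  apply: (basis_mx_uniq he' hM').
  apply: lc_mx_subst hQ'; apply: lc_mx_subst hM; exact: lc_mulX.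
by rewrite E2 mxtrace_mulC mulmxA E1 mul1mx.
Qed.

End MpolyIdeal.

Section BaseChange.
Context (n : nat) (A B : comNzRingType) (phi : {rmorphism A -> B}).
Implicit Types (J : {mpoly A[n]} -> Prop) (I : {mpoly B[n]} -> Prop).

Lemma map_mpoly_lc m (a : 'I_m -> A) (x : 'I_m -> {mpoly A[n]}) :
  map_mpoly phi (\sum_l a l *: x l) = \sum_l phi (a l) *: map_mpoly phi (x l).
Proof.
rewrite (raddf_sum (map_mpoly phi)).
by apply: eq_bigr => l _; apply: map_mpolyZ.
Qed.

Lemma base_change_ideal J : is_ideal (base_change phi J).
Proof. exact: ideal_gen_ideal. Qed.

Lemma base_change_mem J f : J f -> base_change phi J (map_mpoly phi f).
Proof. by move=> h; apply: mem_ideal_gen; exists f. Qed.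

Lemma base_change_min J I : is_ideal I -> (forall f, J f -> I (map_mpoly phi f)) ->
  forall g, base_change phi J g -> I g.
Proof. by move=> hI h; apply: ideal_gen_min => // _ [f Jf ->]; apply: h. Qed.

Lemma base_changeS J J' : (forall f, J f -> J' f) ->
  forall g, base_change phi J g -> base_change phi J' g.
Proof.
move=> h; apply: base_change_min; first exact: base_change_ideal.
by move=> f Jf; apply: base_change_mem; apply: h.
Qed.

Lemma base_change_eq J J' : ideal_eq J J' ->
  ideal_eq (base_change phi J) (base_change phi J').
Proof. by move=> h g; split; apply: base_changeS => f; rewrite h. Qed.

(** The monomials of the coefficients can be absorbed into [J], which leaves
    scalar coefficients. *)
Lemma base_change_lc J g : is_ideal J -> base_change phi J g ->
  exists m (a : 'I_m -> B) (f : 'I_m -> {mpoly A[n]}),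
    (forall i, J (f i)) /\ g = \sum_i a i *: map_mpoly phi (f i).
Proof.
move=> hJ; pose T g := exists m (a : 'I_m -> B) (f : 'I_m -> {mpoly A[n]}),
    (forall i, J (f i)) /\ g = \sum_i a i *: map_mpoly phi (f i).
have T0 : T 0 by exists 0%N, (fun=> 0), (fun=> 0); split=> [[]|] //; rewrite big_ord0.
have TD x y : T x -> T y -> T (x + y).
  move=> [m [a [f [hf ->]]]] [m' [a' [f' [hf' ->]]]].
  exists (m + m')%N.
  exists (fun i => match split i with inl j => a j | inr j => a' j end).
  exists (fun i => match split i with inl j => f j | inr j => f' j end).
  split; first by move=> i; case: (split i).
  rewrite big_split_ord /=; congr (_ + _); apply: eq_bigr => i _.
    by rewrite (unsplitK (inl i)).
  by rewrite (unsplitK (inr i)).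
have TX c x : T x -> T (c * x).
  move=> [m [a [f [hf ->]]]]; rewrite (mpolyE c) mulr_suml.
  apply: (big_ind T) => // e _.
  exists m, (fun i => c@_e * a i), (fun i => 'X_[e] * f i); split.
    by move=> i; apply: ideal_mull.
  rewrite mulr_sumr; apply: eq_bigr => i _.
  by rewrite rmorphM /= map_mpolyX -scalerAr -scalerAl scalerA mulrC.
move: g; apply: (base_change_min (I := T)); first by split.
move=> f Jf; exists 1%N, (fun=> 1), (fun=> f); split=> //.
by rewrite big_ord1 scale1r.
Qed.

End BaseChange.

Lemma base_change_comp (n : nat) (A B C : comNzRingType) (f : {rmorphism A -> B})
    (g : {rmorphism B -> C}) (h : {rmorphism A -> C}) (J : {mpoly A[n]} -> Prop) :
  (forall x, h x = g (f x)) ->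
  ideal_eq (base_change h J) (base_change g (base_change f J)).
Proof.
move=> e.
have E x : map_mpoly h x = map_mpoly g (map_mpoly f x).
  by apply/mpolyP => m; rewrite !mcoeff_map_mpoly /= e.
move=> x; split; move: x; apply: base_change_min; try exact: base_change_ideal.
  by move=> x Jx; rewrite E; do 2 apply: base_change_mem.
move=> x; apply: (base_change_min (I := fun x => base_change h J (map_mpoly g x))).
  have hI := base_change_ideal h J; split.
  - by rewrite rmorph0; apply: ideal0.
  - by move=> y z hy hz; rewrite rmorphD; apply: idealD.
  - by move=> y z hz; rewrite rmorphM; apply: ideal_mull.
by move=> y Jy; rewrite -E; apply: base_change_mem.
Qed.

Lemma base_change_id (n : nat) (A : comNzRingType) (f : {rmorphism A -> A})
    (J : {mpoly A[n]} -> Prop) : is_ideal J -> (forall x, f x = x) ->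
  ideal_eq (base_change f J) J.
Proof.
move=> hJ e.
have E x : map_mpoly f x = x by apply/mpolyP => m; rewrite !mcoeff_map_mpoly /= e.
move=> x; split; last by move=> Jx; rewrite -(E _ x); apply: base_change_mem.
by move: x; apply: base_change_min => // x Jx; rewrite E.
Qed.

(** * Ideals given by multiplication matrices *)

Section Chart.
Context (n d : nat) (lam : 'I_d -> 'X_{1..n}) (i0 : 'I_d).
Hypothesis lam0 : lam i0 = 0%MM.

Section OverRing.
Context (A : comNzRingType).
Implicit Types (M : 'I_n -> 'M[A]_d) (J : {mpoly A[n]} -> Prop).

Definition lamX (i : 'I_d) : {mpoly A[n]} := 'X_[lam i].
Definition mact M (m : 'X_{1..n}) : 'M[A]_d := \prod_(j < n) M j ^+ m j.
(** The vector [f(M) 1], as the class of 1 is the basis vector [i0].  When [M]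
    consists of the multiplication matrices of S/J, these are the coordinates
    of [f] modulo [J]. *)
Definition nf M : {mpoly A[n]} -> 'rV[A]_d := mlin (fun m => delta_mx 0 i0 *m mact M m).
HB.instance Definition _ M := GRing.Linear.on (nf M).
Definition commuting M := forall j l, M j *m M l = M l *m M j.
(** The second condition says that the class of the monomial [lam i], which is
    [lam i] applied to 1, is the basis vector [i]. *)
Definition chart_eqs M := commuting M /\ forall i, nf M (lamX i) = delta_mx 0 i.
Definition chart_ideal M : {mpoly A[n]} -> Prop := fun f => nf M f = 0.

Lemma nfD M f g : nf M (f + g) = nf M f + nf M g. Proof. exact: linearD. Qed.
Lemma nfB M f g : nf M (f - g) = nf M f - nf M g. Proof. exact: linearB. Qed.
Lemma nfZ M c f : nf M (c *: f) = c *: nf M f. Proof. exact: linearZ. Qed.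
Lemma nf_sum M (T : Type) (r : seq T) (Q : pred T) (F : T -> {mpoly A[n]}) :
  nf M (\sum_(i <- r | Q i) F i) = \sum_(i <- r | Q i) nf M (F i).
Proof. exact: linear_sum. Qed.

Lemma mactU M j : mact M U_(j)%MM = M j.
Proof.
rewrite /mact; under eq_bigr => i _.
  rewrite mnm1E (_ : M i ^+ _ = if i == j then M i else 1).
    over.
  by rewrite eq_sym; case: (eqVneq i j) => _; rewrite ?expr1 ?expr0.
by rewrite -big_mkcond big_pred1_eq.
Qed.

Lemma mactD M m m' : commuting M -> mact M (m + m')%MM = mact M m *m mact M m'.
Proof.
move=> cM; rewrite /mact.
have cX j l a b : GRing.comm (M j ^+ a) (M l ^+ b).
  by apply: commrX; apply: commr_sym; apply: commrX; apply: cM.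
under eq_bigr do rewrite mnmDE exprD.
elim: (index_enum _) => [|j r ih]; first by rewrite !big_nil mulmx1.
rewrite !big_cons ih !mulmxE -!mulrA; congr (_ * _); rewrite !mulrA; congr (_ * _).
have : GRing.comm (M j ^+ m' j) (\prod_(i <- r) M i ^+ m i).
  by apply: commr_prod => i _; apply: cX.
by [].
Qed.

Lemma nfX M m : nf M 'X_[m] = delta_mx 0 i0 *m mact M m.
Proof. exact: mlinX. Qed.

Lemma nf1 M : nf M 1 = delta_mx 0 i0.
Proof.
rewrite -mpolyX0 nfX /mact big1 ?mulmx1 // => j _; by rewrite mnm0E expr0.
Qed.

Lemma nfMX M j f : commuting M -> nf M (f * 'X_j) = nf M f *m M j.
Proof.
move=> cM; rewrite {1}(mpolyE f) [in RHS](mpolyE f) mulr_suml.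
rewrite nf_sum nf_sum mulmx_suml.
apply: eq_bigr => m _; rewrite -scalerAl -mpolyXD !nfZ !nfX.
by rewrite mactD // mactU -scalemxAl mulmxA.
Qed.

Lemma chart_ideal_ideal M : commuting M -> is_ideal (chart_ideal M).
Proof.
move=> cM; rewrite /chart_ideal; split; first exact: linear0.
  by move=> x y hx hy; rewrite nfD hx hy addr0.
move=> a x hx; rewrite mulrC; move: x hx; elim/mpoly_ring_ind: a.
- by move=> c x hx; rewrite mulrC mul_mpolyC nfZ hx scaler0.
- by move=> j x hx; rewrite nfMX // hx mul0mx.
- by move=> f g hf hg x hx; rewrite mulrDr nfD hf // hg // addr0.
- by move=> f g hf hg x hx; rewrite mulrA; apply: hg; apply: hf.
Qed.

Lemma nf_lc M (a : 'I_d -> A) : chart_eqs M -> nf M (\sum_i a i *: lamX i) = \row_i a i.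
Proof.
move=> [_ hM]; rewrite nf_sum; apply/rowP => j.
rewrite summxE mxE (bigD1 j) //= nfZ hM !mxE !eqxx mulr1 big1 ?addr0 //.
by move=> i ij; rewrite nfZ hM !mxE eq_sym (negbTE ij) andbF mulr0.
Qed.

Lemma chart_basis M : chart_eqs M -> quotient_basis (chart_ideal M) lamX.
Proof.
move=> hM; split=> [f|a].
  exists (nf M f 0); rewrite /chart_ideal nfB nf_lc //.
  by apply/rowP => j; rewrite !mxE subrr.
by rewrite /chart_ideal nf_lc // => /rowP h i; have := h i; rewrite !mxE.
Qed.

Lemma chart_mult M : chart_eqs M ->
  forall j i, chart_ideal M ('X_j * lamX i - \sum_l M j i l *: lamX l).
Proof.
move=> hM j i; rewrite /chart_ideal nfB nf_lc // mulrC nfMX; last by case: hM.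
rewrite (proj2 hM) -rowE; by apply/rowP => l; rewrite !mxE subrr.
Qed.

(** The multiplication rules reduce every monomial to its normal form, one
    variable at a time. *)
Lemma nf_reduce M J : commuting M -> is_ideal J ->
  (forall j i, J ('X_j * lamX i - \sum_l M j i l *: lamX l)) ->
  forall f, J (f - \sum_i nf M f 0 i *: lamX i).
Proof.
move=> cM hJ hX f.
rewrite (mpolyE f) nf_sum.
under [X in _ - X]eq_bigr do rewrite summxE scaler_suml.
rewrite exchange_big -sumrB; apply: ideal_sum => // m _ /=.
have H : forall m, J ('X_[m] - \sum_i nf M 'X_[m] 0 i *: lamX i).
  elim/mnm_ind => [|{}m j ih].
    rewrite mpolyX0 nf1 (bigD1 i0) //= big1 => [|i ii0]; last first.
      by rewrite mxE (negbTE ii0) andbF scale0r.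
    by rewrite mxE !eqxx scale1r addr0 /lamX lam0 mpolyX0 subrr; apply: ideal0.
  have := ideal_mull hJ 'X_j ih; rewrite mulrBr mpolyXD mulrC mulr_sumr.
  under eq_bigr do rewrite -scalerAr.
  move=> h1; have h2 := lc_subst hJ (nf M 'X_[m] 0) (hX j).
  have := idealD hJ h1 h2; rewrite subrKA.
  congr (J (_ - _)); apply: eq_bigr => i _; rewrite nfMX // mxE; congr (_ *: _).
under eq_bigr do rewrite nfZ mxE -scalerA.
by rewrite -scaler_sumr -scalerBr; apply: idealZ.
Qed.

(** The matrices commute since the products of two variables with the basis
    can be expanded in either order. *)
Lemma chart_exists J : is_ideal J -> quotient_basis J lamX ->
  exists M, chart_eqs M /\ ideal_eq J (chart_ideal M).
Proof.
move=> hJ hb.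
have /fin_all_exists [M hM] := fun j => basis_mx (fun i => 'X_j * lamX i) hb.
have cM : commuting M.
  move=> j l; apply: (basis_mx_uniq hJ hb (x := fun i => 'X_l * ('X_j * lamX i))).
    apply: lc_mx_subst (hM l) => //; apply: lc_mulX => //.
  move=> i; rewrite mulrCA; move: i.
  apply: lc_mx_subst (hM j) => //; apply: lc_mulX => //.
have red := nf_reduce cM hJ hM.
have eM : chart_eqs M.
  split=> // i; apply/rowP => l; rewrite mxE eqxx /=.
  have := basis_coef_uniq hJ hb (red (lamX i)) (lc_id hJ lamX i) l.
  by rewrite !mxE eq_sym.
exists M; split=> // f; rewrite (ideal_subE hJ (red f)) /chart_ideal.
case: hb => _ hi; split=> [/hi h|->]; first by apply/rowP => i; rewrite h mxE.
rewrite big1 => [|i _]; first exact: ideal0.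
by rewrite mxE scale0r.
Qed.

Lemma chart_uniq M M' : chart_eqs M ->
  (forall j i, chart_ideal M ('X_j * lamX i - \sum_l M' j i l *: lamX l)) -> M =1 M'.
Proof.
move=> hM h' j.
apply: (basis_mx_uniq (chart_ideal_ideal (proj1 hM)) (chart_basis hM) (chart_mult hM j)).
exact: h'.
Qed.

Lemma chart_inj M M' : chart_eqs M -> chart_eqs M' ->
  ideal_eq (chart_ideal M) (chart_ideal M') -> M =1 M'.
Proof. by move=> hM hM' h; apply: chart_uniq => // j i; apply/h/chart_mult. Qed.

Lemma nf_ext M M' : M =1 M' -> nf M =1 nf M'.
Proof.
move=> h f; apply: eq_bigr => m _; congr (_ *: (_ *m _)).
by apply: eq_bigr => j _; rewrite h.
Qed.

Lemma chart_eqs_ext M M' : M =1 M' -> chart_eqs M' -> chart_eqs M.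
Proof.
move=> h [c e]; split=> [j l|i]; first by rewrite !h.
by rewrite (nf_ext h).
Qed.

Lemma chart_ideal_ext M M' : M =1 M' -> ideal_eq (chart_ideal M) (chart_ideal M').
Proof.
by move=> h f; rewrite /chart_ideal (nf_ext h).
Qed.

End OverRing.

Section ChartBaseChange.
Context (A B : comNzRingType) (phi : {rmorphism A -> B}).
Implicit Types (M : 'I_n -> 'M[A]_d).

Definition mapM M j := map_mx phi (M j).

Lemma mact_map M m : mact (mapM M) m = map_mx phi (mact M m).
Proof.
rewrite /mact (big_morph (map_mx phi) (@map_mxM _ _ phi _ _ _) (map_mx1 phi _)).
apply: eq_bigr => j _; rewrite /mapM.
elim: (m j) => [|e ih]; first by rewrite !expr0 map_mx1.
by rewrite !exprS ih map_mxM.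
Qed.

Lemma nf_map M f : nf (mapM M) (map_mpoly phi f) = map_mx phi (nf M f).
Proof.
have -> : map_mpoly phi f = \sum_(m <- msupp f) phi f@_m *: 'X_[m].
  rewrite {1}(mpolyE f) raddf_sum; apply: eq_bigr => m _ /=.
  by rewrite map_mpolyZ map_mpolyX.
rewrite [in RHS](mpolyE f) !nf_sum raddf_sum; apply: eq_bigr => m _ /=.
rewrite !nfZ map_mxZ !nfX mact_map map_mxM map_delta_mx //.
Qed.

Lemma chart_eqs_map M : chart_eqs M -> chart_eqs (mapM M).
Proof.
move=> [cM hM]; split; first by move=> j l; rewrite /mapM -!map_mxM cM.
move=> i; have := nf_map M (lamX A i); rewrite hM map_delta_mx.
by rewrite map_mpolyX.
Qed.

(** An ideal containing the multiplication rules contains the difference of a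
    polynomial and its normal form. *)
Lemma chart_base_change M : chart_eqs M ->
  ideal_eq (base_change phi (chart_ideal M)) (chart_ideal (mapM M)).
Proof.
move=> hM; have hM' := chart_eqs_map hM.
have cI := chart_ideal_ideal (proj1 hM').
move=> f; split; move: f.
  apply: base_change_min => // f; rewrite /chart_ideal nf_map => ->.
  exact: map_mx0.
move=> f hf; have BI := base_change_ideal phi (chart_ideal M).
have := nf_reduce (proj1 hM') BI _ f; rewrite hf.
rewrite big1 ?subr0; first apply.
  move=> j i; have := base_change_mem phi (chart_mult hM j i).
  rewrite rmorphB rmorphM /= !map_mpolyX map_mpoly_lc.
  congr (base_change _ _ (_ - _)); apply: eq_bigr => l _.
  by rewrite map_mpolyX mxE.
by move=> i _; rewrite mxE scale0r.
Qed.

End ChartBaseChange.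

Lemma hilb_of_chart (A : comNzRingType) (M : 'I_n -> 'M[A]_d) :
  chart_eqs M -> hilb_mem d (chart_ideal M).
Proof.
move=> hM; have hI := chart_ideal_ideal (proj1 hM); have hb := chart_basis hM.
split=> //.
- by exists d, (@lamX A); case: hb.
- move=> m a x h.
  have /fin_all_exists [b hx] := fun i => hb.1 (x i).
  exists d, b, (@lamX A); split=> // j.
  apply: (hb.2 (fun j => \sum_i a i * b i j)).
  exact: (proj1 (ideal_subE hI (lc_subst hI a hx)) h).
- move=> K phi; exists (@lamX K).
  have [hs hi] := chart_basis (chart_eqs_map phi hM).
  have E := chart_base_change phi hM.
  split=> [f|a h]; last by apply: hi; apply/E.
  by have [a ha] := hs f; exists a; apply/E.
Qed.

(** The rule for [M'] is [M' j i l = u ^ (deg i + 1 - deg l) * M j i l], stated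
    without negative exponents. *)
Lemma scale_chart (A : comNzRingType) (u w : A) (M M' : 'I_n -> 'M[A]_d) :
  u * w = 1 -> commuting M -> commuting M' ->
  (forall j i l, M' j i l * u ^+ mdeg (lam l) = u ^+ (mdeg (lam i)).+1 * M j i l) ->
  ideal_eq (scale u (chart_ideal M)) (chart_ideal M').
Proof.
move=> uw cM cM' hu.
have key f l : nf M' f 0 l * u ^+ mdeg (lam l) = nf M (f \mPo [tuple u *: 'X_i | i < n]) 0 l.
  have -> : f \mPo [tuple u *: 'X_i | i < n] =
      \sum_(m <- msupp f) f@_m *: ('X_[m] \mPo [tuple u *: 'X_i | i < n]).
    rewrite {1}(mpolyE f) raddf_sum; apply: eq_bigr => m _.
    exact: comp_mpolyZ.
  rewrite {1}(mpolyE f) !nf_sum !summxE mulr_suml.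
  apply: eq_bigr => m _.
  rewrite !nfZ !mxE -mulrA; congr (_ * _); move: m l.
  elim/mnm_ind => [|m j ih] l.
    rewrite mpolyX0 nf1 comp_mpoly1 nf1 mxE eqxx /=.
    by case: eqP => [->|_]; rewrite ?mul0r // lam0 mdeg0 expr0 mulr1.
  rewrite mpolyXD rmorphM /= nfMX // comp_mpolyXU -tnth_nth tnth_mktuple.
  rewrite -scalerAr nfZ nfMX // !mxE mulr_suml mulr_sumr.
  by apply: eq_bigr => i _; rewrite -mulrA hu -ih exprS; ring.
move=> f; rewrite /scale /chart_ideal; split=> h.
  apply/rowP => l; rewrite mxE.
  have := key f l; rewrite h mxE => /(congr1 (fun x => x * w ^+ mdeg (lam l))).
  by rewrite -mulrA -exprMn uw expr1n mulr1 mul0r.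
by apply/rowP => l; rewrite -key h !mxE mul0r.
Qed.

End Chart.

(** * Openness of the locus where given monomials form a basis *)

(** The equational criterion for several relations at once: the criterion for
    the first relation gives new generators, and the other relations become
    relations between these. *)
Lemma flat_relations (n : nat) (A : comNzRingType) (J : {mpoly A[n]} -> Prop) :
  is_ideal J -> quotient_flat J ->
  forall r m (c : 'I_r -> 'I_m -> A) (x : 'I_m -> {mpoly A[n]}),
    (forall l, J (\sum_i c l i *: x i)) ->
    exists s (g : 'I_m -> 'I_s -> A) (y : 'I_s -> {mpoly A[n]}),
      (forall i, J (x i - \sum_t g i t *: y t)) /\
      (forall l t, \sum_i c l i * g i t = 0).
Proof.
move=> hJ hF; elim=> [|r ih] m c x hc.
  exists m, (fun i j => (1%:M : 'M_m) i j), x; split=> [i|[]//]; exact: lc_id.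
have [s [b [y [hx hb]]]] := hF _ _ _ (hc ord0).
have [|s' [g [z [hy hg]]]] := ih s (fun l j => \sum_i c (lift ord0 l) i * b i j) y.
  by move=> l; apply: (proj1 (ideal_subE hJ (lc_subst hJ _ hx))).
exists s', (fun i t => \sum_j b i j * g j t), z; split.
  move=> i; rewrite -(subrKA (\sum_j b i j *: y j)); apply: idealD => //.
  exact: lc_subst.
move=> l t; under eq_bigr do rewrite mulr_sumr.
rewrite exchange_big /=.
case: (unliftP ord0 l) => [l'|] ->; last first.
  rewrite big1 // => j _; under eq_bigr do rewrite mulrA.
  by rewrite -mulr_suml hb mul0r.
rewrite -[RHS](hg l' t); apply: eq_bigr => j _.
by rewrite mulr_suml; apply: eq_bigr => i _; rewrite mulrA.
Qed.

Section Span.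
Context (n d : nat) (lam : 'I_d -> 'X_{1..n}).

Definition lam_spans (A : comNzRingType) (J : {mpoly A[n]} -> Prop) : Prop :=
  forall f, exists a : 'I_d -> A, J (f - \sum_i a i *: lamX lam A i).

Section SpanModule.
Context (A : comNzRingType) (J : {mpoly A[n]} -> Prop) (hJ : is_ideal J).
Let G f := exists a : 'I_d -> A, J (f - \sum_i a i *: lamX lam A i).

Lemma span_mod0 : G 0.
Proof.
exists (fun=> 0); rewrite big1 ?subrr; first exact: ideal0.
by move=> i _; rewrite scale0r.
Qed.
Lemma span_modD f g : G f -> G g -> G (f + g).
Proof.
move=> [a ha] [b hb]; exists (fun i => a i + b i).
under eq_bigr do rewrite scalerDl.
by rewrite big_split opprD addrACA; apply: idealD.
Qed.
Lemma span_modZ c f : G f -> G (c *: f).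
Proof.
move=> [a ha]; exists (fun i => c * a i).
under eq_bigr do rewrite -scalerA.
by rewrite -scaler_sumr -scalerBr; apply: idealZ.
Qed.
Lemma span_mod_sum (T : Type) (r : seq T) (Q : pred T) (F : T -> {mpoly A[n]}) :
  (forall i, Q i -> G (F i)) -> G (\sum_(i <- r | Q i) F i).
Proof. by move=> h; apply: (big_ind G) => //; [exact: span_mod0 | exact: span_modD]. Qed.
Lemma span_mod_congr f g : J (f - g) -> G g -> G f.
Proof.
by move=> h [a ha]; exists a; rewrite -(subrKA g); apply: idealD.
Qed.
Lemma span_modX : (forall m, G 'X_[m]) -> lam_spans J.
Proof.
move=> h f; rewrite (mpolyE f); apply: span_mod_sum => m _; exact: span_modZ.
Qed.
End SpanModule.

Lemma span_base_change (A B : comNzRingType) (phi : {rmorphism A -> B})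
    (J : {mpoly A[n]} -> Prop) : is_ideal J -> lam_spans J -> lam_spans (base_change phi J).
Proof.
move=> hJ h; apply: span_modX; first exact: base_change_ideal.
move=> m; have [a ha] := h 'X_[m]; exists (fun i => phi (a i)).
have := base_change_mem phi ha; rewrite rmorphB /= map_mpolyX map_mpoly_lc.
congr (base_change _ _ (_ - _)); apply: eq_bigr => i _; by rewrite map_mpolyX.
Qed.

(** Let [\sum_i a i *: lam i] lie in the base change of [J].  As a relation over
    [B], it is a combination of images of relations over [A] between monomials.
    Trivialising the latter by flatness and expressing the new generators in
    [lam] over [B] gives a matrix [M] with [lam = M lam] and [a M = 0].  Over a
    field [lam] is a basis for reasons of dimension, so that [M] is the
    identity there; hence [\det M] is a unit and [a = 0]. *)
Lemma span_basis (A B : comNzRingType) (phi : {rmorphism A -> B})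
    (J : {mpoly A[n]} -> Prop) :
  hilb_mem d J -> lam_spans (base_change phi J) ->
  quotient_basis (base_change phi J) (lamX lam B).
Proof.
move=> [hJ _ hF hR] sp; split=> // a ha.
have BI := base_change_ideal phi J.
have [r [c' [f [Jf fE]]]] := base_change_lc hJ ha.
(* All polynomials involved have degree less than [b]. *)
pose b := (\sum_l msize (f l) + \sum_i mdeg (lam i)).+1%N.
pose T : finType := 'X_{1..n < b}.
pose ev (j : 'I_#|T|) : 'X_{1..n} := bmnm (enum_val j).
have hfl l : \sum_j (f l)@_(ev j) *: 'X_[ev j] = f l.
  rewrite [RHS](@mpolywE _ _ b); last first.
    by rewrite /b (bigD1 l) //= -addnA; apply/leqW/leq_addr.
  rewrite [RHS](reindex (fun j : 'I_#|T| => enum_val j)) //.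
  exact/onW_bij/enum_val_bij.
have [|s [g [y [hx hg]]]] :=
  @flat_relations _ _ _ hJ hF r #|T| (fun l j => (f l)@_(ev j)) (fun j => 'X_[ev j]).
  by move=> l; rewrite hfl.
have lp i : (mdeg (lam i) < b)%N.
  by rewrite /b ltnS (bigD1 i) //= addnCA; apply: leq_addr.
pose pos i : 'I_#|T| := enum_rank (BMultinom (lp i) : T).
have evpos i : ev (pos i) = lam i by rewrite /ev /pos enum_rankK.
have /fin_all_exists [h hy] := fun t => sp (map_mpoly phi (y t)).
pose M : 'M[B]_d := \matrix_(i, l) \sum_t phi (g (pos i) t) * h t l.
have hM i : base_change phi J (lamX lam B i - \sum_l M i l *: lamX lam B l).
  have := base_change_mem phi (hx (pos i)).
  rewrite rmorphB /= map_mpolyX map_mpoly_lc evpos => h1.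
  have h2 := lc_subst BI (fun t => phi (g (pos i) t)) hy.
  have := idealD BI h1 h2; rewrite subrKA.
  by congr (base_change _ _ (_ - _)); apply: eq_bigr => l _; rewrite mxE.
have aM : \row_i a i *m M = 0.
  apply/rowP => l; rewrite !mxE.
  under eq_bigr do rewrite !mxE mulr_sumr.
  rewrite exchange_big big1 // => t _ /=.
  under eq_bigr do rewrite mulrA.
  rewrite -mulr_suml.
  have coefE j : \sum_i a i * (i \in [pred i | pos i == j])%:R =
      \sum_l0 c' l0 * phi (f l0)@_(ev j).
    have := congr1 (mcoeff (ev j)) fE; rewrite !raddf_sum /= => e.
    transitivity (\sum_i (a i *: lamX lam B i)@_(ev j)).
      apply: eq_bigr => i _; rewrite mcoeffZ mcoeffX; congr (_ * _%:R).
      rewrite inE; congr nat_of_bool; apply/eqP/eqP => [<-|e']; first by rewrite evpos.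
      by apply: enum_val_inj; apply: val_inj; rewrite /= -/(ev _) -/(ev j) evpos.
    by rewrite e; apply: eq_bigr => i _; rewrite mcoeffZ mcoeff_map_mpoly.
  rewrite (_ : \sum_i _ = 0) ?mul0r //.
  transitivity (\sum_j (\sum_i a i * (i \in [pred i | pos i == j])%:R) * phi (g j t)).
    under [RHS]eq_bigr do rewrite mulr_suml.
    rewrite exchange_big; apply: eq_bigr => i _ /=.
    rewrite (bigD1 (pos i)) //= inE eqxx mulr1 big1 ?addr0 // => j.
    by rewrite inE eq_sym => /negbTE ->; rewrite mulr0 mul0r.
  under eq_bigr do rewrite coefE mulr_suml.
  rewrite exchange_big big1 // => l0 _ /=.
  under eq_bigr do rewrite -mulrA -rmorphM.
  by rewrite -mulr_sumr -rmorph_sum hg rmorph0 mulr0.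
have [z zM] : exists z, z * \det M = 1.
  apply: unit_from_fields => K psi.
  rewrite -det_map_mx; suff -> : map_mx psi M = 1%:M by rewrite det1 oner_eq0.
  have [e he] := hR K [the {rmorphism A -> K} of psi \o phi].
  set JK := base_change _ J in he.
  have JKI : is_ideal JK by exact: base_change_ideal.
  have JKE : ideal_eq JK (base_change psi (base_change phi J)).
    exact: base_change_comp.
  have spK : lam_spans JK.
    move=> x; have [v hv] := span_base_change psi BI sp x; exists v; exact/JKE.
  have hMK i : JK (lamX lam K i - \sum_l map_mx psi M i l *: lamX lam K l).
    apply/JKE; have := base_change_mem psi (hM i).
    rewrite rmorphB /= map_mpolyX map_mpoly_lc.
    congr (base_change _ _ (_ - _)); apply: eq_bigr => l _.
    by rewrite map_mpolyX [in RHS]mxE.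
  have [L hL] := basis_mx (lamX lam K) he.
  have /fin_all_exists [E0 hE0] := fun i => spK (e i).
  pose E : 'M_d := \matrix_(i, l) E0 i l.
  have hE i : JK (e i - \sum_l E i l *: lamX lam K l).
    by under eq_bigr do rewrite mxE.
  have EL : E *m L = 1%:M.
    by apply: (basis_mx_uniq JKI he (lc_mx_subst JKI hE hL)); apply: lc_id.
  have ML : map_mx psi M *m L = L.
    exact: (basis_mx_uniq JKI he (lc_mx_subst JKI hMK hL) hL).
  have LE := mulmx1C EL.
  by rewrite -[LHS]mulmx1 -LE mulmxA ML.
move=> i; have := congr1 (fun x => x *m \adj M) aM.
rewrite -mulmxA mul_mx_adj mul0mx mul_mx_scalar => /rowP/(_ i); rewrite !mxE.
by move=> h0; rewrite -[a i]mul1r -zM -mulrA h0 mulr0.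
Qed.

(** The determinant is linear in each row, so that the rows can be brought into
    [Rel] one at a time. *)
Lemma det_row_span (B : comNzRingType) (m : nat) (Rel : 'rV[B]_m -> Prop) (I : B -> Prop) :
  is_ideal I ->
  (forall V : 'M_m, (forall i, Rel (row i V)) -> I (\det V)) ->
  forall V : 'M_m, (forall i, forall U : 'rV_m -> Prop, U 0 ->
     (forall b u v, U u -> U v -> U (b *: u + v)) -> (forall u, Rel u -> U u) ->
     U (row i V)) -> I (\det V).
Proof.
move=> hI h.
pose S (v : 'rV_m) := forall U : 'rV_m -> Prop, U 0 ->
     (forall b u v, U u -> U v -> U (b *: u + v)) -> (forall u, Rel u -> U u) -> U v.
suff H : forall t, forall V : 'M_m, (forall i : 'I_m, if (i < t)%N then S (row i V) else Rel (row i V)) ->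
    I (\det V).
  by move=> V hV; apply: (H m) => i; rewrite ltn_ord; apply: hV.
elim=> [|t ih] V hV; first by apply: h.
have [tm|tm] := ltnP t m; last first.
  apply: ih => i; have := hV i; have it : (i < t)%N by apply: leq_trans tm.
  by rewrite it ltnS (ltnW it).
pose it := Ordinal tm.
(* Cofactors along row [it] ignore this row, so [\det (V' v)] is linear in [v]. *)
pose V' (v : 'rV_m) : 'M_m := \matrix_(i, j) if i == it then v 0 j else V i j.
have detV' v : \det (V' v) = \sum_j v 0 j * cofactor V it j.
  rewrite (expand_det_row _ it); apply: eq_bigr => j _.
  rewrite mxE eqxx; congr (_ * (_ * \det _)).
  by apply/matrixP => a c; rewrite !mxE eq_sym (negbTE (neq_lift _ _)).
have := hV it; rewrite ltnSn => /(_ (fun v => I (\det (V' v)))).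
have VE : V' (row it V) = V.
  by apply/matrixP => i j; rewrite !mxE; case: eqP => // ->.
rewrite VE; apply.
- by rewrite detV' big1 => [|j _]; [apply: ideal0 | rewrite mxE mul0r].
- move=> b u v hu hv; rewrite detV'.
  under eq_bigr do rewrite !mxE mulrDl -mulrA.
  rewrite big_split -mulr_sumr /= -!detV'; apply: idealD => //; exact: ideal_mull.
- move=> u ru; apply: ih => i; have := hV i.
  have [e|ni] := eqVneq i it.
    rewrite e ltnn /= => _; suff -> : row it (V' u) = u by [].
    by apply/rowP => j; rewrite !mxE eqxx.
  have -> : row i (V' u) = row i V by apply/rowP => j; rewrite !mxE (negbTE ni).
  rewrite ltnS leq_eqVlt; suff /negbTE -> : val i != t by [].
  by apply: contra ni => /eqP e; apply/eqP/val_inj.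
Qed.

(** Over [A], the cokernel of [lam] has the generators [x j] and the relations
    [Rel].  The ideal of the complement is generated by the maximal minors of
    [Rel]: by Cramer's rule these minors kill the cokernel, and conversely, if
    the cokernel vanishes over [B], then the rows of the identity are
    combinations of relations. *)
Lemma span_open (A : comNzRingType) (J : {mpoly A[n]} -> Prop) :
  is_ideal J -> quotient_finite J ->
  exists a : A -> Prop, forall (B : comNzRingType) (phi : {rmorphism A -> B}),
    lam_spans (base_change phi J) <->
    ideal_gen (fun b : B => exists2 c, a c & b = phi c) 1.
Proof.
move=> hJ [m [x hx]].
have [r hR] := coordinates_exist hJ hx.
pose R := mlin r.
pose spn (A' : comNzRingType) (J' : {mpoly A'[n]} -> Prop) f :=
  exists c : 'I_d -> A', J' (f - \sum_i c i *: lamX lam A' i).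
pose Rel (rho : 'rV[A]_m) := spn A J (\sum_j rho 0 j *: x j).
exists (fun c => exists2 rho : 'M[A]_m, (forall i, Rel (row i rho)) & c = \det rho).
move=> B phi; have BI := base_change_ideal phi J.
set I := ideal_gen _; have II : is_ideal I by exact: ideal_gen_ideal.
have spn_map f : spn A J f -> spn B (base_change phi J) (map_mpoly phi f).
  move=> [c hc]; exists (fun i => phi (c i)); have := base_change_mem phi hc.
  rewrite rmorphB /= map_mpoly_lc.
  congr (base_change _ _ (_ - _)); apply: eq_bigr => l _.
  by rewrite map_mpolyX.
split=> [sp|].
- rewrite -(det1 B m).
  apply: (@det_row_span _ _ (fun u => exists2 rho, Rel rho & u = map_mx phi rho) I II).
    move=> V hV; have /fin_all_exists2 [rho h1 h2] := hV.
    apply: mem_ideal_gen; exists (\det (\matrix_i rho i)).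
      by exists (\matrix_i rho i) => // i; rewrite rowK.
    rewrite -det_map_mx; congr (\det _); apply/row_matrixP => i.
    by rewrite h2 -map_row rowK.
  move=> j U U0 UP URel.
  have UZ b u : U u -> U (b *: u) by move=> hu; rewrite -[_ *: _]addr0; apply: UP.
  have UD u v : U u -> U v -> U (u + v) by move=> hu hv; rewrite -[u]scale1r; apply: UP.
  have Usum (T : finType) (F : T -> 'rV_m) : (forall i, U (F i)) -> U (\sum_i F i).
    by move=> h; apply: (big_ind U).
  pose RB : {mpoly B[n]} -> 'rV[B]_m := mlin (fun mu => map_mx phi (r mu)).
  have RBZ c f : RB (c *: f) = c *: RB f by exact: linearZ.
  have RBD f g : RB (f + g) = RB f + RB g by exact: linearD.
  have RBsum (T : Type) (s : seq T) (F : T -> {mpoly B[n]}) :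
    RB (\sum_(i <- s) F i) = \sum_(i <- s) RB (F i) by exact: linear_sum.
  have RBmap f : RB (map_mpoly phi f) = map_mx phi (R f).
    have -> : map_mpoly phi f = \sum_(mu <- msupp f) phi f@_mu *: 'X_[mu].
      rewrite {1}(mpolyE f) raddf_sum; apply: eq_bigr => mu _ /=.
      by rewrite map_mpolyZ map_mpolyX.
    rewrite RBsum /R /mlin raddf_sum; apply: eq_bigr => mu _ /=.
    by rewrite RBZ map_mxZ /RB mlinX.
  have Umap f : spn A J f -> U (map_mx phi (R f)).
    move=> hf; apply: URel; exists (R f) => //.
    apply: (span_mod_congr hJ) hf; rewrite -opprB; apply: idealN => //.
  have [c hc] := sp (map_mpoly phi (x j)).
  have [s [b [f [Jf E]]]] := base_change_lc hJ hc.
  have {}E : map_mpoly phi (x j) =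
      \sum_i b i *: map_mpoly phi (f i) + \sum_i c i *: map_mpoly phi (lamX lam A i).
    rewrite -E; under [X in _ = _ + X]eq_bigr do rewrite map_mpolyX.
    by rewrite subrK.
  have -> : row j (1%:M : 'M[B]_m) = map_mx phi (row j 1%:M - R (x j)) + RB (map_mpoly phi (x j)).
    by rewrite RBmap map_mxB subrK map_row map_mx1.
  apply: (UD).
    apply: (URel); exists (row j 1%:M - R (x j)) => //; exists (fun=> 0).
    rewrite [X in _ - X]big1 ?subr0 => [|i _]; last by rewrite scale0r.
    under eq_bigr do rewrite mxE scalerDl.
    rewrite big_split /= (bigD1 j) //= big1 => [|i ij]; last first.
      by rewrite !mxE eq_sym (negbTE ij) scale0r.
    rewrite !mxE eqxx scale1r addr0; have := hR (x j).
    congr (J (_ + _)); rewrite -sumrN; apply: eq_bigr => i _.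
    by rewrite mxE scaleNr.
  rewrite E RBD !RBsum; apply: (UD); apply: (Usum) => i; rewrite RBZ RBmap; apply: (UZ); apply: (Umap).
    exists (fun=> 0); rewrite big1 ?subr0 // => l _; by rewrite scale0r.
  exists (fun l => (1%:M : 'M_d) i l); exact: lc_id.
- have S0 := span_mod0 BI; have SD := span_modD BI; have SZ := span_modZ BI.
  move=> h1; have key : forall b, I b -> forall j, spn B (base_change phi J) (b *: map_mpoly phi (x j)).
    apply: ideal_gen_min.
      split=> [j|u v hu hv j|c u hu j]; first by rewrite scale0r.
        by rewrite scalerDl; apply: SD (hu j) (hv j).
      by rewrite -scalerA; apply: SZ (hu j).
    move=> _ [_ [rho hrho ->] ->] j.
    have -> : phi (\det rho) *: map_mpoly phi (x j) = map_mpoly phi (\det rho *: x j).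
      by rewrite map_mpolyZ.
    apply: spn_map.
    have -> : \det rho *: x j = \sum_i (\adj rho) j i *: \sum_l rho i l *: x l.
      under eq_bigr do rewrite scaler_sumr.
      rewrite exchange_big /=.
      under eq_bigr do under eq_bigr do rewrite scalerA.
      under eq_bigr do rewrite -scaler_suml.
      have E l : \sum_i \adj rho j i * rho i l = (\det rho)%:M j l.
        by rewrite -mul_adj_mx mxE.
      under eq_bigr do rewrite E mxE.
      rewrite (bigD1 j) //= eqxx mulr1n big1 ?addr0 // => l /negbTE ji.
      by rewrite eq_sym ji mulr0n scale0r.
    apply: span_mod_sum => // i _; apply: span_modZ => //.
    have := hrho i; rewrite /Rel; congr (spn _ _ _); apply: eq_bigr => l _.
    by rewrite mxE.
  apply: span_modX => // mu.
  apply: (span_mod_congr BI (g := \sum_j phi (r mu 0 j) *: map_mpoly phi (x j))).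
    have := base_change_mem phi (hR 'X_[mu]); rewrite mlinX.
    by rewrite rmorphB /= map_mpolyX map_mpoly_lc.
  apply: span_mod_sum => // j _; apply: SZ.
  by rewrite -[map_mpoly _ _]scale1r; apply: key.
Qed.
End Span.

(** * Monomial bases stable under divisors *)

Section StandardMonomials.
Context (k : fieldType) (n : nat) (I : {mpoly k[n]} -> Prop) (hI : is_ideal I).

(** Monomials that are not congruent to a combination of smaller ones for the
    degree lexicographic order. *)
Definition standard (m : 'X_{1..n}) : Prop :=
  ~ exists g : {mpoly k[n]}, (forall m', m' \in msupp g -> (m' < m)%O) /\ I ('X_[m] - g).

Definition standard_supp (f : {mpoly k[n]}) := forall m, m \in msupp f -> standard m.

Lemma standard_div m m' : standard (m + m')%MM -> standard m.
Proof.
move=> h [g [hg Ig]]; apply: h; exists (g * 'X_[m']); split.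
  move=> mu; rewrite mcoeff_msupp => h.
  have : mu \in msupp (g * 'X_[m']) by rewrite mcoeff_msupp.
  move/msuppM_le /allpairsP => -[[a b] /= [ha]].
  rewrite msuppX inE => /eqP -> ->.
  by rewrite ltmc_add2l; apply: hg.
by rewrite mpolyXD -mulrBl; apply: ideal_mulr.
Qed.

(** Otherwise the leading monomial of [f] would not be standard. *)
Lemma standard_indep f : I f -> standard_supp f -> f = 0.
Proof.
move=> If hf; apply/eqP; apply: contraT => f0; exfalso.
apply: (hf (mlead f)); first exact: mlead_supp.
have c0 : f@_(mlead f) != 0 by rewrite mleadc_eq0.
exists ('X_[mlead f] - (f@_(mlead f))^-1 *: f); split.
  move=> m; rewrite mcoeff_msupp mcoeffB mcoeffX mcoeffZ.
  case: (eqVneq (mlead f) m) => [<-|ne]; first by rewrite mulVf // subrr eqxx.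
  rewrite sub0r oppr_eq0 mulf_eq0 negb_or => /andP [_ h].
  rewrite lt_neqAle eq_sym ne /=; apply: msupp_le_mlead.
  by rewrite mcoeff_msupp.
by rewrite opprB addrC subrK; apply: idealZ.
Qed.

Let G f := exists2 g, standard_supp g & I (f - g).

Let G0 : G 0.
Proof. by exists 0; [move=> m; rewrite msupp0 | rewrite subrr; apply: ideal0]. Qed.
Let GD f g : G f -> G g -> G (f + g).
Proof.
move=> [a ha Ia] [b hb Ib]; exists (a + b).
  by move=> m /msuppD_le; rewrite mem_cat => /orP [/ha|/hb].
by rewrite opprD addrACA; apply: idealD.
Qed.
Let GZ c f : G f -> G (c *: f).
Proof.
move=> [a ha Ia]; exists (c *: a); last by rewrite -scalerBr; apply: idealZ.
by move=> m /msuppZ_le /ha.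
Qed.

Lemma standard_span f : exists2 g, standard_supp g & I (f - g).
Proof.
have GX : forall m, G 'X_[m].
  apply: ltmwf => m ih.
  have [sm|] := boolp.pselect (standard m).
    exists 'X_[m]; last by rewrite subrr; apply: ideal0.
    by move=> m'; rewrite msuppX inE => /eqP ->.
  move/boolp.contrapT => [g [hg Ig]].
  have [a ha Ia] : G g.
    rewrite (mpolyE g) big_seq; apply: (big_ind G) => // m' /hg hm'.
    by apply: GZ; apply: ih.
  by exists a => //; rewrite -(subrKA g); apply: idealD.
rewrite -/(G f) (mpolyE f); apply: (big_ind G) => // m _; exact: GZ.
Qed.

(** The standard monomials that occur in normal forms of the [e i] already
    form a basis, so that there is no other standard monomial, and divisors of
    standard monomials are standard. *)
Lemma standard_basis d : (0 < d)%N ->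
  (exists e : 'I_d -> {mpoly k[n]}, quotient_basis I e) ->
  exists (lam : 'I_d -> 'X_{1..n}) (i0 : 'I_d),
    [/\ lam i0 = 0%MM, quotient_basis I (lamX lam k) &
        forall i m m', lam i = (m + m')%MM -> exists j, lam j = m].
Proof.
move=> d0 [e he].
have /fin_all_exists2 [g sg Ig] := fun i => standard_span (e i).
pose L := undup (flatten [seq msupp (g i) | i <- enum 'I_d]).
have uL : uniq L by apply: undup_uniq.
have memL i m : m \in msupp (g i) -> m \in L.
  move=> h; rewrite mem_undup; apply/flattenP; exists (msupp (g i)) => //.
  by apply: map_f; rewrite mem_enum.
have sL m : m \in L -> standard m.
  by rewrite mem_undup => /flattenP [_ /mapP [i _ ->]]; apply: sg.
pose lamL (i : 'I_(size L)) := tnth (in_tuple L) i.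
have lamLE i : lamL i \in L by apply: mem_tnth.
have lamL_inj : injective lamL by apply/tuple_uniqP.
have expand f : (forall m, m \in msupp f -> m \in L) ->
    f = \sum_i f@_(lamL i) *: lamX lamL k i.
  move=> hf; apply/mpolyP => m; rewrite raddf_sum /=.
  under eq_bigr do rewrite mcoeffZ mcoeffX.
  have [mL|mL] := boolP (m \in L).
    have /tnthP [i mi] := (mL : m \in in_tuple L).
    rewrite mi -/(lamL i) (bigD1 i) //= eqxx mulr1 big1 ?addr0 // => j ji.
    by rewrite (inj_eq lamL_inj) (negbTE ji) mulr0.
  rewrite big1 => [|i _]; first by rewrite memN_msupp_eq0 //; apply: contra mL => /hf.
  case: eqP => [E|_]; last by rewrite mulr0.
  by rewrite -E lamLE in mL.
have indL (a : 'I_(size L) -> k) : I (\sum_i a i *: lamX lamL k i) -> forall i, a i = 0.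
  move=> /standard_indep h i.
  have coefE : (\sum_j a j *: lamX lamL k j)@_(lamL i) = a i.
    rewrite raddf_sum (bigD1 i) //= mcoeffZ mcoeffX eqxx mulr1 big1 ?addr0 // => j ji.
    by rewrite mcoeffZ mcoeffX (inj_eq lamL_inj) (negbTE ji) mulr0.
  rewrite -coefE h ?mcoeff0 // => m /msupp_sum_le /flattenP [s /mapP [j _ ->]].
  by move=> /msuppZ_le; rewrite msuppX inE => /eqP ->; apply: sL; apply: lamLE.
have bL : quotient_basis I (lamX lamL k).
  split=> // f; have [a ha] := he.1 f.
  pose h := \sum_i a i *: g i.
  have hL m : m \in msupp h -> m \in L.
    move=> /msupp_sum_le /flattenP [s /mapP [j _ ->]].
    by move=> /msuppZ_le; apply: memL.
  exists (fun i => h@_(lamL i)); rewrite -expand //.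
  rewrite -(subrKA (\sum_i a i *: e i)); apply: idealD => //.
  rewrite -sumrB; apply: ideal_sum => // i _.
  by rewrite -scalerBr; apply: idealZ.
have eqd := basis_card hI bL he.
have inL m : standard m -> exists i, lamL i = m.
  move=> sm; have [a ha] := bL.1 'X_[m].
  have z : 'X_[m] - \sum_i a i *: lamX lamL k i = 0.
    apply: standard_indep => // m' /msuppB_le; rewrite mem_cat => /orP [].
      by rewrite msuppX inE => /eqP ->.
    move=> /msupp_sum_le /flattenP [s /mapP [j _ ->]].
    by move=> /msuppZ_le; rewrite msuppX inE => /eqP ->; apply: sL; apply: lamLE.
  apply: boolp.contrapT => no.
  have := congr1 (mcoeff m) z; rewrite mcoeffB mcoeffX eqxx mcoeff0 raddf_sum /= big1.
    by move/eqP; rewrite subr0 oner_eq0.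
  move=> i _; rewrite mcoeffZ mcoeffX; case: eqP => [E|_]; last by rewrite mulr0.
  by case: no; exists i.
clear expand indL; move: lamL lamLE lamL_inj bL inL; rewrite eqd => lam lamE _ bL inL.
have s0 : standard 0%MM.
  have := sL _ (lamE (Ordinal d0)); rewrite -[lam _]add0m; exact: standard_div.
have [i0 hi0] := inL _ s0.
exists lam, i0; split=> // i m m' E; apply: inL.
by have := sL _ (lamE i); rewrite E; apply: standard_div.
Qed.

End StandardMonomials.

(** * Translations *)

Section Translation.
Context (n d : nat) (lam : 'I_d -> 'X_{1..n}) (i0 : 'I_d).
Hypothesis lam0 : lam i0 = 0%MM.
Hypothesis lam_div : forall i m m', lam i = (m + m')%MM -> exists j, lam j = m.

Section Tau.
Context (A : comNzRingType).

Definition tau (c : 'I_n -> A) : {mpoly A[n]} -> {mpoly A[n]} :=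
  comp_mpoly [tuple 'X_i + (c i)%:MP | i < n].
HB.instance Definition _ c := GRing.RMorphism.on (tau c).

Lemma tauX c i : tau c 'X_i = 'X_i + (c i)%:MP.
Proof. by rewrite /tau comp_mpolyXU -tnth_nth tnth_mktuple. Qed.
Lemma tauC c a : tau c a%:MP = a%:MP.
Proof. exact: comp_mpolyC. Qed.
Lemma tauZ c a f : tau c (a *: f) = a *: tau c f.
Proof. exact: comp_mpolyZ. Qed.

Lemma tauK c : cancel (tau (fun i => - c i)) (tau c).
Proof.
apply: (@mpoly_rmorph_ext _ _ _ [the {rmorphism _ -> _} of tau c \o tau (fun i => - c i)]
  [the {rmorphism _ -> _} of idfun]) => [a|i] /=.
  by rewrite !tauC.
by rewrite tauX rmorphD /= tauX tauC mpolyCN addrK.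
Qed.

Lemma tau_lc m c (a : 'I_m -> A) x : tau c (\sum_i a i *: x i) = \sum_i a i *: tau c (x i).
Proof. by rewrite (rmorph_sum (tau c)); apply: eq_bigr => i _; apply: tauZ. Qed.

Let spanA f := exists a : 'I_d -> A, f = \sum_i a i *: lamX lam A i.

(** The monomials of a translate of a monomial divide it. *)
Lemma tau_lamX c i : spanA (tau c (lamX lam A i)).
Proof.
have supp m : forall m', m' \in msupp (tau c 'X_[m]) -> exists m'', m = (m' + m'')%MM.
  elim/mnm_ind: m => [|m j ih] m'.
    rewrite mpolyX0 rmorph1 msupp1 inE => /eqP ->; exists 0%MM; by rewrite addm0.
  rewrite mpolyXD rmorphM /= tauX => /msuppM_le /allpairsP [[a b] /= [/ih [m'' ->] hb ->]].
  move: hb => /msuppD_le; rewrite mem_cat msuppX inE msuppC => /orP [/eqP ->|].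
    by exists m''; rewrite -!addmA (addmC m'').
  case: (c j == 0) => //=; rewrite inE => /eqP ->; exists (m'' + U_(j))%MM.
  by rewrite addm0 addmA.
rewrite (mpolyE (tau c _)) big_seq; apply: (big_ind spanA).
- by exists (fun=> 0); rewrite big1 // => j _; rewrite scale0r.
- move=> _ _ [a ->] [b ->]; exists (fun i => a i + b i).
  by under [RHS]eq_bigr do rewrite scalerDl; rewrite big_split.
- move=> m /supp [m'' E]; have [j <-] := lam_div E.
  exists (fun l => (tau c (lamX lam A i))@_(lam j) * (l == j)%:R).
  rewrite (bigD1 j) //= eqxx mulr1 big1 ?addr0 // => l /negbTE ->.
  by rewrite mulr0 scale0r.
Qed.

Lemma translate_ideal c (J : {mpoly A[n]} -> Prop) : is_ideal J -> is_ideal (translate c J).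
Proof.
move=> hJ; split.
- by rewrite /translate -/(tau c 0) rmorph0; apply: ideal0.
- by move=> x y hx hy; rewrite /translate -/(tau c _) rmorphD; apply: idealD.
- by move=> a x hx; rewrite /translate -/(tau c _) rmorphM; apply: ideal_mull.
Qed.

Lemma translate_basis c (J : {mpoly A[n]} -> Prop) : is_ideal J -> quotient_basis J (lamX lam A) ->
  quotient_basis (translate c J) (lamX lam A).
Proof.
move=> hJ [hs hi].
have span_lc c' (a : 'I_d -> A) : spanA (tau c' (\sum_i a i *: lamX lam A i)).
  rewrite tau_lc; have /fin_all_exists [b hb] := fun i => tau_lamX c' i.
  exists (fun l => \sum_i a i * b i l).
  under [RHS]eq_bigr do rewrite scaler_suml.
  rewrite exchange_big; apply: eq_bigr => i _ /=.
  by rewrite hb scaler_sumr; apply: eq_bigr => l _; rewrite scalerA.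
split=> [f|a].
  have [a ha] := hs (tau c f); have [b hb] := span_lc (fun i => - c i) a.
  exists b; rewrite /translate -/(tau c _) -hb rmorphB /=.
  by rewrite tauK.
rewrite /translate -/(tau c _) => h; apply: (hi).
have [b hb] := span_lc c a; rewrite hb in h.
have b0 := hi _ h; suff -> : \sum_i a i *: lamX lam A i = 0 by apply: ideal0.
have tauK' : tau (fun i => - c i) (tau c (\sum_i a i *: lamX lam A i)) = \sum_i a i *: lamX lam A i.
  have := tauK (fun i => - c i) (\sum_i a i *: lamX lam A i).
  suff -> : tau (fun i => - - c i) =1 tau c by [].
  move=> f; rewrite /tau; congr (_ \mPo _); apply: eq_from_tnth => i.
  by rewrite !tnth_mktuple opprK.
rewrite -tauK' hb big1 ?rmorph0 // => i _; by rewrite b0 scale0r.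
Qed.

(** Translation by [c] identifies the quotient by the translated ideal with the
    one by the original ideal and sends multiplication by the [j]-th variable
    to multiplication by this variable plus [c j]. *)
Lemma translate_chart c (M : 'I_n -> 'M[A]_d) : chart_eqs lam i0 M ->
  exists M', [/\ chart_eqs lam i0 M',
    ideal_eq (translate c (chart_ideal i0 M)) (chart_ideal i0 M') &
    forall j, \tr (M' j) = \tr (M j) + c j *+ d].
Proof.
move=> hM; have cI := chart_ideal_ideal i0 (proj1 hM); have cb := chart_basis hM.
have tI := translate_ideal c cI; have tb := translate_basis c cI cb.
have [M' [hM' E]] := chart_exists lam0 tI tb.
exists M'; split=> // j; apply: esym.
have -> : \tr (M j) + c j *+ d = \tr (M j + (c j)%:M) by rewrite mxtraceD mxtrace_scalar.
apply: (@basis_trace_uniq _ _ _ cI _ (lamX lam A) (fun i => tau c (lamX lam A i))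
  _ _ ('X_j + (c j)%:MP)) => //.
- split=> [f|a h].
    have [b hb] := tb.1 (tau (fun i => - c i) f); exists b.
    by move: hb; rewrite /translate -/(tau c _) rmorphB /= tauK tau_lc.
  by apply: tb.2; rewrite /translate -/(tau c _) tau_lc.
- move=> i; rewrite mulrDl.
  under eq_bigr do rewrite mxE scalerDl.
  rewrite big_split /= opprD addrACA; apply: (idealD cI); first exact: chart_mult.
  rewrite (bigD1 i) //= mxE eqxx mulr1n mul_mpolyC big1 ?addr0 ?subrr; first exact: ideal0.
  by move=> l li; rewrite mxE eq_sym (negbTE li) mulr0n scale0r.
- move=> i; have /E := chart_mult hM' j i.
  rewrite /translate -/(tau c _) rmorphB rmorphM /= tauX tau_lc.
  by [].
Qed.

End Tau.

(** Where [c] becomes 0, the translated family agrees with the original one. *)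
Lemma translate_chart_base_change (A B : comNzRingType) (phi : {rmorphism A -> B})
    (c : 'I_n -> A) (M M' : 'I_n -> 'M[A]_d) :
  chart_eqs lam i0 M -> chart_eqs lam i0 M' ->
  ideal_eq (translate c (chart_ideal i0 M)) (chart_ideal i0 M') ->
  (forall j, phi (c j) = 0) -> mapM phi M =1 mapM phi M'.
Proof.
move=> hM hM' E c0; apply: (chart_uniq (chart_eqs_map phi hM)) => j i.
apply/(chart_base_change lam0 phi hM).
have /E := chart_mult hM' j i; rewrite /translate -/(tau c _) => /(base_change_mem phi).
have tE : map_mpoly phi \o tau c =1 map_mpoly phi.
  apply: (@mpoly_rmorph_ext _ _ _ [the {rmorphism _ -> _} of map_mpoly phi \o tau c]
    [the {rmorphism _ -> _} of map_mpoly phi]) => [a|l] /=; first by rewrite tauC.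
  by rewrite tauX rmorphD /= map_mpolyC /= c0 mpolyC0 addr0.
rewrite -[map_mpoly _ _]/((map_mpoly phi \o tau c) _) tE.
rewrite rmorphB rmorphM /= !map_mpolyX map_mpoly_lc.
congr (base_change _ _ (_ - _)); apply: eq_bigr => l _.
by rewrite map_mpolyX mxE.
Qed.

End Translation.

(** * Coordinate rings of the charts *)

Lemma algebra_presentation (k : fieldType) (p : nat) (rel : {mpoly k[p]} -> Prop) :
  ~ ideal_gen rel 1 ->
  exists (R : kalg k) (pi : {rmorphism {mpoly k[p]} -> R}),
    [/\ forall f, pi f = 0 <-> ideal_gen rel f,
        forall c, pi c%:MP = kalg_str R c,
        forall y, exists x, pi x = y &
        forall (A : kalg k) (g : {rmorphism {mpoly k[p]} -> A}),
          (forall c, g c%:MP = kalg_str A c) -> (forall f, rel f -> g f = 0) ->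
          exists h : khom R A, forall x, h (pi x) = g x].
Proof.
move=> h1; have [Q [pi [pi0 pis]]] := quotient_exists (ideal_gen_ideal rel) h1.
exists (KAlg [the {rmorphism k -> Q} of pi \o @mpolyC p k]), pi; split=> // A g gC grel.
have [f|h hpi] := @quotient_lift _ _ _ pi g pis.
  move/pi0; move: f; apply: ideal_gen_min => //; split; first exact: rmorph0.
    by move=> x y hx hy; rewrite rmorphD hx hy addr0.
  by move=> a x hx; rewrite rmorphM hx mulr0.
have hk c : h (kalg_str (KAlg [the {rmorphism k -> Q} of pi \o @mpolyC p k]) c) = kalg_str A c.
  by rewrite /= hpi gC.
by exists (KHom hk).
Qed.

Section CoordinateRing.
Context (k : fieldType) (n d : nat) (lam : 'I_d -> 'X_{1..n}) (i0 : 'I_d).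
Hypothesis lam0 : lam i0 = 0%MM.

Definition nvars : nat := #|{: 'I_n * 'I_d * 'I_d}|.
Definition var (j : 'I_n) (i l : 'I_d) : 'I_nvars := enum_rank (j, i, l).
Definition coord (T : Type) (F : 'I_n -> 'I_d -> 'I_d -> T) (a : 'I_nvars) : T :=
  let: (j, i, l) := enum_val a in F j i l.
(** The entry [(j, i, l)] scales with the degree of the product of the [j]-th
    variable with [lam i], minus that of [lam l]. *)
Definition cweight : 'I_nvars -> int :=
  coord (fun _ i l => (mdeg (lam i)).+1%:Z - (mdeg (lam l))%:Z).

Local Notation P := {mpoly k[nvars]}.
(** The generic matrices of multiplication by the variables. *)
Definition gmx (j : 'I_n) : 'M[P]_d := \matrix_(i, l) 'X_(var j i l).

Lemma coord_var (T : Type) (F : 'I_n -> 'I_d -> 'I_d -> T) j i l :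
  coord F (var j i l) = F j i l.
Proof. by rewrite /coord /var enum_rankK. Qed.

Lemma var_surj (a : 'I_nvars) : exists j i l, a = var j i l.
Proof.
case E : (enum_val a) => [[j i] l]; exists j, i, l.
by rewrite /var -E enum_valK.
Qed.

Definition hilb_rel (f : P) : Prop :=
  (exists j l i b, f = (gmx j *m gmx l - gmx l *m gmx j) i b) \/
  (exists i l, f = (nf i0 gmx (lamX lam P i) - delta_mx 0 i) 0 l).
Definition bar_rel (f : P) : Prop := hilb_rel f \/ exists j, f = \tr (gmx j).

Lemma kills_hilb_rel (A : comNzRingType) (g : {rmorphism P -> A}) :
  (forall f, hilb_rel f -> g f = 0) <-> chart_eqs lam i0 (mapM g gmx).
Proof.
have nfE i : nf i0 (mapM g gmx) (lamX lam A i) = map_mx g (nf i0 gmx (lamX lam P i)).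
  by rewrite -nf_map map_mpolyX.
have mulE j l : mapM g gmx j *m mapM g gmx l = map_mx g (gmx j *m gmx l).
  by apply: esym; apply: map_mxM.
split=> [h|[cM hM] f].
  split=> [j l|i].
    apply/matrixP => i b; rewrite !mulE [LHS]mxE [RHS]mxE.
    apply/eqP; rewrite -subr_eq0 -rmorphB; apply/eqP/h; left; exists j, l, i, b.
    by rewrite [RHS]mxE [X in _ = _ + X]mxE.
  rewrite nfE; apply/rowP => l; rewrite [LHS]mxE.
  apply/eqP; rewrite -subr_eq0 mxE -(rmorph_nat g) -rmorphB; apply/eqP/h; right; exists i, l.
  by rewrite [RHS]mxE [X in _ = _ + X]mxE mxE.
case=> [[j [l [i [b ->]]]]|[i [l ->]]].
  have := cM j l; rewrite !mulE => /matrixP/(_ i b); rewrite [LHS]mxE [RHS]mxE => e.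
  by rewrite mxE [X in g (_ + X)]mxE rmorphB e subrr.
have := hM i; rewrite nfE => /rowP/(_ l); rewrite [LHS]mxE mxE => e.
by rewrite mxE [X in g (_ + X)]mxE mxE rmorphB e rmorph_nat subrr.
Qed.

Lemma kills_bar_rel (A : comNzRingType) (g : {rmorphism P -> A}) :
  (forall f, bar_rel f -> g f = 0) <->
  chart_eqs lam i0 (mapM g gmx) /\ forall j, \tr (mapM g gmx j) = 0.
Proof.
have trE j : \tr (mapM g gmx j) = g (\tr (gmx j)) by rewrite /mapM -trace_map_mx.
split=> [h|[/kills_hilb_rel h1 h2] f].
  split; first by apply/kills_hilb_rel => f hf; apply: h; left.
  by move=> j; rewrite trE; apply: h; right; exists j.
by case=> [/h1 //|[j ->]]; rewrite -trE.
Qed.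

Lemma point_morphism (A : comNzRingType) (s : {rmorphism k -> A}) (M : 'I_n -> 'M[A]_d) :
  exists g : {rmorphism P -> A}, (forall c, g c%:MP = s c) /\ mapM g gmx =1 M.
Proof.
exists [the {rmorphism P -> A} of mmap s (coord (fun j i l => M j i l))].
split=> [c|j] /=; first exact: mmapC.
by apply/matrixP => i l; rewrite !mxE /= mmapX mmap1U coord_var.
Qed.

Lemma mapM_ext (A : comNzRingType) (f g : {rmorphism P -> A}) :
  (forall c, f c%:MP = g c%:MP) -> mapM f gmx =1 mapM g gmx -> f =1 g.
Proof.
move=> hC hM; apply: mpoly_rmorph_ext => // a.
have [j [i [l ->]]] := var_surj a.
by have /matrixP/(_ i l) := hM j; rewrite !mxE.
Qed.

Lemma mapM_comp (A B : comNzRingType) (f : {rmorphism P -> A}) (g : {rmorphism A -> B})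
    (h : {rmorphism P -> B}) : (forall x, h x = g (f x)) ->
  mapM g (mapM f gmx) =1 mapM h gmx.
Proof. by move=> e j; apply/matrixP => i l; rewrite !mxE e. Qed.

Let dg i : int := (mdeg (lam i))%:Z.
Let homM s (N : 'M[P]_d) := forall i l, whomog cweight (dg i + s - dg l) (N i l).

Let homM_mul s t (N N' : 'M_d) : homM s N -> homM t N' -> homM (s + t) (N *m N').
Proof.
move=> h h' i l; rewrite mxE; apply: whomog_sum => b _.
have -> : dg i + (s + t) - dg l = (dg i + s - dg b) + (dg b + t - dg l) by ring.
exact: whomogM.
Qed.

Let homM1 : homM 0 1%:M.
Proof.
move=> i l; rewrite mxE; case: eqP => [->|_]; last exact: whomog0.
by rewrite addr0 subrr -[_%:R]mpolyC1; apply: whomogC.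
Qed.

Let homM_gmx j : homM 1 (gmx j).
Proof.
move=> i l; rewrite mxE; have := whomogU k cweight (var j i l).
by rewrite /cweight coord_var /dg -addn1 PoszD.
Qed.

Let homM_mact m : homM (mdeg m)%:Z (mact gmx m).
Proof.
rewrite mdegE sumPosz /mact.
elim/big_rec2: _ => [|j N s _ h]; first exact: homM1.
apply: homM_mul => //; elim: (m j) => [|e ih]; first exact: homM1.
by rewrite exprS -addn1 PoszD addrC; apply: homM_mul.
Qed.

Lemma bar_rel_homog f : bar_rel f -> exists e, whomog cweight e f.
Proof.
case=> [[[j [l [i [b ->]]]]|[i [l ->]]]|[j ->]].
- exists (dg i + (1 + 1) - dg b); rewrite mxE [X in whomog _ _ (_ + X)]mxE.
  by apply: whomogB; apply: homM_mul; apply: homM_gmx.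
- exists (dg i - dg l); rewrite mxE [X in whomog _ _ (_ + X)]mxE.
  apply: whomogB.
    rewrite /lamX nfX -rowE mxE.
    by have := homM_mact (lam i) i0 l; rewrite {1}/dg lam0 mdeg0 add0r.
  rewrite mxE eqxx /=; case: eqP => [->|_]; last exact: whomog0.
  by rewrite subrr -[_%:R]mpolyC1; apply: whomogC.
- exists 1; apply: whomog_sum => i _.
  by have := homM_gmx j i i; rewrite addrAC subrr add0r.
Qed.

Lemma chart_barycenter (A : kalg k) (M : 'I_n -> 'M[A]_d) :
  chart_eqs lam i0 M -> (forall j, \tr (M j) = 0) ->
  bar_mem d (chart_ideal i0 M).
Proof.
move=> hM trM; split; first exact: hilb_of_chart hM.
move=> C phi e N he hN j.
have hb := chart_base_change lam0 phi hM; have hM' := chart_eqs_map phi hM.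
have -> : \tr (N j) = \tr (mapM phi M j).
  have BI := base_change_ideal phi (chart_ideal i0 M).
  apply: (basis_trace_uniq BI he _ (hN j)) => [|i].
    have [hs hi] := chart_basis hM'.
    split=> [f|a /hb ha]; last exact: (hi _ ha).
    by have [a ha] := hs f; exists a; exact: (proj2 (hb _) ha).
  by apply/hb; apply: chart_mult.
by rewrite /mapM trace_map_mx trM rmorph0 mulr0.
Qed.

Lemma barycenter_chart (A C : kalg k) (J : {mpoly A[n]} -> Prop) v (phi : khom A C)
    (M : 'I_n -> 'M[C]_d) :
  is_barycenter d J v -> chart_eqs lam i0 M ->
  ideal_eq (base_change phi J) (chart_ideal i0 M) ->
  forall j, phi (v j) = kalg_str C (d%:R^-1) * \tr (M j).
Proof.
move=> hv hM E; apply: hv => [|j i]; last exact: (proj2 (E _) (chart_mult hM j i)).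
have [hs hi] := chart_basis hM.
split=> [f|a /E ha]; last exact: (hi _ ha).
by have [a ha] := hs f; exists a; exact: (proj2 (E _) ha).
Qed.

Section AffineCharts.
Context (R : kalg k) (pi : {rmorphism P -> R}).
Hypothesis piC : forall c, pi c%:MP = kalg_str R c.
Hypothesis pis : forall y, exists x, pi x = y.

Lemma chart_map_khom (A : kalg k) (h : khom R A) (g : {rmorphism P -> A}) :
  chart_eqs lam i0 (mapM pi gmx) -> (forall x, h (pi x) = g x) ->
  ideal_eq (base_change h (chart_ideal i0 (mapM pi gmx))) (chart_ideal i0 (mapM g gmx)).
Proof.
move=> hM e f; rewrite (chart_base_change lam0 h hM f).
by apply: chart_ideal_ext; apply: mapM_comp.
Qed.

Lemma chart_mono (A : kalg k) (phi psi : khom R A) :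
  chart_eqs lam i0 (mapM pi gmx) ->
  ideal_eq (base_change phi (chart_ideal i0 (mapM pi gmx)))
           (base_change psi (chart_ideal i0 (mapM pi gmx))) -> phi =1 psi.
Proof.
move=> hM e y; have [x <-] := pis y.
pose f1 := [the {rmorphism P -> A} of phi \o pi].
pose f2 := [the {rmorphism P -> A} of psi \o pi].
suff : f1 =1 f2 by apply.
apply: mapM_ext => [c|]; first by rewrite /= piC !khom_str.
have hcomp (h : khom R A) (f : {rmorphism P -> A}) : (forall x, f x = h (pi x)) ->
    chart_eqs lam i0 (mapM f gmx).
  move=> e'; apply: chart_eqs_ext (chart_eqs_map h hM) => j.
  by rewrite (mapM_comp e').
apply: (@chart_inj _ _ lam i0 _ (mapM f1 gmx) (mapM f2 gmx)); [exact: (hcomp phi) | exact: (hcomp psi) |].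
move=> z; rewrite -(@chart_map_khom _ phi f1 hM) // e.
by rewrite (@chart_map_khom _ psi f2 hM).
Qed.

Lemma chart_spans (A : kalg k) (J : {mpoly A[n]} -> Prop) (psi : khom R A) :
  chart_eqs lam i0 (mapM pi gmx) ->
  ideal_eq (base_change psi (chart_ideal i0 (mapM pi gmx))) J -> lam_spans lam J.
Proof.
move=> hM e f; have [a ha] := (chart_basis (chart_eqs_map psi hM)).1 f.
by exists a; apply/e/(chart_base_change lam0 psi hM).
Qed.

Lemma hilb_affine_open :
  (forall f, hilb_rel f -> pi f = 0) ->
  (forall (A : kalg k) (g : {rmorphism P -> A}),
      (forall c, g c%:MP = kalg_str A c) -> (forall f, hilb_rel f -> g f = 0) ->
      exists h : khom R A, forall x, h (pi x) = g x) ->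
  affine_open (X := Hilb k n d) (R := R) (chart_ideal i0 (mapM pi gmx)).
Proof.
move=> /kills_hilb_rel hM piU; split.
- exact: (hilb_of_chart lam0 hM).
- by move=> A phi psi; apply: chart_mono.
move=> A J hJ; have [hI hF _ _] := hJ.
have [a ha] := span_open lam hI hF; exists a => A' phi; rewrite -ha; split.
  by move=> [psi e]; apply: chart_spans e.
move=> sp; have hb := span_basis hJ sp.
have [M [eM E]] := chart_exists lam0 (base_change_ideal phi J) hb.
have [g [gC gM]] := point_morphism (kalg_str A') M.
have hg : chart_eqs lam i0 (mapM g gmx).
  by apply: chart_eqs_ext eM => j; rewrite gM.
have [h hh] := piU A' g gC (proj2 (kills_hilb_rel g) hg).
exists h => f; apply: iff_trans (chart_map_khom hM hh f) _.
apply: iff_trans (iff_sym (E f)); exact: chart_ideal_ext.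
Qed.

(** Over a ring where [lam] is a basis of the quotient, a family with barycenter
    0 has matrices of trace 0, so that it comes from the chart. *)
Lemma bar_affine_open : d%:R != 0 :> k ->
  (forall f, bar_rel f -> pi f = 0) ->
  (forall (A : kalg k) (g : {rmorphism P -> A}),
      (forall c, g c%:MP = kalg_str A c) -> (forall f, bar_rel f -> g f = 0) ->
      exists h : khom R A, forall x, h (pi x) = g x) ->
  affine_open (X := Bar k n d) (R := R) (chart_ideal i0 (mapM pi gmx)).
Proof.
move=> char0 /kills_bar_rel [hM trM] piU; split.
- exact: chart_barycenter.
- by move=> A phi psi; apply: chart_mono.
move=> A J [hJ hbar]; have [hI hF _ _] := hJ.
have [a ha] := span_open lam hI hF; exists a => A' phi; rewrite -ha; split.
  by move=> [psi e]; apply: chart_spans e.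
move=> sp; have hb := span_basis hJ sp.
have [M [eM E]] := chart_exists lam0 (base_change_ideal phi J) hb.
have trM0 j : \tr (M j) = 0.
  have := barycenter_chart hbar eM E j; rewrite rmorph0.
  move/(congr1 (fun x => kalg_str A' d%:R * x)).
  by rewrite mulr0 mulrA -rmorphM divff // rmorph1 mul1r.
have [g [gC gM]] := point_morphism (kalg_str A') M.
have hg : chart_eqs lam i0 (mapM g gmx).
  by apply: chart_eqs_ext eM => j; rewrite gM.
have [|h hh] := piU A' g gC.
  by apply/kills_bar_rel; split=> // j; rewrite gM.
exists h => f; apply: iff_trans (chart_map_khom hM hh f) _.
apply: iff_trans (iff_sym (E f)); exact: chart_ideal_ext.
Qed.

End AffineCharts.
End CoordinateRing.

(** * Orbits and the negative spike *)

Lemma ideal_eq_sym (R : comNzRingType) (I J : R -> Prop) : ideal_eq I J -> ideal_eq J I.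
Proof. by move=> h x; rewrite h. Qed.
Lemma ideal_eq_trans (R : comNzRingType) (J I L : R -> Prop) :
  ideal_eq I J -> ideal_eq J L -> ideal_eq I L.
Proof. by move=> h h' x; rewrite h h'. Qed.

Section Orbits.
Context (k : fieldType) (n d : nat) (lam : 'I_d -> 'X_{1..n}) (i0 : 'I_d).
Hypothesis lam0 : lam i0 = 0%MM.
Local Notation P := {mpoly k[nvars n d]}.
Local Notation w := (cweight lam).
Local Notation gmx := (@gmx k n d).
Local Notation rel := (@bar_rel k n d lam i0).
Local Notation chart := (chart_ideal i0).

Lemma chart_bc_ext (A B : comNzRingType) (phi : {rmorphism A -> B}) (M : 'I_n -> 'M[A]_d) M' :
  chart_eqs lam i0 M -> mapM phi M =1 M' ->
  ideal_eq (base_change phi (chart M)) (chart M').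
Proof.
move=> hM e; apply: ideal_eq_trans (chart_base_change lam0 phi hM) _.
exact: chart_ideal_ext.
Qed.

Section Family.
Context (D : comNzRingType) (pi : {rmorphism P -> D}).
Hypothesis pi_neg : forall b, w b < 0 -> pi 'X_b = 0.
Hypothesis pi_rel : forall f, rel f -> pi f = 0.

Section Fam.
Context (A : comNzRingType) (iota : {rmorphism D -> A}) (s : A).

(** The orbit [s . pi] of a point [pi] of the chart.  It is defined even when
    [s] is not a unit: the absolute value in the exponent is harmless, because
    [pi] kills the variables of negative weight. *)
Definition fam : {rmorphism P -> A} :=
  [the {rmorphism P -> A} of mmap [the {rmorphism k -> A} of iota \o (pi \o @mpolyC _ k)]
    (fun a => iota (pi 'X_a) * s ^+ `|w a|)].

Lemma famU a : fam 'X_a = iota (pi 'X_a) * s ^+ `|w a|.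
Proof. by rewrite /= mmapX mmap1U. Qed.

Lemma famC c : fam c%:MP = iota (pi c%:MP).
Proof. by rewrite /= mmapC. Qed.

Lemma famX m : fam 'X_[m] = iota (pi 'X_[m]) * s ^+ `|wt w m|.
Proof.
have [/existsP [b /andP [mb wb]]|/existsPn noneg] := boolP [exists b, (m b != 0%N) && (w b < 0)].
  by rewrite (mpolyX_split k mb) rmorphM famU (rmorphM pi) pi_neg // mulr0 rmorph0 !mul0r mulr0.
have -> : `|wt w m|%N = (\sum_a `|w a| * m a)%N.
  apply/eqP; rewrite -eqz_nat gez0_abs ?sumPosz.
    apply/eqP; apply: eq_bigr => a _; rewrite -mulr_natr natz PoszM.
    have := noneg a; rewrite negb_and negbK -leNgt; case/orP => [/eqP ->|h].
      by rewrite !mulr0.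
    by rewrite gez0_abs.
  apply: sumr_ge0 => a _; have := noneg a; rewrite negb_and negbK -leNgt.
  by case/orP => [/eqP ->|h]; rewrite ?mulr0n // mulrn_wge0.
rewrite mpolyXE_id !rmorph_prod -prodrXr -big_split; apply: eq_bigr => a _.
by rewrite rmorphXn famU /= exprMn -exprM !rmorphXn.
Qed.

Lemma fam_homog e f : whomog w e f -> fam f = iota (pi f) * s ^+ `|e|.
Proof.
move=> <-; rewrite /wcomp /mlin !rmorph_sum mulr_suml; apply: eq_bigr => m _.
case: eqP => [<-|_]; last by rewrite scaler0 !rmorph0 mul0r.
by rewrite -mul_mpolyC !rmorphM famX famC /= mulrA.
Qed.

Lemma fam_rel f : rel f -> fam f = 0.
Proof.
move=> hf; have [e /fam_homog ->] := bar_rel_homog lam0 hf.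
by rewrite pi_rel // rmorph0 mul0r.
Qed.

Lemma fam_chart : chart_eqs lam i0 (mapM fam gmx) /\ forall j, \tr (mapM fam gmx j) = 0.
Proof. by apply/kills_bar_rel; apply: fam_rel. Qed.

Lemma famM j i l : mapM fam gmx j i l = iota (pi 'X_(var j i l)) * s ^+ `|w (var j i l)|.
Proof. by rewrite !mxE famU. Qed.

End Fam.

Lemma fam_scale (A : comNzRingType) (iota : {rmorphism D -> A}) (s u v : A) : u * v = 1 ->
  ideal_eq (scale u (chart (mapM (fam iota s) gmx))) (chart (mapM (fam iota (u * s)) gmx)).
Proof.
move=> uv; have [[c1 _] _] := fam_chart iota s; have [[c2 _] _] := fam_chart iota (u * s).
apply: (scale_chart lam0 uv c1 c2).
move=> j i l; rewrite !famM.
have [wn|wp] := boolP (w (var j i l) < 0); first by rewrite pi_neg // rmorph0 !mul0r mulr0.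
have e : (`|w (var j i l)| + mdeg (lam l) = (mdeg (lam i)).+1)%N.
  by move: wp; rewrite /cweight coord_var; lia.
rewrite -e exprD exprMn; move: (iota _) (u ^+ `|_|) (s ^+ _) (u ^+ _) => y1 y2 y3 y4.
by ring.
Qed.

Lemma fam_bc (A B : comNzRingType) (iota : {rmorphism D -> A}) (s : A)
    (phi : {rmorphism A -> B}) (kappa : {rmorphism D -> B}) (s' : B) :
  (forall x, kappa x = phi (iota x)) -> s' = phi s ->
  ideal_eq (base_change phi (chart (mapM (fam iota s) gmx))) (chart (mapM (fam kappa s') gmx)).
Proof.
move=> e ->; apply: chart_bc_ext; first by case: (fam_chart iota s).
move=> j; apply/matrixP => i l; rewrite [LHS]mxE !famM rmorphM rmorphXn.
by rewrite e.
Qed.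

End Family.

Section SpikeFiber.
Context (I : {mpoly k[n]} -> Prop) (Mq : 'I_n -> 'M[k]_d).
Hypothesis eqMq : chart_eqs lam i0 Mq.
Hypothesis eqI : ideal_eq I (chart Mq).
Definition qpt : 'I_(nvars n d) -> k := coord (fun j i l => Mq j i l).
Hypothesis q0 : forall a, w a != 0 -> qpt a = 0.

Section SpikePoint.
Context (D : comNzRingType) (pi : {rmorphism P -> D}).
Hypothesis pi_fib : forall f, fibrel w qpt rel f -> pi f = 0.

Let pi_neg b : w b < 0 -> pi 'X_b = 0.
Proof. by move=> wb; apply: pi_fib; left; right; exists b; rewrite /negvar wb. Qed.
Let pi_rel f : rel f -> pi f = 0.
Proof. by move=> h; apply: pi_fib; do 2 left. Qed.
Let pi_zero b : w b = 0 -> pi 'X_b = pi (qpt b)%:MP.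
Proof.
move=> wb; apply/eqP; rewrite -subr_eq0 -rmorphB; apply/eqP; apply: pi_fib.
by right; exists b; rewrite /zerovar wb eqxx.
Qed.

(** The orbit map of [iota \o pi], precomposed with multiplication by [s], where
    ['X] is the coordinate of the affine line.  Its limit at 0 is [I] because
    [pi] satisfies [fibrel]. *)
Lemma spike_point (B : kalg k) (iota : {rmorphism D -> B}) (s : B) :
  (forall c, iota (pi c%:MP) = kalg_str B c) ->
  fmem (Spike d I) (A := B)
    (chart (mapM (fam pi [the {rmorphism D -> {poly B}} of @polyC B \o iota] (s%:P * 'X)) gmx)).
Proof.
move=> strE; pose io := [the {rmorphism D -> {poly B}} of @polyC B \o iota].
have [hM trM] := fam_chart pi_neg pi_rel io (s%:P * 'X).
split; first split.
- exact: (chart_barycenter (A := poly_kalg B) lam0 hM trM).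
- move=> C phi c u v uv.
  pose kap := [the {rmorphism D -> C} of phi \o iota].
  have bc x : ideal_eq (base_change (poly_eval phi x) (chart (mapM (fam pi io (s%:P * 'X)) gmx)))
      (chart (mapM (fam pi kap (phi s * x)) gmx)).
    apply: fam_bc => // [y|] /=; first by rewrite map_polyC /= /horner_eval hornerC.
    by rewrite rmorphM /= map_polyC map_polyX /= /horner_eval hornerM hornerC hornerX.
  apply: ideal_eq_trans (bc _) _.
  have -> : phi s * (u * c) = u * (phi s * c) by rewrite mulrCA.
  apply: ideal_eq_trans (ideal_eq_sym (fam_scale pi_neg pi_rel kap _ uv)) _.
  move=> f; rewrite /scale; apply: iff_sym; exact: bc.
- rewrite /bar_pi; apply: ideal_eq_trans.
    apply: (fam_bc pi_neg pi_rel (kappa := iota) (s' := 0)) => [y|] /=.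
      by rewrite map_polyC /= /horner_eval hornerC.
    by rewrite rmorphM /= map_polyC map_polyX /= /horner_eval hornerM hornerX mulr0.
  apply: ideal_eq_trans (ideal_eq_sym (base_change_eq (kalg_str B) eqI)).
  apply: ideal_eq_sym; apply: chart_bc_ext => // j; apply/matrixP => i l.
  rewrite famM mxE -[Mq j i l]/((fun j i l => Mq j i l) j i l) -coord_var -/qpt -strE.
  have [wb|wb] := eqVneq (w (var j i l)) 0; first by rewrite wb expr0 mulr1 pi_zero.
  by rewrite (q0 wb) mpolyC0 !rmorph0 expr0n absz_eq0 (negbTE wb) mulr0.
Qed.

End SpikePoint.

Lemma unit_poly_const (D : idomainType) (p r : {poly D}) : r * p = 1 -> p = (p`_0)%:P.
Proof.
move=> e; apply: size1_polyC.
have rp : r * p != 0 by rewrite e oner_eq0.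
have := rp; rewrite mulf_eq0 negb_or => /andP [r0 p0].
have := congr1 (fun x : {poly D} => size x) e; rewrite size_mul // size_poly1.
by move: r0 p0; rewrite -!size_poly_gt0; lia.
Qed.

(** The kernel of [phi] is prime, hence maximal, so that the image of [phi] is
    a field; units of [{poly D}] are constants. *)
Lemma krull_dim0_poly (C : comNzRingType) (D : idomainType) (phi : {rmorphism C -> {poly D}}) :
  krull_dim0 C -> forall c, phi c = ((phi c)`_0)%:P.
Proof.
move=> dim0; pose K c := phi c = 0.
have KI : is_ideal K.
  rewrite /K; split; first exact: rmorph0.
    by move=> x y hx hy; rewrite rmorphD hx hy addr0.
  by move=> a x hx; rewrite rmorphM hx mulr0.
have Kp : is_prime_ideal K.
  split=> //; first by rewrite /K rmorph1 => /eqP; rewrite oner_eq0.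
  move=> x y; rewrite /K rmorphM => /eqP; rewrite mulf_eq0.
  by case/orP => /eqP; [left|right].
have [_ _ maxK] := dim0 K Kp.
move=> c; have [->|c0] := eqVneq (phi c) 0; first by rewrite coef0.
(* The ideal [K + (c)]. *)
pose L x := exists r, K (x - r * c).
have LI : is_ideal L.
  split; first by exists 0; rewrite mul0r subr0; apply: ideal0.
    move=> x y [r hr] [r' hr']; exists (r + r').
    by rewrite mulrDl opprD addrACA; apply: idealD.
  move=> a x [r hr]; exists (a * r).
  by rewrite -mulrA -mulrBr; apply: ideal_mull.
have [r hr] : L 1.
  apply: boolp.contrapT => L1.
  have LK := maxK L LI _ L1.
  have : K c by apply/LK; [move=> x Kx; exists 0; rewrite mul0r subr0 | exists 1; rewrite mul1r subrr; apply: ideal0].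
  by move/eqP; rewrite (negbTE c0).
apply: (@unit_poly_const _ _ (phi r)).
by move: hr; rewrite /K rmorphB rmorphM rmorph1 => /eqP; rewrite subr_eq0 => /eqP.
Qed.

(** If no power of ['X_a] lies in the ideal, then ['X_a] is nonzero in the
    quotient [D] by some prime.  The orbits scaled by [s] in the affine line
    form a {poly D}-point of the spike.  It comes from a map out of the
    coordinate ring [C] of the spike, which is constant in [s]; but for [s = 0]
    the family is constant along the orbit, while for [s = 1] it moves the
    coordinate [a]. *)
Lemma spike_pos_fib :
  (exists (C : kalg k) (xi : fpt (Spike d I) C), represents xi /\ krull_dim0 C) ->
  forall a, 0 < w a -> exists N, ideal_gen (fibrel w qpt rel) ('X_a ^+ N).
Proof.
move=> [C [xi [[_ rep] dim0]]] a wa; apply: boolp.contrapT => no.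
have [|Pr [Pp PI Px]] := @prime_avoiding _ (ideal_gen (fibrel w qpt rel)) 'X_a (ideal_gen_ideal _).
  by move=> N hN; apply: no; exists N.
have [D [pi pi0]] := prime_quotient_exists Pp.
have pi_fib f : fibrel w qpt rel f -> pi f = 0.
  by move=> hf; apply/pi0; apply: PI; apply: mem_ideal_gen.
have pi_neg b : w b < 0 -> pi 'X_b = 0.
  by move=> wb; apply: pi_fib; left; right; exists b; rewrite /negvar wb.
have pi_rel f : rel f -> pi f = 0 by move=> h; apply: pi_fib; do 2 left.
pose Dk : kalg k := KAlg [the {rmorphism k -> D} of pi \o @mpolyC _ k].
pose iota : {rmorphism D -> {poly D}} := [the {rmorphism D -> {poly D}} of @polyC D].
have hJ := @spike_point D pi pi_fib (poly_kalg Dk) iota 'X (fun c => erefl).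
set J := chart_ideal _ _ in hJ.
have [[phi hphi] _] := rep _ _ hJ.
have const := krull_dim0_poly phi dim0.
pose ev (c : D) : {rmorphism {poly D} -> D} := [the {rmorphism _ -> _} of horner_eval c].
have evphi c x : ev c (phi x) = ev 0 (phi x).
  by rewrite const /ev /= /horner_eval !hornerC.
pose psi : {rmorphism C -> D} := [the {rmorphism C -> D} of ev 0 \o phi].
have bc c : ideal_eq (base_change [the {rmorphism {poly C} -> {poly D}} of map_poly psi] xi)
    (chart (mapM (fam pi iota (c%:P * 'X)) gmx)).
  apply: ideal_eq_trans (base_change_comp
     (f := [the {rmorphism {poly C} -> {poly {poly D}}} of map_poly phi])
     (g := [the {rmorphism {poly {poly D}} -> {poly D}} of map_poly (ev c)]) _ _) _.
    move=> x /=; apply/polyP => i; rewrite !coef_map /=.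
    by rewrite -[RHS]/(ev c (phi x`_i)) evphi.
  apply: ideal_eq_trans (base_change_eq _ hphi) _.
  apply: fam_bc => // [y|] /=; first by rewrite map_polyC /= /horner_eval hornerC.
  by rewrite rmorphM /= map_polyC map_polyX /= /horner_eval hornerX.
have [h0 _] := fam_chart pi_neg pi_rel iota (0%:P * 'X).
have [h1 _] := fam_chart pi_neg pi_rel iota (1%:P * 'X).
have E := chart_inj h1 h0 (ideal_eq_trans (ideal_eq_sym (bc 1)) (bc 0)).
have [j [i [l aE]]] := var_surj a.
have := congr1 (fun x : 'M_d => x i l) (E j); rewrite !famM -aE.
rewrite mul0r mul1r expr0n absz_eq0 gt_eqF // mulr0 => /(congr1 (fun x : {poly D} => x`_(`|w a|%N))).
rewrite coefCM coefXn eqxx mulr1 coef0 => /pi0.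
by have := Px 1%N; rewrite expr1.
Qed.

End SpikeFiber.
End Orbits.

(** * Tangent vectors *)

(** Nakayama's lemma for the square-zero ideal of the dual numbers: up to the
    span of [lam], everything is a multiple of [eps], and then of
    [eps * eps = 0]. *)
Lemma dual_span (k : comNzRingType) (n d : nat) (lam : 'I_d -> 'X_{1..n})
    (J : {mpoly (dual k)[n]} -> Prop) : is_ideal J ->
  lam_spans lam (base_change [the {rmorphism dual k -> k} of @dual0 k] J) -> lam_spans lam J.
Proof.
move=> hJ sp.
pose eps : dual k := (0, 1).
pose d0 := [the {rmorphism dual k -> k} of @dual0 k].
pose dC := [the {rmorphism k -> dual k} of @dualC k].
have step f : exists (a : 'I_d -> dual k) (h : {mpoly (dual k)[n]}),
    J (f - \sum_i a i *: lamX lam (dual k) i - eps *: h).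
  have [a ha] := sp (map_mpoly d0 f).
  have [m [b [g [Jg gE]]]] := base_change_lc hJ ha.
  pose F := f - \sum_i dC (a i) *: lamX lam (dual k) i - \sum_i dC (b i) *: g i.
  exists (fun i => dC (a i)), (map_mpoly dC (\sum_(m <- msupp F) (F@_m).2 *: 'X_[m])).
  have F0 : map_mpoly d0 F = 0.
    rewrite !rmorphB /= !map_mpoly_lc; apply/eqP; rewrite subr_eq0; apply/eqP.
    under eq_bigr do rewrite map_mpolyX.
    by rewrite gE.
  have FE : eps *: map_mpoly dC (\sum_(mu <- msupp F) (F@_mu).2 *: 'X_[mu]) = F.
    apply/mpolyP => mu; rewrite mcoeffZ mcoeff_map_mpoly raddf_sum /=.
    have -> : \sum_(i <- msupp F) ((F@_i).2 *: 'X_[i])@_mu = (F@_mu).2.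
      under eq_bigr do rewrite mcoeffZ mcoeffX.
      have [mF|mF] := boolP (mu \in msupp F).
        rewrite (bigD1_seq mu) //= eqxx mulr1 big1 ?addr0 //.
        by move=> i /negbTE ->; rewrite mulr0.
      rewrite big_seq big1 => [|i iF]; first by rewrite memN_msupp_eq0.
      by case: eqP => [E|_]; [rewrite -E iF in mF | rewrite mulr0].
    have := congr1 (mcoeff mu) F0; rewrite mcoeff_map_mpoly mcoeff0 /= /dual0.
    case: (F@_mu) => x y /= ->; congr pair => /=; first by rewrite mul0r.
    by rewrite mul0r add0r mul1r.
  rewrite FE /F opprB addrC subrK; apply: ideal_sum => // i _; exact: idealZ.
move=> f; have [a [h ha]] := step f; have [b [h' hb]] := step h.
exists (fun i => a i + eps * b i).
under eq_bigr do rewrite scalerDl -scalerA.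
rewrite big_split -scaler_sumr opprD addrA.
rewrite -(subrKA (eps *: h)) -scalerBr; apply: idealD => //.
have e0 : eps * eps = 0.
  by congr pair => /=; rewrite ?mul0r ?mulr0 ?addr0.
have e1 : eps *: (eps *: h') = 0.
  by rewrite -!mul_mpolyC mulrA -mpolyCM e0 mpolyC0 mul0r.
have -> : eps *: (h - \sum_i b i *: lamX lam (dual k) i) =
    eps *: (h - \sum_i b i *: lamX lam (dual k) i - eps *: h').
  by rewrite [RHS]scalerBr e1 subr0.
exact: idealZ.
Qed.

Section Tangent.
Context (k : fieldType) (n d : nat) (lam : 'I_d -> 'X_{1..n}) (i0 : 'I_d).
Hypothesis lam0 : lam i0 = 0%MM.
Local Notation P := {mpoly k[nvars n d]}.
Local Notation w := (cweight lam).
Local Notation gmx := (@gmx k n d).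
Local Notation rel := (@bar_rel k n d lam i0).
Local Notation chart := (chart_ideal i0).
Context (I : {mpoly k[n]} -> Prop) (Mq : 'I_n -> 'M[k]_d).
Hypothesis eqMq : chart_eqs lam i0 Mq.
Hypothesis trMq : forall j, \tr (Mq j) = 0.
Hypothesis eqI : ideal_eq I (chart Mq).
Local Notation q := (qpt Mq).
Hypothesis q0 : forall a, w a != 0 -> q a = 0.

Lemma qptE j i l : q (var j i l) = Mq j i l.
Proof. exact: coord_var. Qed.

Definition eval_q : {rmorphism P -> k} := [the {rmorphism P -> k} of meval q].

Lemma eval_qM : mapM eval_q gmx =1 Mq.
Proof. by move=> j; apply/matrixP => i l; rewrite !mxE /= mevalXU qptE. Qed.

Lemma rel_q f : rel f -> f.@[q] = 0.
Proof.
move=> hf; suff : eval_q f = 0 by [].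
move: f hf; apply/kills_bar_rel; split; first exact: chart_eqs_ext eval_qM _.
by move=> j; rewrite eval_qM.
Qed.

Definition tangent_map (t : 'I_(nvars n d) -> k) : {rmorphism P -> dual k} :=
  [the {rmorphism P -> dual k} of mmap [the {rmorphism k -> dual k} of @dualC k]
    (fun a => (q a, t a) : dual k)].

Lemma tangent_mapE t f : tangent_map t f = (f.@[q], \sum_b t b * dq q b f).
Proof.
elim/mpoly_ring_ind: f => [c|a|f g hf hg|f g hf hg].
- rewrite /= mmapC mevalC big1 // => b _; by rewrite dqC mulr0.
- rewrite /= mmapX mmap1U mevalXU (bigD1 a) //= dqX eqxx mulr1 big1 ?addr0 // => b.
  by rewrite dqX eq_sym => /negbTE ->; rewrite mulr0.
- rewrite rmorphD hf hg mevalD; congr pair; rewrite /= -big_split.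
  by apply: eq_bigr => b _; rewrite dqD mulrDr.
- rewrite rmorphM hf hg mevalM; congr pair; rewrite /= mulr_sumr mulr_suml -big_split.
  by apply: eq_bigr => b _ /=; rewrite dqM; ring.
Qed.

Definition tangent_vector (t : 'I_(nvars n d) -> k) : Prop :=
  forall f, rel f -> \sum_b t b * dq q b f = 0.

Lemma tangent_mapM t j i l : mapM (tangent_map t) gmx j i l = (q (var j i l), t (var j i l)).
Proof. by rewrite !mxE /= mmapX mmap1U. Qed.

Lemma tangent_vector_chart t :
  tangent_vector t <->
  chart_eqs lam i0 (mapM (tangent_map t) gmx) /\ forall j, \tr (mapM (tangent_map t) gmx j) = 0.
Proof.
apply: iff_trans (kills_bar_rel lam i0 (tangent_map t)).
split=> h f /[dup] hf /h; rewrite tangent_mapE; first by move=> ->; rewrite rel_q.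
by case.
Qed.

Lemma tangent_chart t : tangent_vector t -> tangent d I (chart (mapM (tangent_map t) gmx)).
Proof.
move=> /tangent_vector_chart [hM trM]; split.
  exact: (chart_barycenter (A := dual_kalg k) lam0 hM trM).
apply: ideal_eq_trans (ideal_eq_sym eqI); apply: (chart_bc_ext lam0) => // j.
by apply/matrixP => i l; rewrite mxE tangent_mapM -qptE.
Qed.

(** Scaling multiplies the coordinate [t b] by the power [w b] of the scalar,
    and leaves [q] unchanged. *)
Lemma tangent_chart_deg (e : int) t : tangent_vector t -> (forall b, w b != e -> t b = 0) ->
  tangent_deg d I (- e) (chart (mapM (tangent_map t) gmx)).
Proof.
move=> ht te; split; first exact: tangent_chart.
move=> s s0; have [hM _] := (proj1 (tangent_vector_chart t) ht).
have hM' := chart_eqs_map [the {rmorphism dual k -> dual k} of dual_scale (s ^ (- - e))] hM.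
apply: ideal_eq_trans (ideal_eq_sym (chart_base_change lam0 _ hM)).
have uv : dualC s * dualC s^-1 = 1.
  by rewrite -(rmorphM [the {rmorphism k -> dual k} of @dualC k]) divff // rmorph1.
apply: (scale_chart lam0 uv (proj1 hM) (proj1 hM')) => j i l.
rewrite mxE !tangent_mapM opprK.
have dX m : dualC s ^+ m = dualC (s ^+ m).
  by rewrite (rmorphXn [the {rmorphism k -> dual k} of @dualC k]).
rewrite !dX; set a := var j i l.
have wa : w a = (mdeg (lam i)).+1%:Z - (mdeg (lam l))%:Z by rewrite /cweight coord_var.
congr pair; rewrite /= ?mulr0 ?mul0r ?add0r ?addr0.
  have [wa0|/q0 ->] := eqVneq (w a) 0; last by rewrite mul0r mulr0.
  by rewrite mulrC; congr (s ^+ _ * _); lia.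
have [wae|/te ->] := eqVneq (w a) e; last by rewrite !(mulr0, mul0r).
rewrite mulrAC; congr (_ * _).
by rewrite -[s ^+ _.+1]/(s ^ (mdeg (lam i)).+1) -[s ^+ _]/(s ^ (mdeg (lam l))) -expfzDr // -wae wa subrK.
Qed.

(** First-order deformations of [I] stay in the chart, as [lam] still spans the
    quotient. *)
Lemma tangent_exists J : d%:R != 0 :> k -> tangent d I J ->
  exists t, tangent_vector t /\ ideal_eq J (chart (mapM (tangent_map t) gmx)).
Proof.
move=> char0 [[hJ hbar] JI]; have [Ji _ _ _] := hJ.
pose id2 := [the {rmorphism dual k -> dual k} of @idfun (dual k)].
have Jid : ideal_eq (base_change id2 J) J by apply: base_change_id.
have sp : lam_spans lam J.
  apply: dual_span => // f; have [a ha] := (chart_basis eqMq).1 f.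
  by exists a; apply/JI/eqI.
have hb : quotient_basis J (lamX lam (dual k)).
  have [|hs hi] := @span_basis _ _ lam _ _ id2 J hJ.
    by move=> f; have [a ha] := sp f; exists a; apply/Jid.
  by split=> // a ha; apply: hi; apply/Jid.
have [M [eM E]] := chart_exists lam0 Ji hb.
pose t := coord (fun j i l => (M j i l).2).
have qM : mapM [the {rmorphism dual k -> k} of @dual0 k] M =1 Mq.
  apply: (chart_inj (chart_eqs_map _ eM) eqMq).
  apply: ideal_eq_trans (ideal_eq_sym (chart_base_change lam0 _ eM)) _.
  apply: ideal_eq_trans (ideal_eq_trans JI eqI).
  exact/base_change_eq/ideal_eq_sym.
have tM : mapM (tangent_map t) gmx =1 M.
  move=> j; apply/matrixP => i l; rewrite tangent_mapM /t coord_var qptE -qM mxE /= /dual0.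
  by case: (M j i l).
exists t; split; last by apply: ideal_eq_trans E _; apply: chart_ideal_ext => j; rewrite tM.
apply/tangent_vector_chart; split; first exact: chart_eqs_ext tM eM.
move=> j; rewrite tM.
have eid : ideal_eq (base_change id2 J) (chart M) by apply: ideal_eq_trans Jid E.
have kid c : id2 (kalg_str (dual_kalg k) c) = kalg_str (dual_kalg k) c by [].
pose id3 : khom (dual_kalg k) (dual_kalg k) := @KHom k (dual_kalg k) (dual_kalg k) id2 kid.
have := @barycenter_chart k n d lam i0 (dual_kalg k) (dual_kalg k) J _ id3 M hbar eM eid j.
rewrite rmorph0 => /(congr1 (fun x => kalg_str (dual_kalg k) d%:R * x)).
by rewrite mulr0 mulrA -rmorphM divff // rmorph1 mul1r.
Qed.

(** The derivative at [q] of [s * 'X_a] along [t] is the left-hand side, since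
    [q a = 0]. *)
Lemma tangent_locally t s a : tangent_vector t -> ideal_gen rel (s * 'X_a) ->
  w a != 0 -> s.@[q] * t a = 0.
Proof.
move=> ht hs wa.
have := K_dq rel_q ht hs => <-.
under eq_bigr do rewrite dqM mevalXU (q0 wa) mulr0 add0r dqX.
rewrite (bigD1 a) //= eqxx mulr1 big1 ?addr0; first by rewrite mulrC.
by move=> b; rewrite eq_sym => /negbTE ->; rewrite !mulr0.
Qed.

Lemma tangent_zero_chart t : tangent_vector t ->
  ideal_eq (chart (mapM (tangent_map t) gmx)) (tangent_zero I) -> forall b, t b = 0.
Proof.
move=> ht E b; have [hM _] := (proj1 (tangent_vector_chart t) ht).
have [j [i [l ->]]] := var_surj b.
pose dC := [the {rmorphism k -> dual k} of @dualC k].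
have E' : ideal_eq (tangent_zero I) (chart (mapM dC Mq)).
  apply: ideal_eq_trans (base_change_eq dC eqI) _; exact: (chart_base_change lam0 dC eqMq).
have := chart_inj hM (chart_eqs_map dC eqMq) (ideal_eq_trans E E') j.
by move/matrixP/(_ i l); rewrite tangent_mapM mxE => -[].
Qed.

End Tangent.

(** Scaling the multiplication rules by 2 changes the coefficient of [lam l] by
    a factor [2 ^ w], which differs from 1 in characteristic 0 when [w] is not
    0. *)
Lemma gm_fixed_weight (k : fieldType) (n d : nat) (lam : 'I_d -> 'X_{1..n}) (i0 : 'I_d)
    (I : {mpoly k[n]} -> Prop) (Mq : 'I_n -> 'M[k]_d) :
  [pchar k] =i pred0 -> lam i0 = 0%MM -> chart_eqs lam i0 Mq -> is_ideal I ->
  ideal_eq I (chart_ideal i0 Mq) -> Gm_fixed I ->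
  forall a, cweight lam a != 0 -> qpt Mq a = 0.
Proof.
move=> char0 lam0 hM hI E fixI a.
have [j [i [l ->]]] := var_surj a; rewrite /cweight /qpt !coord_var => wa.
have scaleX (m : 'X_{1..n}) :
    'X_[m] \mPo [tuple 2%:R *: 'X_i | i < n] = 2%:R ^+ mdeg m *: 'X_[m] :> {mpoly k[n]}.
  elim/mnm_ind: m => [|m b ih]; first by rewrite mpolyX0 comp_mpoly1 mdeg0 expr0 scale1r.
  rewrite mpolyXD rmorphM /= ih comp_mpolyXU -tnth_nth tnth_mktuple mdegD mdeg1 addn1.
  by rewrite -scalerAl -scalerAr scalerA -exprSr.
have two0 : (2%:R : k) != 0 by rewrite (pcharf0P k).1.
pose f := 'X_j * lamX lam k i - \sum_l Mq j i l *: lamX lam k l.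
have If : I f by apply/E; apply: chart_mult.
have fE : f \mPo [tuple 2%:R *: 'X_i | i < n] =
    2%:R ^+ (mdeg (lam i)).+1 *: ('X_j * lamX lam k i)
    - \sum_l (Mq j i l * 2%:R ^+ mdeg (lam l)) *: lamX lam k l.
  rewrite /f /lamX -mpolyXD comp_mpolyB scaleX mdegD mdeg1 add1n; congr (_ - _).
  rewrite (raddf_sum (comp_mpoly _)); apply: eq_bigr => b _.
  by rewrite /= comp_mpolyZ scaleX scalerA.
have If2 : I (f \mPo [tuple 2%:R *: 'X_i | i < n]).
  have uv : (2%:R : k) * 2%:R^-1 = 1 by rewrite divff.
  have := fixI (base_kalg k) 2%:R 2%:R^-1 uv f.
  have Iid := base_change_id (f := [the {rmorphism k -> k} of idfun]) hI (fun x => erefl).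
  by rewrite /scale => h; apply/Iid/h/Iid.
have := idealB hI If2 (idealZ hI (2%:R ^+ (mdeg (lam i)).+1) If).
rewrite fE /f scalerBr opprB addrC subrKA scaler_sumr -sumrB.
under eq_bigr do rewrite scalerA -scalerBl.
move=> /E /(chart_basis hM).2 /(_ l) /eqP.
rewrite [in X in _ - X]mulrC -mulrBl mulf_eq0 => /orP [|/eqP //].
rewrite subr_eq0 -!natrX => /eqP e; exfalso.
have natI x y : (x <= y)%N -> x%:R = y%:R :> k -> x = y.
  move=> xy /eqP; rewrite eq_sym -subr_eq0 -natrB // (pcharf0P k).1 // subn_eq0 => yx.
  by apply/eqP; rewrite eqn_leq xy yx.
have : (2 ^ (mdeg (lam i)).+1 = 2 ^ mdeg (lam l))%N.
  by case: (leqP (2 ^ (mdeg (lam i)).+1) (2 ^ mdeg (lam l))) => [|/ltnW] /natI h; [|apply: esym]; apply: h.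
by move=> /(@expnI 2 isT) e'; move: wa; rewrite e' subrr eqxx.
Qed.

(** * Hedgehog points *)

Section Hedgehog.
Context (k : fieldType) (n d : nat) (lam : 'I_d -> 'X_{1..n}) (i0 : 'I_d).
Hypothesis lam0 : lam i0 = 0%MM.
Hypothesis char0 : d%:R != 0 :> k.
Local Notation P := {mpoly k[nvars n d]}.
Local Notation w := (cweight lam).
Local Notation gmx := (@gmx k n d).
Local Notation rel := (@bar_rel k n d lam i0).
Local Notation chart := (chart_ideal i0).
Context (I : {mpoly k[n]} -> Prop) (Mq : 'I_n -> 'M[k]_d).
Hypothesis eqMq : chart_eqs lam i0 Mq.
Hypothesis trMq : forall j, \tr (Mq j) = 0.
Hypothesis eqI : ideal_eq I (chart Mq).
Local Notation q := (qpt Mq).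
Hypothesis q0 : forall a, w a != 0 -> q a = 0.

(** The polynomial [f] is the coordinate ['X_a] along which some tangent vector
    not of degree 0 moves. *)
Lemma hedgehog_nilpotent : hedgehog d I ->
  exists f N, (exists2 s : P, s.@[q] = 1 & ideal_gen rel (s * f ^+ N)) /\
    forall s : P, s.@[q] != 0 -> ~ ideal_gen rel (s * f).
Proof.
case=> _ _ hpos hnt hdim.
have [J hJ nJ] := hnt.
have [t [ht Jt]] := tangent_exists lam0 eqMq trMq eqI char0 hJ.
have tpos (e : int) u : e < 0 -> (forall b, w b != e -> u b = 0) ->
    (forall f, rel f -> \sum_b u b * dq q b f = 0) -> forall b, u b = 0.
  move=> e0 ue hu; apply: (tangent_zero_chart lam0 eqMq trMq eqI hu).
  apply: (hpos (- e)); first by rewrite oppr_gt0.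
  exact: (tangent_chart_deg lam0 eqMq trMq eqI q0).
have [a wa ta] : exists2 a, w a != 0 & t a != 0.
  apply: boolp.contrapT => no; apply: nJ.
  have := tangent_chart_deg lam0 eqMq trMq eqI q0 (e := 0) ht.
  case=> [b wb|_ h].
    by apply/eqP; apply: contraT => tb; case: no; exists b.
  split=> // s /h; rewrite oppr0 => hs.
  apply: ideal_eq_trans (ideal_eq_trans _ hs) _; last first.
    exact/base_change_eq/ideal_eq_sym.
  by move=> f; apply: Jt.
have [s [T [hs hT]]] := locally_nilpotent q0 (bar_rel_homog lam0) tpos
  (spike_pos_fib lam0 eqMq eqI q0 hdim) wa.
exists 'X_a, T; split; first by exists s.
move=> s' hs' h; have /eqP := tangent_locally eqMq trMq q0 ht h wa.
by rewrite mulf_eq0 (negbTE hs') (negbTE ta).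
Qed.

Lemma hedgehog_bar_nonreduced : hedgehog d I -> nonreduced_point (X := Bar k n d) I.
Proof.
move=> hI.
have eval_rel f : rel f -> eval_q Mq f = 0 by exact: (rel_q eqMq trMq).
have proper : ~ ideal_gen rel 1.
  by move=> /(K_q eval_rel); rewrite meval1 => /eqP; rewrite oner_eq0.
have [R [pi [pi0 piC pis piU]]] := algebra_presentation proper.
have [e he] := piU (base_kalg k) (eval_q Mq) (fun c => mevalC _ c) eval_rel.
have pirel f : rel f -> pi f = 0 by move=> hf; apply/pi0; apply: mem_ideal_gen.
exists R, (chart (mapM pi gmx)), e; split.
- exact: (bar_affine_open lam0 piC pis char0 pirel piU).
- have [hM _] := (proj1 (kills_bar_rel lam i0 pi) pirel).
  apply: ideal_eq_trans (ideal_eq_sym eqI).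
  apply: ideal_eq_trans (chart_map_khom lam0 hM he) _.
  exact/chart_ideal_ext/eval_qM.
have [f [N [[s hs hf] nf]]] := hedgehog_nilpotent hI.
exists (pi f), N; split.
  exists (pi s); first by rewrite he /= hs oner_eq0.
  by rewrite -rmorphXn -rmorphM; apply/pi0.
move=> [y]; have [x <-] := pis y; rewrite he => hx; rewrite -rmorphM => /pi0.
exact: nf.
Qed.

Hypothesis lam_div : forall i m m', lam i = (m + m')%MM -> exists j, lam j = m.
Local Notation hrel := (@hilb_rel k n d lam i0).

(** Let [B] and [H] be the coordinate rings of the charts, with [pr : H -> B] the
    restriction to barycenter 0.  Translating the universal family over [H] to
    barycenter 0 gives [h : B -> H] with [pr \o h] the identity, so that [h]
    preserves non-vanishing in the local rings. *)
Lemma hedgehog_hilb_nonreduced : hedgehog d I -> nonreduced_point (X := Hilb k n d) I.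
Proof.
move=> hI.
have eval_rel f : rel f -> eval_q Mq f = 0 by exact: (rel_q eqMq trMq).
have properB : ~ ideal_gen rel 1.
  by move=> /(K_q eval_rel); rewrite meval1 => /eqP; rewrite oner_eq0.
have properH : ~ ideal_gen hrel 1 by move=> h; apply: properB; apply: ideal_genS h => f; left.
have [B [piB [piB0 piBC piBs piBU]]] := algebra_presentation properB.
have [H [piH [piH0 piHC piHs piHU]]] := algebra_presentation properH.
have piBrel f : rel f -> piB f = 0 by move=> hf; apply/piB0; apply: mem_ideal_gen.
have piHrel f : hrel f -> piH f = 0 by move=> hf; apply/piH0; apply: mem_ideal_gen.
have [eB heB] := piBU (base_kalg k) (eval_q Mq) (fun c => mevalC _ c) eval_rel.
have [pr hpr] := piHU B piB piBC (fun f h => piBrel f (or_introl h)).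
have [hMB trB] := (proj1 (kills_bar_rel lam i0 piB) piBrel).
have hMH := (proj1 (kills_hilb_rel lam i0 piH) piHrel).
(* Translating by the opposite of the barycenter. *)
pose c j := - (kalg_str H d%:R^-1 * \tr (mapM piH gmx j)).
have [M' [hM' E' trM']] := translate_chart lam0 lam_div c hMH.
have trM0 j : \tr (M' j) = 0.
  rewrite trM' /c mulNrn -[X in - X]mulr_natl mulrA.
  by rewrite -(rmorph_nat (kalg_str H)) -rmorphM divff // rmorph1 mul1r subrr.
have [rho [rhoC rhoM]] := point_morphism (kalg_str H) M'.
have rhorel f : rel f -> rho f = 0.
  move: f; apply/kills_bar_rel; split; first exact: chart_eqs_ext rhoM hM'.
  by move=> j; rewrite rhoM.
have [h hh] := piBU H rho rhoC rhorel.
have prpi : forall j, mapM pr (mapM piH gmx) j = mapM piB gmx j by apply: mapM_comp => x; rewrite hpr.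
have prc j : pr (c j) = 0.
  rewrite /c rmorphN rmorphM; have -> : pr (\tr (mapM piH gmx j)) = \tr (mapM piB gmx j).
    by rewrite -prpi; apply: esym; exact: trace_map_mx.
  by rewrite trB mulr0 oppr0.
have prrho : forall x, pr (rho x) = piB x.
  apply: (@mapM_ext _ _ _ _ [the {rmorphism P -> B} of pr \o rho] piB) => [a|j] /=.
    by rewrite rhoC khom_str piBC.
  have := translate_chart_base_change lam0 hMH hM' E' prc j.
  rewrite prpi => ->; apply/matrixP => i l.
  by rewrite !mxE /= -rhoM !mxE.
have prh y : pr (h y) = y by have [x <-] := piBs y; rewrite hh prrho.
pose eH : khom H (base_kalg k) := @KHom k H (base_kalg k)
  [the {rmorphism H -> k} of eB \o pr] (fun a => etrans (congr1 eB (khom_str pr a)) (khom_str eB a)).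
exists H, (chart (mapM piH gmx)), eH; split.
- exact: (hilb_affine_open lam0 piHC piHs piHrel piHU).
- apply: ideal_eq_trans (ideal_eq_sym eqI).
  have heH x : eH (piH x) = eval_q Mq x by rewrite /= hpr heB.
  apply: ideal_eq_trans (chart_map_khom lam0 hMH heH) _.
  exact/chart_ideal_ext/eval_qM.
have [f [N [[s hs hf] nf]]] := hedgehog_nilpotent hI.
exists (h (piB f)), N; split.
  exists (h (piB s)); first by rewrite /= prh heB /= hs oner_eq0.
  rewrite -rmorphXn -rmorphM -(rmorphXn piB) -(rmorphM piB).
  by rewrite (proj2 (piB0 _) hf) rmorph0.
move=> [y hy] /(congr1 pr); rewrite rmorphM prh rmorph0.
have [x ex] := piBs (pr y); rewrite -ex -rmorphM => /piB0.
by apply: nf; move: hy; rewrite /= -ex heB.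
Qed.

End Hedgehog.

Theorem theorem1p3 (k : closedFieldType) (n d : nat) (I : {mpoly k[n]} -> Prop)
    (char0 : [pchar k] =i pred0) (n_gt0 : (0 < n)%N) (d_gt0 : (0 < d)%N)
    (hI : hedgehog d I) :
  nonreduced_point (X := Bar k n d) I /\
  nonreduced_point (X := Hilb k n d) (translate (fun=> 0) I).
Proof.
have d0 : d%:R != 0 :> k by rewrite (pcharf0P k).1 // -lt0n.
have [[Ii _ _ rk] hbar] := hedgehog_mem hI.
have Iid := base_change_id (f := [the {rmorphism k -> k} of idfun]) Ii (fun x => erefl).
have [e [hs hi]] := rk k [the {rmorphism k -> k} of idfun].
have he : quotient_basis I e.
  split=> [f|a ha]; last by apply: hi; apply/Iid.
  by have [a ha] := hs f; exists a; apply/Iid.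
have [lam [i0 [lam0 hb lam_div]]] := standard_basis Ii d_gt0 (ex_intro _ e he).
have [Mq [eqMq eqI]] := chart_exists lam0 Ii hb.
have kid c : idfun (kalg_str (base_kalg k) c) = kalg_str (base_kalg k) c by [].
pose kidh : khom (base_kalg k) (base_kalg k) :=
  @KHom k (base_kalg k) (base_kalg k) [the {rmorphism k -> k} of idfun] kid.
have trMq j : \tr (Mq j) = 0.
  have := @barycenter_chart k n d lam i0 (base_kalg k) (base_kalg k) I _ kidh Mq hbar eqMq
    (ideal_eq_trans Iid eqI) j.
  rewrite /= => /esym/eqP; rewrite mulf_eq0 invr_eq0 (negbTE d0) => /eqP //.
have q0 := gm_fixed_weight char0 lam0 eqMq Ii eqI (hedgehog_fixed hI).
split; first exact: (hedgehog_bar_nonreduced lam0 d0 eqMq trMq eqI q0 hI).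
have [R [xi [v [ho hx hr]]]] := hedgehog_hilb_nonreduced lam0 d0 eqMq trMq eqI q0 lam_div hI.
exists R, xi, v; split=> //; apply: ideal_eq_trans hx _ => f.
rewrite /translate; suff -> : [tuple 'X_i + (0 : k)%:MP | i < n] = [tuple 'X_i | i < n] :> n.-tuple {mpoly k[n]}.
  by rewrite comp_mpoly_id.
by apply: eq_from_tnth => i; rewrite !tnth_mktuple mpolyC0 addr0.
Qed.
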